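(* Let $s\ge 3$ be a real number and let $\mu>\delta>0$. Let $\varphi^{(0)}\in H^{s}(\mathbb T)$, $\varphi^{(1)}\in H^{s-1}(\mathbb T)$ and let $\{\varphi^{(0)}_n\}_{n\in\mathbb N}\subset H^s(\mathbb T)$, $\{\varphi^{(1)}_n\}_{n\in\mathbb N}\subset H^{s-1}(\mathbb T)$ be sequences, where all the functions $\varphi^{(0)},\varphi^{(1)},\varphi^{(0)}_n,\varphi^{(1)}_n$ have zero spatial mean. Assume that, as $n\to+\infty$, $\varphi^{(0)}_n\to\varphi^{(0)}$ strongly in $H^s(\mathbb T)$ and $\varphi^{(1)}_n\to\varphi^{(1)}$ strongly in $H^{s-1}(\mathbb T)$. Let $T>0$ and $I=[0,T]$. Consider the equation $$\varphi_{tt}-\mu\varphi_{xx}=\Big(\tfrac12\mathbb H[\phi^2]_{xx}+\phi\,\varphi_{xx}\Big)_{x},\qquad \phi=\mathbb H[\varphi],\qquad (t,x)\in I\times\mathbb T. \tag{E}$$ Assume that there exists a unique solution $\varphi\in C(I;H^s(\mathbb T))\cap C^1(I;H^{s-1}(\mathbb T))$ of (E) with initial data $\varphi|_{t=0}=\varphi^{(0)}$, $\partial_t\varphi|_{t=0}=\varphi^{(1)}$, and that for every $n$ there exists a unique solution $\varphi_n\in C(I;H^s(\mathbb T))\cap C^1(I;H^{s-1}(\mathbb T))$ of (E) with initial data $\varphi_n|_{t=0}=\varphi^{(0)}_n$, $\partial_t\varphi_n|_{t=0}=\varphi^{(1)}_n$. Assume moreover that there is a constant $C_2>0$, independent of $n$,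 such that for all $t\in I$ $$\mu-2\,\mathbb H[\varphi]_x\ge\delta,\qquad \|\varphi(t)\|^2_{H^s}+\|\varphi_t(t)\|^2_{H^{s-1}}\le C_2\big(\|\varphi^{(0)}\|^2_{H^s}+\|\varphi^{(1)}\|^2_{H^{s-1}}\big),$$ and for all $n$ and all $t\in I$ $$\mu-2\,\mathbb H[\varphi_n]_x\ge\delta,\qquad \|\varphi_n(t)\|^2_{H^s}+\|(\varphi_n)_t(t)\|^2_{H^{s-1}}\le C_2\big(\|\varphi_n^{(0)}\|^2_{H^s}+\|\varphi_n^{(1)}\|^2_{H^{s-1}}\big).$$ Then $\varphi_n\to\varphi$ strongly in $C(I;H^s(\mathbb T))\cap C^1(I;H^{s-1}(\mathbb T))$ as $n\to+\infty$.
   Context: $\mathbb T=\mathbb R/(2\pi\mathbb Z)$. The unknowns are scalar (real-valued) functions of $(t,x)$. $\mathbb H$ is the Hilbert transform in $x$, i.e. the Fourier multiplier $\widehat{\mathbb H[f]}(k)=-i\,\mathrm{sgn}(k)\widehat f(k)$, $k\in\mathbb Z$, with $\mathrm{sgn}(0)=0$, where $\widehat f(k)=\frac1{2\pi}\int_{\mathbb T}f(x)e^{-ikx}dx$. $H^s=H^s(\mathbb T)$ is the Sobolev space with norm $\|f\|_{H^s}^2=\sum_{k\in\mathbb Z}(1+|k|^2)^{s}|\widehat f(k)|^2$. $C^j(I;X)$ is the space of $j$ times continuously differentiable functions $I\to X$ with its usual norm. The inequalities $\mu-2\,\mathbb H[\varphi]_x\ge\delta$ are understood for all $(t,x)\in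 I\times\mathbb T$. $T$ is arbitrary. *)

(* Defs.v *)
From HB Require Import structures.
From mathcomp Require Import all_boot all_order all_algebra.
From mathcomp Require Import all_classical all_reals all_analysis.
From mathcomp.real_closed Require Import complex.

Set Implicit Arguments.
Unset Strict Implicit.
Unset Printing Implicit Defensive.
Import Order.TTheory GRing.Theory Num.Theory.
Import numFieldNormedType.Exports.
Local Open Scope classical_set_scope.
Local Open Scope ring_scope.

(** Functions on the torus R/(2 pi Z) are 2 pi-periodic functions R -> R;
    integrals over the torus are Lebesgue integrals over [0, 2 pi]. A function
    u of (t, x) is a curve t |-> u t, with u t a function on the torus; only
    its values for t in I = [0, T] matter. *)

Definition periodic2pi (R : realType) (f : R -> R) : Prop :=
  forall x, f (x + 2 * pi) = f x.

Definition torus_int (R : realType) (f : R -> R) : R :=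
  (\int[lebesgue_measure]_(x in `[0%R, 2 * pi]) f x)%R.

Definition zero_mean (R : realType) (f : R -> R) : Prop := torus_int f = 0.

Definition expi (R : realType) (x : R) : R[i] := Complex (cos x) (sin x).

Definition torus_cint (R : realType) (g : R -> R[i]) : R[i] :=
  Complex (torus_int (fun x => complex.Re (g x)))
          (torus_int (fun x => complex.Im (g x))).

Definition fourier (R : realType) (f : R -> R) (k : int) : R[i] :=
  ((2 * pi)^-1)%:C%C *
  torus_cint (fun x => (f x)%:C%C * expi (- (k%:~R * x))).

(** [poweR] gives [+oo] the square root [+oo]. *)
Definition sobolev_norm (R : realType) (s : R) (f : R -> R) : \bar R :=
  ((\esum_(k in [set: int])
     ((1 + (`|k|%:~R) ^+ 2) `^ s * ComplexField.Normc.normc (fourier f k) ^+ 2)%:E)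
   `^ (2^-1))%E.

(** Measurable representatives of the elements of H^s, meant for 0 <= s. *)
Record sobolev (R : realType) (s : R) (f : R -> R) : Prop := {
  sobolev_periodic : periodic2pi f ;
  sobolev_measurable : measurable_fun setT f ;
  sobolev_L2 : lebesgue_measure.-integrable `[0%R, 2 * pi]
                 (fun x => (f x ^+ 2)%:E) ;
  sobolev_finite : (sobolev_norm s f < +oo)%E }.

(** The multiplier operator, as the limit of the symmetric partial sums over
    - N <= k <= N. For f in H^s with s > 1/2 and m bounded the series converges
    absolutely and uniformly, so the value is the continuous representative of
    the multiplier applied to f. For f real and m (- k) the conjugate of m k,
    the partial sums are real and [Re] only changes the type. *)
Definition fourier_multiplier (R : realType) (m : int -> R[i]) (f : R -> R)
    (x : R) : R :=
  lim ((fun N : nat => complex.Re (\sum_(j < N.*2.+1)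
          (let k : int := j%:Z - N%:Z in
           m k * fourier f k * expi (k%:~R * x)))) @ \oo).

Definition hilbert (R : realType) : (R -> R) -> R -> R :=
  fourier_multiplier (fun k => - 'i%C * (sgz k)%:~R).

Definition smooth_periodic (R : realType) (eta : R -> R) : Prop :=
  periodic2pi eta /\ forall n x, derivable (derive1n n eta) x 1.

(** g is the derivative of f in the sense of distributions on the torus. *)
Definition weak_derivative (R : realType) (f g : R -> R) : Prop :=
  forall eta : R -> R, smooth_periodic eta ->
    torus_int (fun x => f x * derive1 eta x)
    = - torus_int (fun x => g x * eta x).

Definition sobolev_continuous (R : realType) (T s : R) (u : R -> R -> R)
    : Prop :=
  forall t, t \in `[0, T] ->
    sobolev s (u t) /\
    (sobolev_norm s (u t' \- u t) @[t' --> within `[0, T] (nbhs t)]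
       --> 0%E).

(** v is the derivative of u : I -> H^s, for the norm of H^s (one-sided at the
    endpoints of I). *)
Definition sobolev_time_derivative (R : realType) (T s : R)
    (u v : R -> R -> R) : Prop :=
  forall t, t \in `[0, T] ->
    [/\ sobolev s (u t), sobolev s (v t) &
    (sobolev_norm s (fun x => (u t' x - u t x) / (t' - t) - v t x)
       @[t' --> within `[0, T] t^'] --> 0%E)].

(** The norm of C(I; H^s), and that of C^1(I; H^s) for a curve u with time
    derivative v. *)
Definition norm_C0 (R : realType) (T s : R) (u : R -> R -> R) : \bar R :=
  ereal_sup [set sobolev_norm s (u t) | t in `[0, T]].

Definition norm_C1 (R : realType) (T s : R) (u v : R -> R -> R) : \bar R :=
  (norm_C0 T s u + norm_C0 T s v)%E.

(** 1/2 H[phi^2]_xx + phi varphi_xx with phi = H[varphi] and varphi = f. For f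
    the continuous representative of an element of H^s, s >= 3, f and
    H[phi^2] are of class C^2 and the derivatives are classical. *)
Definition flux (R : realType) (f : R -> R) (x : R) : R :=
  2^-1 * derive1n 2 (hilbert (fun y => hilbert f y ^+ 2)) x
  + hilbert f x * derive1n 2 f x.

(** phi is a solution in C(I; H^s) /\ C^1(I; H^(s-1)), with time derivative
    phi_t, of the Cauchy problem with data phi0, phi1. Each phi t is the
    continuous representative of its class. For such phi all terms of the
    equation lie in C(I; H^(s-3)); the equation is an identity in that space,
    where phi_tt is the derivative of phi_t and the outer x-derivative of the
    flux is a weak derivative. *)
Record is_solution (R : realType) (mu s T : R) (phi0 phi1 : R -> R)
    (phi phi_t : R -> R -> R) : Prop := {
  solution_C0 : sobolev_continuous T s phi ;
  solution_dt : sobolev_time_derivative T (s - 1) phi phi_t ;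
  solution_C1 : sobolev_continuous T (s - 1) phi_t ;
  solution_repr : forall t, t \in `[0, T] -> continuous (phi t) ;
  solution_init0 : {ae lebesgue_measure, forall x, phi 0 x = phi0 x} ;
  solution_init1 : {ae lebesgue_measure, forall x, phi_t 0 x = phi1 x} ;
  solution_eq : exists2 phi_tt : R -> R -> R,
    sobolev_time_derivative T (s - 3) phi_t phi_tt &
    forall t, t \in `[0, T] ->
      weak_derivative (flux (phi t))
        (fun x => phi_tt t x - mu * derive1n 2 (phi t) x) }.

Definition is_unique_solution (R : realType) (mu s T : R) (phi0 phi1 : R -> R)
    (phi phi_t : R -> R -> R) : Prop :=
  is_solution mu s T phi0 phi1 phi phi_t /\
  forall psi psi_t : R -> R -> R, is_solution mu s T phi0 phi1 psi psi_t ->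
    forall t, t \in `[0, T] -> psi t = phi t.

(** mu - 2 H[varphi]_x >= delta on I x torus. *)
Definition hyperbolic (R : realType) (mu delta T : R) (phi : R -> R -> R)
    : Prop :=
  forall t x, t \in `[0, T] -> delta <= mu - 2 * derive1 (hilbert (phi t)) x.

Definition energy_bound (R : realType) (s T C2 : R) (phi0 phi1 : R -> R)
    (phi phi_t : R -> R -> R) : Prop :=
  forall t, t \in `[0, T] ->
    (sobolev_norm s (phi t) ^+ 2 + sobolev_norm (s - 1) (phi_t t) ^+ 2
     <= C2%:E * (sobolev_norm s phi0 ^+ 2 + sobolev_norm (s - 1) phi1 ^+ 2))%E.

(* Main.v *)
(* On the Fourier side the equation reads
     z_k'' = - mu k^2 z_k + \sum_(j + l = k) kap(j, l) z_j z_l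
   with an explicit kernel [kap]. For a slowly varying weight w the energy
     \sum w_k^2 (|p_k|^2 + mu k^2 |z_k|^2)
       - 2 Re \sum |k - l| z_(k - l) (k w_k conj z_k) (l w_l z_l),   p = z',
   is coercive because mu - 2 H[phi]_x >= delta, and its last term cancels the
   part of the interaction that loses a derivative, so Gronwall's lemma applies;
   the sums are truncated to a box of frequencies, and the H^3 bound makes the
   truncation error vanish when the box grows. The estimate is used twice. With
   a Sobolev weight amplified at high frequencies it shows that the
   high-frequency tails are small uniformly in n and t, since those of the data
   are. With w = 1, applied to the difference of two solutions, it shows that
   every fixed frequency converges uniformly in t. *)
From HB Require Import structures.
Require Import Defs.
From mathcomp Require Import all_boot all_order all_algebra.
From mathcomp Require Import all_classical all_reals all_analysis.
From mathcomp Require Import measurable_realfun.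
From mathcomp.real_closed Require Import complex.
From mathcomp Require Import ring lra zify.
Set Implicit Arguments.
Unset Strict Implicit.
Unset Printing Implicit Defensive.
Import Order.TTheory GRing.Theory Num.Theory.
Import numFieldNormedType.Exports.
Local Open Scope classical_set_scope.
Local Open Scope ring_scope.

(** A difference of two solutions cannot be estimated directly in H^s: where the difference at low
    frequency meets a solution at high frequency, the Sobolev weight falls on the solution, which
    would have to lie in H^(s+1). With w = 1 this product only needs k^2 z_k to be summable, which
    H^3 provides. The weighted estimate concerns one solution at a time, whose high frequencies are
    controlled by the weighted energy itself. The two estimates are glued by the order of the
    choices. The Gronwall constant depends on the weight only through its constant of slow
    variation, which is independent of the amplification L. So the tails are of size L^-2 as soon as
    the weighted data are bounded, and they are if the amplification starts beyond a frequency
    chosen from L and the limit data. The boxes are imposed by regularity: p is differentiable in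
    time only with values in H^(s-3), so the full energy need not be differentiable, whereas a
    finite sum of coefficients is. The energy does not see frequency 0 of z; there the zero mean of
    the data is used. *)

Definition box (N : nat) : seq int := locked [seq j%:Z - N%:Z | j <- index_iota 0 N.*2.+1].

(** * Finite sums over frequencies and summability *)

Section FiniteSums.
Variable R : realType.
Implicit Types (A B D : int -> R) (r : seq int).

Lemma mem_box N k : (k \in box N) = (`|k| <= N)%N.
Proof.
rewrite /box; unlock; apply/mapP/idP => [[j]|h].
  rewrite mem_index_iota => h ->; lia.
exists (absz (k + N%:Z)); first by rewrite mem_index_iota; lia.
lia.
Qed.

Lemma box_uniq N : uniq (box N).
Proof. by rewrite /box; unlock; rewrite map_inj_uniq ?iota_uniq// => i j; lia. Qed.

(** For a nonnegative family this bounds the sum over all integers. Testing on finite duplicate-free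
    lists avoids infinite sums and makes the passage to a subfamily immediate. *)
Definition bdsum A (C : R) := forall r, uniq r -> \sum_(j <- r) A j <= C.

Lemma sum_subseq A r r' : (forall k, 0 <= A k) -> uniq r -> uniq r' ->
  {subset r <= r'} -> \sum_(k <- r) A k <= \sum_(k <- r') A k.
Proof.
move=> A0 ur ur' rr'.
have -> : \sum_(k <- r) A k = \sum_(k <- r' | k \in r) A k.
  rewrite -[RHS]big_filter; apply: perm_big; apply: uniq_perm => //.
    exact: filter_uniq.
  move=> k; rewrite mem_filter; case: (boolP (k \in r)) => //= /rr' -> //.
rewrite [leRHS](bigID (fun k => k \in r))/= lerDl.
by apply: sumr_ge0.
Qed.

Lemma seq_sub_box r : exists N, {subset r <= box N}.
Proof.
exists (\max_(k <- r) `|k|)%N => k kr; rewrite mem_box.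
exact: (@leq_bigmax_seq _ _ xpredT (fun k : int => absz k) _ kr isT).
Qed.

Lemma bdsum_box A C : (forall k, 0 <= A k) ->
  (forall N, \sum_(k <- box N) A k <= C) -> bdsum A C.
Proof.
move=> A0 hAC r ur; have [N rN] := seq_sub_box r.
by apply: le_trans (hAC N); apply: sum_subseq => //; exact: box_uniq.
Qed.

Lemma bdsum_ge0 A C : bdsum A C -> 0 <= C.
Proof. by move/(_ [::] isT); rewrite big_nil. Qed.

Lemma bdsum_le A B C : (forall k, A k <= B k) -> bdsum B C -> bdsum A C.
Proof. by move=> AB BC r ur; apply: le_trans (BC r ur); exact: ler_sum. Qed.

Lemma bdsumD A B C C' : bdsum A C -> bdsum B C' ->
  bdsum (fun k => A k + B k) (C + C').
Proof. by move=> hAC BC r ur; rewrite big_split/= lerD ?hAC ?BC. Qed.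

Lemma bdsumZ A C c : 0 <= c -> bdsum A C -> bdsum (fun k => c * A k) (c * C).
Proof. by move=> c0 hAC r ur; rewrite -mulr_sumr ler_wpM2l ?hAC. Qed.

Lemma bdsum_term A C k : bdsum A C -> A k <= C.
Proof. by move/(_ [:: k] isT); rewrite big_seq1. Qed.

(** A finite list whose sum comes within e of the supremum leaves at most e to every list disjoint
    from it. *)
Lemma bdsum_tail A C e : (forall k, 0 <= A k) -> bdsum A C -> 0 < e ->
  exists N, forall r, uniq r -> (forall k, k \in r -> (N < `|k|)%N) ->
    \sum_(k <- r) A k <= e.
Proof.
move=> A0 hAC e0.
pose S := [set x | exists2 r, uniq r & x = \sum_(k <- r) A k].
have hS : has_sup S.
  split; first by exists 0; exists [::] => //; rewrite big_nil.
  by exists C => _ [r ur ->]; exact: hAC.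
have [_ [r0 ur0 ->] h] := sup_adherent e0 hS.
have [N r0N] := seq_sub_box r0.
exists N => r ur rN.
have u : uniq (r0 ++ r).
  rewrite cat_uniq ur0 ur andbT; apply/hasPn => k /rN kN; apply/negP => /r0N.
  by rewrite mem_box leqNgt kN.
have := ub_le_sup hS.2 (ex_intro2 _ _ (r0 ++ r) u erefl).
rewrite big_cat/= => h2; lra.
Qed.

Lemma sum_delta_le r (p : pred int) (x : R) k0 : uniq r -> 0 <= x ->
  (forall k, p k -> k = k0) -> \sum_(k <- r) (if p k then x else 0) <= x.
Proof.
move=> ur x0 pk.
apply: (@le_trans _ _ (\sum_(k <- r) (if k == k0 then x else 0))).
  apply: ler_sum => k _; case: ifP => // [/pk ->|_]; first by rewrite eqxx.
  by case: ifP.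
case: (boolP (k0 \in r)) => kr.
  rewrite (bigD1_seq k0)//= eqxx big1 ?addr0// => i /negPf -> //.
rewrite big_seq big1// => k kr'; case: eqP kr' kr => // -> -> //.
Qed.

Lemma sum_half r r' A B : \sum_(j <- r) \sum_(l <- r') A j * B l / 2 =
  (\sum_(j <- r) A j) * (\sum_(l <- r') B l) / 2.
Proof.
by rewrite !mulr_suml; apply: eq_bigr => j _; rewrite mulr_sumr mulr_suml.
Qed.

(** Convolution of l^1 with l^2, tested against l^2. After 2 B D <= B^2 + D^2 the constraint j + l =
    k removes one of the three indices from each half. A sum of squares on the right, rather than a
    product of norms, is the form that suits Gronwall's lemma. *)
Lemma young rk rj rl A B D CA : uniq rk -> uniq rj -> uniq rl ->
  (forall j, 0 <= A j) -> \sum_(j <- rj) A j <= CA ->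
  \sum_(k <- rk) \sum_(j <- rj) \sum_(l <- rl)
     (if j + l == k then A j * B l * D k else 0)
  <= CA / 2 * (\sum_(l <- rl) B l ^+ 2 + \sum_(k <- rk) D k ^+ 2).
Proof.
move=> uk uj ul A0 hAC.
pose F k j l := if j + l == k then A j * B l ^+ 2 / 2 else 0.
pose G k j l := if j + l == k then A j * D k ^+ 2 / 2 else 0.
apply: (@le_trans _ _ (\sum_(k <- rk) \sum_(j <- rj) \sum_(l <- rl)
     (F k j l + G k j l))).
  apply: ler_sum => k _; apply: ler_sum => j _; apply: ler_sum => l _.
  rewrite /F /G; case: ifP => _; last by rewrite addr0.
  have := mulr_ge0 (A0 j) (sqr_ge0 (B l - D k)); nra.
under eq_bigr => k _ do under eq_bigr => j _ do rewrite big_split/=.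
under eq_bigr => k _ do rewrite big_split/=.
rewrite big_split/= mulrDr lerD//.
  rewrite exchange_big/=.
  apply: (@le_trans _ _ (\sum_(j <- rj) \sum_(l <- rl) A j * B l ^+ 2 / 2)).
    apply: ler_sum => j _; rewrite exchange_big/=; apply: ler_sum => l _.
    apply: (@sum_delta_le _ _ _ (j + l)) => //.
      by rewrite divr_ge0// mulr_ge0// sqr_ge0.
    by move=> k /eqP.
  rewrite sum_half mulrAC ler_wpM2r//; first by apply: sumr_ge0 => l _; exact: sqr_ge0.
  by rewrite ler_wpM2r.
apply: (@le_trans _ _ (\sum_(k <- rk) \sum_(j <- rj) A j * D k ^+ 2 / 2)).
  apply: ler_sum => k _; apply: ler_sum => j _.
  apply: (@sum_delta_le _ _ _ (k - j)) => //.
    by rewrite divr_ge0// mulr_ge0// sqr_ge0.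
  by move=> l /eqP; lia.
rewrite exchange_big/= sum_half mulrAC ler_wpM2r//.
  by apply: sumr_ge0 => l _; exact: sqr_ge0.
by rewrite ler_wpM2r.
Qed.

End FiniteSums.

(** * Real parts, imaginary parts and modulus *)

Section Complex.
Variable R : realType.
Implicit Types (x y : R[i]).
Local Notation C := R[i].
Local Notation Re := complex.Re.
Local Notation Im := complex.Im.

Definition nc : C -> R := @ComplexField.Normc.normc R.

Lemma ReD x y : Re (x + y) = Re x + Re y. Proof. by case: x y => [a b] []. Qed.
Lemma ImD x y : Im (x + y) = Im x + Im y. Proof. by case: x y => [a b] []. Qed.
Lemma ReN x : Re (- x) = - Re x. Proof. by case: x. Qed.
Lemma ImN x : Im (- x) = - Im x. Proof. by case: x. Qed.
Lemma ReM x y : Re (x * y) = Re x * Re y - Im x * Im y.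
Proof. by case: x y => [a b] []. Qed.
Lemma ImM x y : Im (x * y) = Re x * Im y + Im x * Re y.
Proof. by case: x y => [a b] [] *. Qed.
Lemma ReZ (c : R) x : Re (c%:C%C * x) = c * Re x.
Proof. by rewrite ReM/= mul0r subr0. Qed.
Lemma ImZ (c : R) x : Im (c%:C%C * x) = c * Im x.
Proof. by rewrite ImM/= mul0r addr0. Qed.

Lemma Re_sum (I : Type) (r : seq I) (P : pred I) (F : I -> C) :
  Re (\sum_(i <- r | P i) F i) = \sum_(i <- r | P i) Re (F i).
Proof. by elim/big_rec2 : _ => // i a b _ <-; rewrite ReD. Qed.
Lemma Im_sum (I : Type) (r : seq I) (P : pred I) (F : I -> C) :
  Im (\sum_(i <- r | P i) F i) = \sum_(i <- r | P i) Im (F i).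
Proof. by elim/big_rec2 : _ => // i a b _ <-; rewrite ImD. Qed.

Lemma nc_ge0 x : 0 <= nc x. Proof. by case: x => a b; exact: sqrtr_ge0. Qed.
Lemma nc0 : nc 0 = 0. Proof. exact: ComplexField.Normc.normc0. Qed.
Lemma ncM x y : nc (x * y) = nc x * nc y.
Proof. exact: ComplexField.Normc.normcM. Qed.
Lemma ncN x : nc (- x) = nc x. Proof. exact: normcN. Qed.
Lemma ncD x y : nc (x + y) <= nc x + nc y. Proof. exact: le_normcD. Qed.
Lemma ncB x y : nc (x - y) <= nc x + nc y.
Proof. by rewrite -(ncN y); exact: ncD. Qed.
Lemma ncBC x y : nc (x - y) = nc (y - x).
Proof. by rewrite -ncN opprB. Qed.
Lemma nc_sq x : nc x ^+ 2 = Re x ^+ 2 + Im x ^+ 2.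
Proof. by case: x => a b /=; rewrite sqr_sqrtr// addr_ge0 ?sqr_ge0. Qed.
Lemma nc_real (c : R) : nc c%:C%C = `|c|.
Proof. by rewrite /nc/= expr0n/= addr0 sqrtr_sqr. Qed.
Lemma ncJ x : nc (x^*%C) = nc x.
Proof. by case: x => a b; rewrite /nc/= sqrrN. Qed.
Lemma Re_le_nc x : `|Re x| <= nc x.
Proof.
by rewrite -sqrtr_sqr; case: x => a b /=; rewrite ler_sqrt ?addr_ge0 ?sqr_ge0// lerDl sqr_ge0.
Qed.
Lemma Im_le_nc x : `|Im x| <= nc x.
Proof.
by rewrite -sqrtr_sqr; case: x => a b /=; rewrite ler_sqrt ?addr_ge0 ?sqr_ge0// lerDr sqr_ge0.
Qed.
Lemma nc_le x : nc x <= `|Re x| + `|Im x|.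
Proof.
rewrite -(@ler_pXn2r _ 2)// ?nnegrE ?nc_ge0 ?addr_ge0//.
by rewrite nc_sq sqrrD !real_normK ?num_real// addrAC lerDl mulrn_wge0// mulr_ge0.
Qed.
Lemma nc_sum (I : Type) (r : seq I) (P : pred I) (F : I -> C) :
  nc (\sum_(i <- r | P i) F i) <= \sum_(i <- r | P i) nc (F i).
Proof.
elim/big_rec2 : _ => [|i a b _ ab]; first by rewrite nc0.
by apply: le_trans (ncD _ _) _; rewrite lerD2l.
Qed.
Lemma nc_eq0 x : (forall e, 0 < e -> nc x <= e) -> x = 0.
Proof.
move=> h; apply: ComplexField.Normc.eq0_normc; apply/eqP.
by rewrite eq_le nc_ge0 andbT; apply/ler_addgt0Pr => e /h; rewrite add0r.
Qed.
Lemma nc_sqD x y : nc (x + y) ^+ 2 <= 2 * nc x ^+ 2 + 2 * nc y ^+ 2.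
Proof.
rewrite !nc_sq ReD ImD.
have := sqr_ge0 (Re x - Re y); have := sqr_ge0 (Im x - Im y); nra.
Qed.
Lemma nc_sqB x y : nc (x - y) ^+ 2 <= 2 * nc x ^+ 2 + 2 * nc y ^+ 2.
Proof. by rewrite -(ncN y); exact: nc_sqD. Qed.
Lemma mulcJ x : x * x^*%C = (nc x ^+ 2)%:C%C.
Proof. by rewrite nc_sq; case: x => a b /=; simpc; congr Complex; ring. Qed.

End Complex.

(** * Derivatives within [0, T] and Gronwall's lemma *)

Section TimeDerivative.
Variables (R : realType) (T : R).
Implicit Types (f g : R -> R) (t : R).
Local Notation Re := complex.Re.
Local Notation Im := complex.Im.

(* Caratheodory's form of the derivative within [0, T]. *)
Definition tder f (df : R) t := exists phi : R -> R,
  [/\ forall t', f t' - f t = phi t' * (t' - t), phi t = df &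
      phi @ within `[0, T] (nbhs t) --> df].

Lemma tder_quotient f df t :
  ((f t' - f t) / (t' - t) @[t' --> within `[0, T] t^'] --> df) -> tder f df t.
Proof.
move=> h; exists (fun t' => if t' == t then df else (f t' - f t) / (t' - t)).
split; last first.
- apply/cvgrPdist_lt => e e0.
  move/cvgrPdist_lt : h => /(_ e e0).
  rewrite !near_withinE => h.
  near=> t' => /= t'T; case: eqP => [_|/eqP t't]; first by rewrite subrr normr0.
  by move: t'T t't; near: t'; apply: filterS h => x h x0 xt; exact: h.
- by rewrite eqxx.
- move=> t'; case: eqP => [->|/eqP]; first by rewrite !subrr mulr0.
  by rewrite -subr_eq0 => /divfK ->.
Unshelve. all: by end_near. Qed.

Lemma tder_cvg f df t : tder f df t -> f @ within `[0, T] (nbhs t) --> f t.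
Proof.
case=> phi [fphi phit cphi].
have -> : f = (fun t' => f t + phi t' * (t' - t)).
  by apply/funext => t'; rewrite -fphi addrC subrK.
rewrite [X in _ --> X](_ : _ = f t + df * (t - t)); last by rewrite !subrr !mulr0.
apply: cvgD; first exact: cvg_cst.
apply: cvgM => //; apply: cvgB; last exact: cvg_cst.
exact: cvg_within.
Qed.

Lemma tder_is_derive f df t : t \in `]0, T[ -> tder f df t -> is_derive t 1 f df.
Proof.
move=> tT [phi [fphi phit cphi]]; apply/is_derive1_caratheodory; exists phi.
split => //; move: cphi; rewrite -phit within_interior//.
by rewrite interior_itv.
Qed.

Lemma tder_cst c t : tder (fun=> c) 0 t.
Proof.
exists (fun=> 0); split => //; first by move=> t'; rewrite subrr mul0r.
exact: cvg_cst.
Qed.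

Lemma tderD f g df dg t : tder f df t -> tder g dg t ->
  tder (fun t => f t + g t) (df + dg) t.
Proof.
move=> [p [fp <- cp]] [q [gq <- cq]]; exists (fun t => p t + q t); split => //.
  by move=> t'; rewrite mulrDl -fp -gq; ring.
exact: cvgD.
Qed.

Lemma tderM f g df dg t : tder f df t -> tder g dg t ->
  tder (fun t => f t * g t) (df * g t + f t * dg) t.
Proof.
move=> hf [q [gq <- cq]]; have cf := tder_cvg hf; case: hf => p [fp <- cp].
exists (fun t' => p t' * g t + f t' * q t'); split => //.
  by move=> t'; rewrite mulrDl mulrAC -fp -mulrA -gq; ring.
by apply: cvgD; apply: cvgM => //; exact: cvg_cst.
Qed.

Lemma tderN f df t : tder f df t -> tder (fun t => - f t) (- df) t.
Proof.
move=> [p [fp <- cp]]; exists (fun t => - p t); split => //.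
  by move=> t'; rewrite mulNr -fp; ring.
exact: cvgN.
Qed.

Lemma tder_sum (I : Type) (r : seq I) (F : I -> R -> R) (dF : I -> R) t :
  (forall i, tder (F i) (dF i) t) ->
  tder (fun t => \sum_(i <- r) F i t) (\sum_(i <- r) dF i) t.
Proof.
move=> h; elim: r => [|i r ih].
  rewrite big_nil; under eq_fun do rewrite big_nil; exact: tder_cst.
rewrite big_cons; under eq_fun do rewrite big_cons; exact: tderD.
Qed.

Lemma is_derive_tder f df t : is_derive t 1 f df -> tder f df t.
Proof.
move/is_derive1_caratheodory => [p [fp cp <-]]; exists p; split => //.
by apply: cvg_within_filter; exact: cp.
Qed.

(** The function exp (- a t) f t - b t is nonincreasing by the mean value theorem: its derivative is
    at most b (exp (- a t) - 1) <= 0. *)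
Lemma gronwall f (df : R -> R) a b :
  (forall t, t \in `[0, T] -> tder f (df t) t) -> 0 <= a -> 0 <= b ->
  (forall t, t \in `]0, T[ -> df t <= a * f t + b) ->
  forall t, t \in `[0, T] -> f t <= expR (a * t) * (f 0 + b * t).
Proof.
move=> hf a0 b0 hdf t tT.
pose g t := expR (- a * t) * f t + - b * t.
pose dg t := - a * expR (- a * t) * f t + expR (- a * t) * df t + (0 * t + - b * 1).
have hg x : x \in `[0, T] -> tder g (dg x) x.
  move=> xT; apply: tderD; first apply: tderM (hf _ xT).
    apply: is_derive_tder; rewrite mulrC.
    apply: (@is_derive1_comp _ expR ( *%R (- a))).
    apply: is_derive_eq; rewrite scaler1//.
  by apply: tderM; [exact: tder_cst|exact: is_derive_tder].
have t0 : 0 <= t by move: tT; rewrite in_itv/= => /andP[].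
have sub x : x \in `[0, t] -> x \in `[0, T].
  move: tT; rewrite !in_itv/= => /andP[_ tT] /andP[-> xt]; exact: le_trans tT.
have sub' x : x \in `]0, t[ -> x \in `]0, T[.
  move: tT; rewrite !in_itv/= => /andP[_ tT] /andP[-> xt]; exact: lt_le_trans tT.
suff gt : g t <= g 0.
  have e : f t = expR (a * t) * (g t + b * t).
    have -> : g t + b * t = expR (- (a * t)) * f t by rewrite /g mulNr; ring.
    by rewrite mulrA -expRD subrr expR0 mul1r.
  rewrite e ler_wpM2l ?expR_ge0// lerD2r (le_trans gt)//.
  by rewrite /g !mulr0 expR0 mul1r addr0.
have [->//|tn0] := eqVneq t 0.
have t0' : 0 < t by rewrite lt_neqAle eq_sym tn0.
have [||c cT e] := @MVT R g dg 0 t t0'.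
- by move=> x xT; apply: tder_is_derive; [exact: sub'|apply: hg; exact/sub/subset_itv_oo_cc].
- apply: (@continuous_subspaceW _ _ _ `[0, T]); first by move=> x; exact: sub.
  by apply/subspace_continuousP => x xT; exact: (tder_cvg (hg _ xT)).
rewrite -subr_le0 e pmulr_lle0 ?subr_gt0// /dg mul0r add0r mulr1.
have c0 : 0 <= c by move: cT; rewrite in_itv/= => /andP[/ltW].
have E1 : expR (- a * c) <= 1 by rewrite -expR0 ler_expR mulNr oppr_le0 mulr_ge0.
have := hdf _ (sub' _ cT); rewrite -lerBlDl => h.
have E0 := expR_ge0 (- a * c).
have h1 := ler_wpM2l E0 h.
have h2 := ler_wpM2r b0 E1.
rewrite mul1r in h2; lra.
Qed.

End TimeDerivative.

(** * Energy identity on finitely many frequencies *)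

Section ComplexTimeDerivative.
Variables (R : realType) (T : R).
Implicit Types (z w : R -> R[i]) (t : R).
Local Notation Re := complex.Re.
Local Notation Im := complex.Im.

Definition ctder z (dz : R[i]) t :=
  tder T (fun t => Re (z t)) (Re dz) t /\ tder T (fun t => Im (z t)) (Im dz) t.

Lemma ctder_cst c t : ctder (fun=> c) 0 t.
Proof. by split; exact: tder_cst. Qed.

Lemma ctderM z w dz dw t : ctder z dz t -> ctder w dw t ->
  ctder (fun t => z t * w t) (dz * w t + z t * dw) t.
Proof.
move=> [z1 z2] [w1 w2]; split.
  rewrite ReD !ReM; under eq_fun do rewrite ReM.
  rewrite [X in tder _ _ X](_ : _ = (Re dz * Re (w t) + Re (z t) * Re dw) +
    - (Im dz * Im (w t) + Im (z t) * Im dw)); last by ring.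
  by apply: tderD; [exact: tderM|apply: tderN; exact: tderM].
rewrite ImD !ImM; under eq_fun do rewrite ImM.
rewrite [X in tder _ _ X](_ : _ = (Re dz * Im (w t) + Re (z t) * Im dw) +
  (Im dz * Re (w t) + Im (z t) * Re dw)); last by ring.
by apply: tderD; exact: tderM.
Qed.

Lemma ctderD z w dz dw t : ctder z dz t -> ctder w dw t ->
  ctder (fun t => z t + w t) (dz + dw) t.
Proof.
move=> [z1 z2] [w1 w2]; split.
  by rewrite ReD; under eq_fun do rewrite ReD; exact: tderD.
by rewrite ImD; under eq_fun do rewrite ImD; exact: tderD.
Qed.

Lemma ctderB z w dz dw t : ctder z dz t -> ctder w dw t ->
  ctder (fun t => z t - w t) (dz - dw) t.
Proof.
move=> hz [w1 w2]; apply: ctderD => //; split.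
  by rewrite ReN; under eq_fun do rewrite ReN; exact: tderN.
by rewrite ImN; under eq_fun do rewrite ImN; exact: tderN.
Qed.

Lemma ctderJ z dz t : ctder z dz t -> ctder (fun t => (z t)^*%C) (dz^*)%C t.
Proof.
have rJ (x : R[i]) : Re (x^*)%C = Re x by case: x.
have iJ (x : R[i]) : Im (x^*)%C = - Im x by case: x.
move=> [z1 z2]; split.
  by rewrite rJ; under eq_fun do rewrite rJ.
by rewrite iJ; under eq_fun do rewrite iJ; exact: tderN.
Qed.

Lemma ctderZ c z dz t : ctder z dz t -> ctder (fun t => c * z t) (c * dz) t.
Proof.
by move=> hz; rewrite -[c * dz]add0r -(mul0r (z t)); apply: ctderM => //; exact: ctder_cst.
Qed.

Lemma ctder_sum (I : Type) (r : seq I) (F : I -> R -> R[i]) (dF : I -> R[i]) t :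
  (forall i, ctder (F i) (dF i) t) ->
  ctder (fun t => \sum_(i <- r) F i t) (\sum_(i <- r) dF i) t.
Proof.
move=> h; split.
  by rewrite Re_sum; under eq_fun do rewrite Re_sum; apply: tder_sum => i; case: (h i).
by rewrite Im_sum; under eq_fun do rewrite Im_sum; apply: tder_sum => i; case: (h i).
Qed.

Lemma tder_ncsq z dz t : ctder z dz t ->
  tder T (fun t => nc (z t) ^+ 2) (2 * Re (dz * (z t)^*%C)) t.
Proof.
move=> hz; have [h _] := ctderM hz (ctderJ hz).
under eq_fun do rewrite -[nc _ ^+ 2]/(Re (nc _ ^+ 2)%:C%C) -mulcJ.
rewrite (_ : 2 * _ = Re (dz * ((z t)^*)%C + z t * (dz^*)%C))//.
by case: (z t) dz {hz h} => a b [c d]/=; ring.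
Qed.

End ComplexTimeDerivative.

Section Convolution.
Variable R : realType.
Local Notation C := R[i].

(** Puts a convolution into the three-index form of [young]. For k and l in box P the difference k -
    l has size at most P + P, so box L contains it. *)
Lemma conv_sum (V : nmodType) (F : int -> int -> V) P L k : k \in box P ->
  (P + P <= L)%N ->
  \sum_(l <- box P) F (k - l) l =
  \sum_(j <- box L) \sum_(l <- box P) if j + l == k then F j l else 0.
Proof.
rewrite mem_box => kP PL; rewrite exchange_big/= big_seq [RHS]big_seq.
apply: eq_bigr => l; rewrite mem_box => lP.
rewrite (bigD1_seq (k - l)) ?box_uniq//=; last by rewrite mem_box; lia.
rewrite subrK eqxx big1 ?addr0// => j /negPf jk.
by case: eqP => // h; move: jk; rewrite -h addrK eqxx.
Qed.

Lemma uniform_rank (S : nat -> int -> Prop) (r : seq int) :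
  (forall k, exists L0, forall L, (L0 <= L)%N -> S L k) ->
  exists L0, forall L, (L0 <= L)%N -> forall k, k \in r -> S L k.
Proof.
move=> h; elim: r => [|k r [L1 h1]]; first by exists 0%N.
have [L2 h2] := h k; exists (maxn L1 L2) => L; rewrite geq_max => /andP[l1 l2] i.
by rewrite inE => /predU1P[->|]; [exact: h2|exact: h1].
Qed.

End Convolution.

Section Energy.
Variable R : realType.
Local Notation C := R[i].
Local Notation Re := complex.Re.
Local Notation Im := complex.Im.

(** The symbol of f |-> H[f]_x, since - i sgn k times i k is |k|. *)
Definition ak (k : int) : R := `|k%:~R|.

Lemma ak_ge0 k : 0 <= ak k. Proof. exact: normr_ge0. Qed.

(** A setting that covers both uses of the energy: [v] is the unknown and [p] its time derivative,
    [a] the coefficient and [b] its time derivative, [m] the weight, [Q] the quadratic interaction,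
    [A] a summable majorant. A single solution z gives a = v = z; two solutions give v = z' - z and
    a = z'. Up to a factor i, [g] is the weighted x-derivative of v, and [y] has the coefficients of
    the x-derivative of H[a]. *)
Variables (T mu delta CA CA1 CB M tau : R) (P : nat).
Variables (m : int -> R) (a b v p N : R -> int -> C) (Q : R -> int -> int -> C)
  (A : R -> int -> R).

Let y t j := (ak j)%:C%C * a t j.
Let y' t j := (ak j)%:C%C * b t j.
Let g t k := (k%:~R * m k)%:C%C * v t k.
Let g' t k := (k%:~R * m k)%:C%C * p t k.
Let q t k := N t k - (mu * k%:~R ^+ 2)%:C%C * v t k.

Definition energy t :=
  \sum_(k <- box P) (m k ^+ 2 * nc (p t k) ^+ 2 + mu * nc (g t k) ^+ 2)
  - 2 * Re (\sum_(k <- box P) \sum_(l <- box P) y t (k - l) * g t l * (g t k)^*%C).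

Hypothesis delta0 : 0 < delta.
Hypothesis M0 : 0 <= M.
Hypothesis m0 : forall k, 0 <= m k.
Hypothesis mM : forall k, m k <= M.
Hypothesis tau0 : 0 <= tau.
Hypothesis va : forall t, t \in `[0, T] -> forall k, ctder T (a ^~ k) (b t k) t.
Hypothesis vp : forall t, t \in `[0, T] -> forall k, ctder T (v ^~ k) (p t k) t.
Hypothesis pq : forall t, t \in `[0, T] -> forall k, ctder T (p ^~ k) (q t k) t.
Hypothesis herm : forall t, t \in `[0, T] -> forall k, a t (- k) = (a t k)^*%C.
Hypothesis convN : forall t, t \in `[0, T] -> forall k e, 0 < e ->
  exists L0, forall L, (L0 <= L)%N ->
  nc (N t k - \sum_(j <- box L) \sum_(l <- box L)
    (if j + l == k then Q t j l else 0)) <= e.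
Hypothesis A0 : forall t j, 0 <= A t j.
Hypothesis bA : forall t, t \in `[0, T] -> bdsum (A t) CA.
Hypothesis ba : forall t, t \in `[0, T] -> bdsum (fun j => ak j * nc (a t j)) CA1.
Hypothesis bb : forall t, t \in `[0, T] -> bdsum (fun j => ak j * nc (b t j)) CB.
Hypothesis kerQ : forall t, t \in `[0, T] -> forall j l,
  nc ((m (j + l))%:C%C * Q t j l
      - ((j + l)%:~R)%:C%C * (y t j * g t l + y t l * g t j))
  <= A t j * nc (g t l) + A t l * nc (g t j).
Hypothesis tailv : forall t, t \in `[0, T] -> forall r, uniq r ->
  (forall k, k \in r -> (P < `|k|)%N) ->
  \sum_(k <- r) k%:~R ^+ 4 * nc (v t k) ^+ 2 <= tau.
Hypothesis coercive : forall t, t \in `[0, T] -> forall h : int -> C,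
  delta * \sum_(k <- box P) nc (h k) ^+ 2 <=
  mu * \sum_(k <- box P) nc (h k) ^+ 2
  - 2 * Re (\sum_(k <- box P) \sum_(l <- box P) y t (k - l) * h l * (h k)^*%C).

Let X t := \sum_(k <- box P) m k ^+ 2 * nc (p t k) ^+ 2.
Let V t := \sum_(k <- box P) nc (g t k) ^+ 2.

Let tailL t L : t \in `[0, T] -> (P <= L)%N ->
  \sum_(l <- [seq l <- box L | l \notin box P]) (M * l%:~R ^+ 2 * nc (v t l)) ^+ 2
    <= M ^+ 2 * tau.
Proof.
move=> tT PL; have := @tailv t tT [seq l <- box L | l \notin box P].
rewrite filter_uniq ?box_uniq// => /(_ isT) h.
have {}h := h (fun k => _).
under eq_bigr => l _ do rewrite -mulrA exprMn exprMn -exprM.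
rewrite -mulr_sumr ler_wpM2l ?sqr_ge0//; apply: h => k.
by rewrite mem_filter mem_box -ltnNge => /andP[].
Qed.

Let V_tail t L : t \in `[0, T] -> (P <= L)%N ->
  \sum_(l <- box L) nc (g t l) ^+ 2 <= V t + M ^+ 2 * tau.
Proof.
move=> tT PL; rewrite (bigID (fun l => l \in box P))/= lerD//.
  rewrite -big_filter; apply: sum_subseq => [k|||k].
  - exact: sqr_ge0.
  - by rewrite filter_uniq ?box_uniq.
  - exact: box_uniq.
  - by rewrite mem_filter => /andP[].
apply: le_trans (tailL tT PL); rewrite [leRHS]big_filter.
apply: ler_sum => l lP.
have B0 := mulr_ge0 (mulr_ge0 M0 (sqr_ge0 (l%:~R : R))) (nc_ge0 (v t l)).
rewrite lerXn2r ?nnegrE ?nc_ge0//.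
rewrite /g ncM ler_wpM2r ?nc_ge0// nc_real normrM (ger0_norm (m0 l)) mulrC.
rewrite ler_pM ?mM ?m0// -(@real_normK _ l%:~R) ?num_real// expr2 ler_peMr//.
rewrite -intr_norm ler1z; move: lP; rewrite mem_box; lia.
Qed.

Lemma energy_coercive t : t \in `[0, T] -> X t + delta * V t <= energy t.
Proof.
move=> tT; have := coercive tT (g t).
rewrite /energy /X big_split/= -mulr_sumr -/(V t) => h.
by rewrite -addrA lerD2l.
Qed.

(** What is left of the derivative of [energy]: the two quadratic terms with mu cancel, and by
    [Re_swap] the two cubic terms in which a factor g is differentiated agree, whence the 2 in front
    of k times the product of y and g. *)
Let denergy t :=
  2 * Re (\sum_(k <- box P) (m k)%:C%C * (p t k)^*%C *
     ((m k)%:C%C * N t k - 2%:R * (k%:~R)%:C%C * \sum_(l <- box P) y t (k - l) * g t l))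
  - 2 * Re (\sum_(k <- box P) \sum_(l <- box P) y' t (k - l) * g t l * (g t k)^*%C).

(** The kernel is Hermitian, so exchanging G and H conjugates the sum. *)
Let Re_swap (F : int -> int -> C) (G H : int -> C) :
  (forall k l, F l k = (F k l)^*%C) ->
  Re (\sum_(k <- box P) \sum_(l <- box P) F k l * G l * (H k)^*%C) =
  Re (\sum_(k <- box P) \sum_(l <- box P) F k l * H l * (G k)^*%C).
Proof.
move=> hF; rewrite [in RHS]exchange_big/= !Re_sum; apply: eq_bigr => k _.
rewrite !Re_sum; apply: eq_bigr => l _; rewrite hF.
by case: (F l k) (G l) (H k) => ? ? [? ?] [? ?]/=; ring.
Qed.

Lemma tder_energy t : t \in `[0, T] -> tder T energy (denergy t) t.
Proof.
move=> tT.
have hg k : ctder T (g ^~ k) (g' t k) t by apply: ctderZ; exact: vp.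
have hy j : ctder T (y ^~ j) (y' t j) t by apply: ctderZ; exact: va.
have yJ k l : y t (l - k) = (y t (k - l))^*%C.
  rewrite /y -opprB (herm tT) /ak rmorphN/= normrN.
  by case: (a t (k - l)) => ? ?; simpc; congr Complex; ring.
suff -> : denergy t =
  (\sum_(k <- box P) (m k ^+ 2 * (2 * Re (q t k * (p t k)^*%C)) +
     mu * (2 * Re (g' t k * (g t k)^*%C)))) +
  - (2 * Re (\sum_(k <- box P) \sum_(l <- box P)
     ((y' t (k - l) * g t l + y t (k - l) * g' t l) * (g t k)^*%C
      + (y t (k - l) * g t l) * (g' t k)^*%C))).
  have Z (f : R -> R) df c : tder T f df t -> tder T (fun t => c * f t) (c * df) t.
    move=> hf; rewrite -[c * df]add0r -(mul0r (f t)); apply: tderM => //.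
    exact: tder_cst.
  apply: tderD.
    apply: tder_sum => k; apply: tderD; apply: Z; apply: tder_ncsq => //.
    exact: pq.
  apply: tderN; apply: Z.
  have [] // : ctder T (fun t => \sum_(k <- box P) \sum_(l <- box P)
    y t (k - l) * g t l * (g t k)^*%C) (\sum_(k <- box P) \sum_(l <- box P)
     ((y' t (k - l) * g t l + y t (k - l) * g' t l) * (g t k)^*%C
      + (y t (k - l) * g t l) * (g' t k)^*%C)) t.
  apply: ctder_sum => k; apply: ctder_sum => l; apply: ctderM; last exact: ctderJ.
  exact: ctderM.
have -> : \sum_(k <- box P) \sum_(l <- box P)
     ((y' t (k - l) * g t l + y t (k - l) * g' t l) * (g t k)^*%C
      + (y t (k - l) * g t l) * (g' t k)^*%C) =
   \sum_(k <- box P) \sum_(l <- box P) y' t (k - l) * g t l * (g t k)^*%C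
   + \sum_(k <- box P) \sum_(l <- box P) y t (k - l) * g' t l * (g t k)^*%C
   + \sum_(k <- box P) \sum_(l <- box P) y t (k - l) * g t l * (g' t k)^*%C.
  rewrite -!big_split/=; apply: eq_bigr => k _; rewrite -!big_split/=.
  by apply: eq_bigr => l _; rewrite mulrDl.
rewrite 2!ReD (Re_swap _ _ yJ).
set Z1 := Re (\sum_(k <- _) \sum_(l <- _) y' _ _ * _ * _).
set Z2 := Re (\sum_(k <- _) \sum_(l <- _) y _ _ * _ * _).
suff e : Re (\sum_(k <- box P) (m k)%:C%C * (p t k)^*%C *
     ((m k)%:C%C * N t k - 2%:R * (k%:~R)%:C%C * \sum_(l <- box P) y t (k - l) * g t l))
  = \sum_(k <- box P) (m k ^+ 2 * Re (q t k * (p t k)^*%C) +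
      mu * Re (g' t k * (g t k)^*%C)) - 2 * Z2.
  rewrite /denergy e -/Z1 mulrBr mulr_sumr.
  under eq_bigr do rewrite mulrDr (mulrCA 2) (mulrCA 2 mu).
  ring.
rewrite /Z2 !Re_sum mulr_sumr -sumrB; apply: eq_bigr => k _.
rewrite -mulr_suml; set S := \sum_(l <- _) _.
rewrite /q /g' /g.
by case: S (N t k) (p t k) (v t k) => ? ? [? ?] [? ?] [? ?]/=; ring.
Qed.

(* The error committed by replacing the interaction by a commutator with the
   multiplication by [y]. *)
Let D t j l := (m (j + l))%:C%C * Q t j l
      - ((j + l)%:~R)%:C%C * (y t j * g t l + y t l * g t j).

(** The two products in [D] contribute equally, because box L times box L is invariant under the
    exchange of j and l; this matches the factor 2. The energy only removes the part with l in box
    P, so the part with l outside remains as an error. *)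
Let commutator_split t k L : k \in box P -> (P + P <= L)%N ->
  (m k)%:C%C * (\sum_(j <- box L) \sum_(l <- box L) (if j + l == k then Q t j l else 0))
   - 2%:R * (k%:~R)%:C%C * \sum_(l <- box P) y t (k - l) * g t l =
  \sum_(j <- box L) \sum_(l <- box L) (if j + l == k then D t j l else 0)
  + 2%:R * (k%:~R)%:C%C * \sum_(j <- box L)
     \sum_(l <- [seq l <- box L | l \notin box P])
       (if j + l == k then y t j * g t l else 0).
Proof.
move=> kP PL; have -> := @conv_sum _ (fun j l => y t j * g t l) _ _ _ kP PL.
have e : \sum_(j <- box L) \sum_(l <- box L) (if j + l == k then y t j * g t l else 0) =
  \sum_(j <- box L) \sum_(l <- box P) (if j + l == k then y t j * g t l else 0)
  + \sum_(j <- box L) \sum_(l <- [seq l <- box L | l \notin box P])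
       (if j + l == k then y t j * g t l else 0).
  rewrite -big_split; apply: eq_bigr => j _.
  rewrite [LHS](bigID (fun l => l \in box P)) big_filter; congr +%R.
  rewrite -[LHS]big_filter; apply: perm_big; apply: uniq_perm; rewrite ?filter_uniq ?box_uniq//.
  by move=> l; rewrite mem_filter !mem_box; lia.
have e' : \sum_(j <- box L) \sum_(l <- box L) (if j + l == k then y t l * g t j else 0) =
  \sum_(j <- box L) \sum_(l <- box L) (if j + l == k then y t j * g t l else 0).
  rewrite exchange_big/=; apply: eq_bigr => j _; apply: eq_bigr => l _.
  by rewrite addrC.
have -> : \sum_(j <- box L) \sum_(l <- box L) (if j + l == k then D t j l else 0) =
  (m k)%:C%C * (\sum_(j <- box L) \sum_(l <- box L) (if j + l == k then Q t j l else 0))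
  - (k%:~R)%:C%C * (\sum_(j <- box L) \sum_(l <- box L) (if j + l == k then y t j * g t l else 0)
     + \sum_(j <- box L) \sum_(l <- box L) (if j + l == k then y t l * g t j else 0)).
  rewrite mulrDr !mulr_sumr -big_split/= -sumrB; apply: eq_bigr => j _.
  rewrite !mulr_sumr -big_split/= -sumrB; apply: eq_bigr => l _.
  by case: eqP => [<-|_]; rewrite ?mulr0 ?addr0 ?subr0// /D mulrDr.
rewrite e' e; ring.
Qed.

Let commutator_le t L : t \in `[0, T] -> (P <= L)%N ->
  \sum_(k <- box P) m k * nc (p t k) *
    nc (\sum_(j <- box L) \sum_(l <- box L) (if j + l == k then D t j l else 0))
  <= CA * (X t + V t + M ^+ 2 * tau).
Proof.
move=> tT PL.
pose W k j l := if j + l == k then A t j * nc (g t l) * (m k * nc (p t k)) else 0.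
apply: (@le_trans _ _ (\sum_(k <- box P) (\sum_(j <- box L) \sum_(l <- box L) W k j l
   + \sum_(j <- box L) \sum_(l <- box L) W k l j))).
  apply: ler_sum => k _; rewrite -big_split/= mulrC.
  apply: (@le_trans _ _ ((\sum_(j <- box L) \sum_(l <- box L)
     (if j + l == k then A t j * nc (g t l) + A t l * nc (g t j) else 0))
     * (m k * nc (p t k)))).
    rewrite ler_wpM2r ?mulr_ge0 ?nc_ge0//.
    apply: le_trans (nc_sum _ _ _) _; apply: ler_sum => j _.
    apply: le_trans (nc_sum _ _ _) _; apply: ler_sum => l _.
    by case: ifP => _; [exact: kerQ|rewrite nc0].
  rewrite mulr_suml; apply: ler_sum => j _; rewrite mulr_suml -big_split/=.
  apply: ler_sum => l _; rewrite /W (addrC l j); case: ifP => _.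
    by rewrite mulrDl.
  by rewrite mul0r addr0.
rewrite big_split/=.
have h : \sum_(k <- box P) \sum_(j <- box L) \sum_(l <- box L) W k j l
   <= CA / 2 * (X t + V t + M ^+ 2 * tau).
  apply: le_trans (young _ _ (box_uniq P) (box_uniq L) (box_uniq L) (A0 t) (bA tT (box_uniq L))) _.
  rewrite ler_wpM2l ?divr_ge0// ?(bdsum_ge0 (bA tT))//.
  rewrite -addrA [leRHS]addrC lerD ?V_tail// /X le_eqVlt; apply/orP; left; apply/eqP.
  by apply: eq_bigr => k _; rewrite exprMn.
have h' : \sum_(k <- box P) \sum_(j <- box L) \sum_(l <- box L) W k l j
   <= CA / 2 * (X t + V t + M ^+ 2 * tau).
  by under eq_bigr do rewrite exchange_big/=.
by apply: le_trans (lerD h h') _; rewrite -mulrDl -splitr.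
Qed.

(** The factor k is a lost derivative, but |k| <= P < |l| allows it to be moved onto v l, where
    [tailv], a bound on l^4 |v l|^2, pays for it. *)
Let tail_le t L : t \in `[0, T] -> (P <= L)%N ->
  \sum_(k <- box P) m k * nc (p t k) *
    nc (2%:R * (k%:~R)%:C%C * \sum_(j <- box L)
     \sum_(l <- [seq l <- box L | l \notin box P])
       (if j + l == k then y t j * g t l else 0))
  <= CA1 * (X t + M ^+ 2 * tau).
Proof.
move=> tT PL; set rl := [seq _ <- _ | _].
pose B l := M * l%:~R ^+ 2 * nc (v t l).
apply: (@le_trans _ _ (2 * \sum_(k <- box P) \sum_(j <- box L) \sum_(l <- rl)
  (if j + l == k then ak j * nc (a t j) * B l * (m k * nc (p t k)) else 0))).
  rewrite mulr_sumr big_seq [leRHS]big_seq; apply: ler_sum => k kP.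
  have nc2 : nc (2%:R : C) = 2 by rewrite -(rmorph_nat (real_complex R)) nc_real ger0_norm.
  have key : nc (2%:R * (k%:~R)%:C%C * \sum_(j <- box L) \sum_(l <- rl)
       (if j + l == k then y t j * g t l else 0)) <= 2 * (`|k%:~R| *
     \sum_(j <- box L) \sum_(l <- rl)
     (if j + l == k then ak j * nc (a t j) * nc (g t l) else 0)).
    rewrite !ncM nc2 nc_real -mulrA ler_wpM2l// ler_wpM2l//.
    apply: le_trans (nc_sum _ _ _) _; apply: ler_sum => j _.
    apply: le_trans (nc_sum _ _ _) _; apply: ler_sum => l _.
    case: ifP => _; last by rewrite nc0.
    by rewrite ncM /y ncM nc_real /ak normr_id.
  have mp0 : 0 <= m k * nc (p t k) by rewrite mulr_ge0 ?nc_ge0.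
  apply: le_trans (ler_wpM2l mp0 key) _; rewrite mulrCA ler_wpM2l//.
  rewrite !mulr_sumr; apply: ler_sum => j _; rewrite !mulr_sumr.
  rewrite big_seq [leRHS]big_seq; apply: ler_sum => l.
  rewrite mem_filter => /andP[lP _]; case: ifP => _; last by rewrite !mulr0.
  rewrite mulrC ler_wpM2r ?mulr_ge0 ?nc_ge0// mulrCA ler_wpM2l ?mulr_ge0 ?nc_ge0 ?normr_ge0//.
  rewrite /g ncM nc_real /B normrM (ger0_norm (m0 l)) mulrA ler_wpM2r ?nc_ge0//.
  rewrite mulrA [leRHS]mulrC ler_pM ?mulr_ge0// ?mM//.
  rewrite -(@real_normK _ l%:~R) ?num_real// expr2 ler_wpM2r//.
  by rewrite -!intr_norm ler_int; move: lP kP; rewrite !mem_box; lia.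
have uu : uniq rl by rewrite filter_uniq ?box_uniq.
have h : \sum_(k <- box P) \sum_(j <- box L) \sum_(l <- rl)
   (if j + l == k then ak j * nc (a t j) * B l * (m k * nc (p t k)) else 0)
   <= CA1 / 2 * (X t + M ^+ 2 * tau).
  apply: le_trans (young _ _ (box_uniq P) (box_uniq L) uu _ (ba tT (box_uniq L))) _.
    by move=> j; rewrite mulr_ge0 ?nc_ge0 ?ak_ge0.
  rewrite ler_wpM2l ?divr_ge0// ?(bdsum_ge0 (ba tT))//.
  rewrite [leRHS]addrC lerD ?tailL// /X le_eqVlt; apply/orP; left; apply/eqP.
  by apply: eq_bigr => k _; rewrite exprMn.
have := ler_wpM2l (ler0n R 2) h => /le_trans; apply.
by rewrite mulrA [2 * _]mulrC divfK ?lexx// pnatr_eq0.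
Qed.

(** Used with c = b t for the term in which y is differentiated in time, and with c = a 0 to bound
    the initial energy from above. *)
Let trilinear_le t (c : int -> C) K : bdsum (fun j => ak j * nc (c j)) K ->
  `|Re (\sum_(k <- box P) \sum_(l <- box P)
     (ak (k - l))%:C%C * c (k - l) * g t l * (g t k)^*%C)| <= K * V t.
Proof.
move=> bc; apply: le_trans (Re_le_nc _) _.
apply: (@le_trans _ _ (\sum_(k <- box P) \sum_(j <- box (P + P)) \sum_(l <- box P)
  (if j + l == k then ak j * nc (c j) * nc (g t l) * nc (g t k) else 0))).
  apply: le_trans (nc_sum _ _ _) _; rewrite big_seq [leRHS]big_seq.
  apply: ler_sum => k kP; apply: le_trans (nc_sum _ _ _) _.
  rewrite -(@conv_sum _ (fun j l => ak j * nc (c j) * nc (g t l) * nc (g t k)) _ _ _ kP)//.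
  by apply: ler_sum => l _; rewrite ncM ncJ ncM ncM nc_real /ak normr_id.
apply: le_trans (young _ _ (box_uniq P) (box_uniq _) (box_uniq _) _ (bc _ (box_uniq _))) _.
  by move=> j; rewrite mulr_ge0 ?nc_ge0 ?ak_ge0.
by rewrite -/(V t); lra.
Qed.

Lemma denergy_le t : t \in `[0, T] -> denergy t <=
  (2 * (CA + CA1 + CB)) * (X t + V t) + 2 * (CA + CA1) * (M ^+ 2 * tau).
Proof.
move=> tT; apply/ler_addgt0Pr => e e0.
(* N t k is a limit of truncated sums. An error e / (Z + 1) at each k of the box contributes at most
   e in total; the 1 keeps the denominator positive. *)
pose Z := 2 * \sum_(k <- box P) m k ^+ 2 * nc (p t k).
have Z0 : 0 <= Z by rewrite mulr_ge0// sumr_ge0// => k _; rewrite mulr_ge0 ?sqr_ge0 ?nc_ge0.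
have e'0 : 0 < e / (Z + 1) by rewrite divr_gt0// ltr_wpDl.
have [L0 hL0] := @uniform_rank _ (box P) (fun k => convN tT k e'0).
pose L := maxn L0 (P + P).
have {}hL0 := hL0 L (leq_maxl _ _).
have PL : (P + P <= L)%N := leq_maxr _ _.
have PL' : (P <= L)%N by apply: leq_trans PL; rewrite leq_addr.
pose S k := \sum_(j <- box L) \sum_(l <- box L) (if j + l == k then Q t j l else 0).
pose U1 k := \sum_(j <- box L) \sum_(l <- box L) (if j + l == k then D t j l else 0).
pose U2 k := 2%:R * (k%:~R)%:C%C * \sum_(j <- box L)
     \sum_(l <- [seq l <- box L | l \notin box P])
       (if j + l == k then y t j * g t l else 0).
have h1 : Re (\sum_(k <- box P) (m k)%:C%C * (p t k)^*%C *
     ((m k)%:C%C * N t k - 2%:R * (k%:~R)%:C%C * \sum_(l <- box P) y t (k - l) * g t l))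
  <= \sum_(k <- box P) (m k * nc (p t k) * nc (U1 k) + m k * nc (p t k) * nc (U2 k)
      + m k ^+ 2 * nc (p t k) * (e / (Z + 1))).
  apply: le_trans (ler_norm _) _; apply: le_trans (Re_le_nc _) _.
  apply: le_trans (nc_sum _ _ _) _; rewrite big_seq [leRHS]big_seq.
  apply: ler_sum => k kP.
  have -> : (m k)%:C%C * N t k - 2%:R * (k%:~R)%:C%C * \sum_(l <- box P) y t (k - l) * g t l
    = (U1 k + U2 k) + (m k)%:C%C * (N t k - S k).
    by rewrite -(commutator_split t kP PL) mulrBr -/(S k); ring.
  rewrite ncM ncM ncJ nc_real (ger0_norm (m0 k)).
  have mp0 : 0 <= m k * nc (p t k) by rewrite mulr_ge0 ?nc_ge0.
  rewrite -mulrDr [m k ^+ 2 * _ * _](_ : _ = m k * nc (p t k) * (m k * (e / (Z + 1)))); last by ring.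
  rewrite -mulrDr ler_wpM2l//; apply: le_trans (ncD _ _) _; apply: lerD; first exact: ncD.
  by rewrite ncM nc_real (ger0_norm (m0 k)) ler_wpM2l ?m0//; exact: hL0.
rewrite !big_split/= -mulr_suml in h1.
have h2 := commutator_le tT PL'; have h3 := tail_le tT PL'.
have h4 := @trilinear_le t (b t) _ (bb tT); have h5 : Z * (e / (Z + 1)) <= e.
  by rewrite mulrCA ler_piMr ?(ltW e0)// ler_pdivrMr ?ltr_wpDl// mul1r lerDl.
have h6 : 2 * (\sum_(k <- box P) m k ^+ 2 * nc (p t k) * (e / (Z + 1))) <= e.
  by rewrite -mulr_suml mulrA.
have V0 : 0 <= V t by apply: sumr_ge0 => k _; exact: sqr_ge0.
have X0 : 0 <= X t by apply: sumr_ge0 => k _; rewrite mulr_ge0 ?sqr_ge0.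
have CA0 := bdsum_ge0 (bA tT); have CA10 := bdsum_ge0 (ba tT); have CB0 := bdsum_ge0 (bb tT).
have Mt0 : 0 <= M ^+ 2 * tau by rewrite mulr_ge0 ?sqr_ge0.
have h7 := mulr_ge0 CA10 V0; have h8 := mulr_ge0 CB0 X0.
have h9 := lerNnormlW h4.
have := le_trans h1 (lerD (lerD h2 h3) (lexx _)).
rewrite /denergy; set W1 := Re _; set W2 := Re _ in h9 *.
rewrite -mulr_suml in h6.
move: h6 h7 h8 h9; nra.
Qed.


(** The factor 1 + delta^-1 bounds X + V, which appears in [denergy_le], by the coercive quantity X
    + delta * V. The factor mu + 2 * CA1 comes from bounding the cubic part of the initial energy by
    [trilinear_le]. *)
Lemma energy_estimate_box t : 0 <= T -> t \in `[0, T] -> X t + delta * V t <=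
  expR (2 * (CA + CA1 + CB) * (1 + delta^-1) * t) *
    (X 0 + (mu + 2 * CA1) * V 0 + 2 * (CA + CA1) * (M ^+ 2 * tau) * t).
Proof.
move=> T0 tT; have zT : (0 : R) \in `[0, T] by rewrite in_itv/= lexx.
have CA0 := bdsum_ge0 (bA zT); have CA10 := bdsum_ge0 (ba zT); have CB0 := bdsum_ge0 (bb zT).
have Mt0 : 0 <= M ^+ 2 * tau by rewrite mulr_ge0 ?sqr_ge0.
have d1 : 0 < delta^-1 by rewrite invr_gt0.
apply: le_trans (energy_coercive tT) _.
apply: (@le_trans _ _ (expR (2 * (CA + CA1 + CB) * (1 + delta^-1) * t) *
    (energy 0 + 2 * (CA + CA1) * (M ^+ 2 * tau) * t))).
  apply: (@gronwall _ T energy denergy) => //.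
  - exact: tder_energy.
  - by rewrite !mulr_ge0 ?addr_ge0// ltW.
  - by rewrite !mulr_ge0 ?addr_ge0// ltW.
  move=> x /subset_itv_oo_cc xT; apply: le_trans (denergy_le xT) _.
  rewrite lerD2r -[leRHS]mulrA ler_wpM2l ?mulr_ge0 ?addr_ge0//.
  have h := energy_coercive xT.
  have V0 : 0 <= V x by apply: sumr_ge0 => k _; exact: sqr_ge0.
  have X0 : 0 <= X x by apply: sumr_ge0 => k _; rewrite mulr_ge0 ?sqr_ge0.
  have h1 : X x + V x <= (1 + delta^-1) * (X x + delta * V x).
    rewrite mulrDl mul1r mulrDr mulKf ?gt_eqF//.
    have := mulr_ge0 (ltW delta0) V0; have := mulr_ge0 (ltW d1) X0; lra.
  by apply: (le_trans h1); rewrite ler_wpM2l// addr_ge0// ltW.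
rewrite ler_wpM2l ?expR_ge0// lerD2r /energy big_split/= -mulr_sumr -/(V 0) -/(X 0).
have := lerNnormlW (@trilinear_le 0 (a 0) _ (ba zT)).
rewrite /y; lra.
Qed.

End Energy.

(** * Interaction kernel and weights *)

Section Kernel.
Variable R : realType.
Implicit Types (j l k : int) (w : nat -> R).

(* The quadratic term of the equation has Fourier coefficients
   [\sum_(j + l = k) kap j l * z_j * z_l]. *)
Definition kap j l : R :=
  2^-1 * ((j + l)%:~R ^+ 2 * ak R (j + l) * Num.sg j%:~R * Num.sg l%:~R
          - (j + l)%:~R * Num.sg j%:~R * l%:~R ^+ 2
          - (j + l)%:~R * Num.sg l%:~R * j%:~R ^+ 2).

Lemma kapC j l : kap j l = kap l j.
Proof. by rewrite /kap (addrC l j); ring. Qed.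

Lemma kapN j l : kap (- j) (- l) = kap j l.
Proof. by rewrite /kap -opprD /ak !rmorphN/= normrN !sgrN; ring. Qed.

(** The parts of [kap] that are cubic in the larger frequency cancel to leading order, and what
    remains is at most quadratic in it; [kap_opp] shows the same for opposite signs. *)
Lemma kap_same (a b : nat) : kap a b = (a%:R + b%:R) * a%:R * b%:R.
Proof.
rewrite /kap /ak -!natz -natrD !natz !pmulrn -!pmulrn normr_nat natrD.
case: a => [|a]; first by rewrite sgr0; ring.
case: b => [|b]; first by rewrite sgr0; ring.
by rewrite !gtr0_sg//; field.
Qed.

Lemma kap_opp (a b : nat) : (a <= b)%N -> kap (- a%:Z) b = (b%:R - a%:R) ^+ 2 * a%:R.
Proof.
move=> ab; have e : - a%:Z + b%:Z = (b - a)%N by lia.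
rewrite /kap /ak e rmorphN/= -!pmulrn normr_nat natrB// sgrN.
case: a ab {e} => [|a] ab; first by rewrite sgr0; ring.
by rewrite !gtr0_sg ?ltr0n//; [field|lia].
Qed.

(** The last clause is a discrete form of n w'(n) <= K w(n), that is of at most polynomial
    growth. *)
Definition slow w (K : R) := [/\ forall n, 0 <= w n,
  forall n n', (n <= n')%N -> w n <= w n' &
  forall a b, (a <= b)%N -> b%:R * (w (b + a)%N - w b) <= K * a%:R * w b].

(** The increment is taken backwards from b. If a <= b - a, this is [slow] at b - a and
    monotonicity; otherwise b - a is itself less than a and K >= 1 suffices. *)
Lemma slow_diff w K (a b : nat) : 1 <= K -> slow w K -> (a <= b)%N ->
  (b - a)%:R * (w b - w (b - a)%N) <= K * a%:R * w b.
Proof.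
move=> K1 [w0 wle ws] ab; have [h|h] := leqP a (b - a).
  have := ws _ _ h; rewrite subnK// => /le_trans; apply.
  by apply: ler_wpM2l; [rewrite mulr_ge0// (le_trans ler01)|exact/wle/leq_subr].
apply: (@le_trans _ _ ((b - a)%:R * w b)).
  by rewrite ler_wpM2l// lerBlDr lerDl.
rewrite ler_wpM2r// (@le_trans _ _ a%:R) ?ler_nat 1?ltnW//.
by rewrite ler_peMl.
Qed.

(* For |j| much smaller than |l| each of the two terms has size |j| l^2 w(l); in
   the difference the weight w(l) only comes with one power of l. *)
Lemma kap_commutator w K j l : 1 <= K -> slow w K ->
  `| w (absz (j + l)) * kap j l - (j + l)%:~R *
     (ak R j * l%:~R * w (absz l) + ak R l * j%:~R * w (absz j)) |
  <= (2 * K + 2) * (j%:~R ^+ 2 * ak R l * w (absz l) + l%:~R ^+ 2 * ak R j * w (absz j)).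
Proof.
move=> K1 sw; have [w0 wle ws] := sw.
pose G j l := w (absz (j + l)) * kap j l - (j + l)%:~R *
     (ak R j * l%:~R * w (absz l) + ak R l * j%:~R * w (absz j)).
pose B j l := (2 * K + 2) * (j%:~R ^+ 2 * ak R l * w (absz l) + l%:~R ^+ 2 * ak R j * w (absz j)).
have GC x y : G x y = G y x by rewrite /G kapC (addrC y x); congr (_ - _); congr (_ * _); rewrite addrC.
have BC x y : B x y = B y x by rewrite /B; ring.
have GN x y : G (- x) (- y) = G x y.
  by rewrite /G kapN -opprD /ak !abszN !rmorphN/= !normrN; ring.
have BN x y : B (- x) (- y) = B x y by rewrite /B /ak !abszN !rmorphN/= !normrN; ring.
(* Both sides are invariant under the exchange of j and l and under a simultaneous change of sign,
   so two cases remain: equal or opposite signs, with the larger frequency second and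
   nonnegative. *)
suff H (a b : nat) : (a <= b)%N -> `|G a b| <= B a b /\ `|G (- a%:Z) b| <= B (- a%:Z) b.
  have H' (x y : int) : (absz x <= absz y)%N -> `|G x y| <= B x y.
    move=> xy; have [h1 h2] := H _ _ xy.
    have ab (u : int) : u = absz u \/ u = - (absz u)%:Z by lia.
    case: (ab x) (ab y) => -> [->|->] //.
      by rewrite -(opprK (absz x)%:Z) GN BN.
    by rewrite GN BN.
  rewrite -/(G j l) -/(B j l).
  have [|/ltnW] := leqP (absz j) (absz l); first exact: H'.
  by rewrite GC BC; exact: H'.
move=> ab; have a0 : 0 <= a%:R :> R by []. have b0 : 0 <= b%:R :> R by [].
have ab' : a%:R <= b%:R :> R by rewrite ler_nat.
have K0 : 0 <= K by exact: le_trans ler01 K1.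
have wa := w0 a; have wb := w0 b; have w1 := wle _ _ ab.
split.
  have e : absz (a%:Z + b%:Z) = (a + b)%N by lia.
  rewrite /G /B e kap_same /ak intrD -!pmulrn !normr_nat !absz_nat.
  have h1 := ws _ _ ab; rewrite addnC in h1.
  have h2 : 0 <= w (a + b)%N - w b by rewrite subr_ge0 wle ?leq_addl.
  set W := w (a + b)%N in h1 h2 *; move: (w a) (w b) W wa wb w1 h1 h2 => u v W u0 v0 uv h1 h2.
  rewrite (_ : _ - _ = (a%:R + b%:R) * a%:R * b%:R * ((W - v) - u)); last by ring.
  set x : R := a%:R in a0 ab' h1 *; set z : R := b%:R in b0 ab' h1 *.
  apply: (@le_trans _ _ ((x + z) * x * z * ((W - v) + u))).
    rewrite normrM ger0_norm ?mulr_ge0 ?addr_ge0// ler_wpM2l ?mulr_ge0 ?addr_ge0//.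
    by rewrite ler_norml; apply/andP; split; lra.
  have h3 : x * (z * (W - v)) <= x * (K * x * v) by rewrite ler_wpM2l.
  have h4 : (x + z) * (x * (z * (W - v))) <= (z + z) * (x * (K * x * v)).
    apply: (ler_pM _ _ _ h3); first exact: addr_ge0; last by rewrite lerD2r.
    by rewrite !mulr_ge0.
  have h5 : (x + z) * (x * z * u) <= (z + z) * (x * z * u).
    by rewrite ler_wpM2r ?mulr_ge0// lerD2r.
  rewrite (_ : _ * _ * _ * _ = (x + z) * (x * (z * (W - v))) + (x + z) * (x * z * u)); last by ring.
  apply: le_trans (lerD h4 h5) _; rewrite -subr_ge0.
  rewrite (_ : _ - _ = 2 * (x * x * z * v) + 2 * (K * (z * z * x * u))); last by ring.
  by rewrite addr_ge0 ?mulr_ge0.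
have e : absz (- a%:Z + b%:Z) = (b - a)%N by lia.
rewrite /G /B e kap_opp// /ak intrD !rmorphN/= normrN -!pmulrn !normr_nat abszN !absz_nat.
have h1 := slow_diff K1 sw ab.
have h2 : 0 <= w b - w (b - a)%N by rewrite subr_ge0 wle ?leq_subr.
have w3 := w0 (b - a)%N.
rewrite natrB// in h1.
move: (w a) (w b) (w (b - a)%N) wa wb w1 w3 h1 h2 => u v W u0 v0 uv W0 h1 h2.
set x : R := a%:R in a0 ab' h1 *; set z : R := b%:R in b0 ab' h1 *.
(* This form isolates the increment v - W of the weight; it comes with the factor z - x, which
   [slow_diff] trades for K * x. *)
rewrite (_ : _ - _ = (z - x) * x * (z * u - (z * (v - W) + x * W))); last by ring.
apply: (@le_trans _ _ ((z - x) * x * (z * u + (z * (v - W) + x * W)))).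
  rewrite normrM ger0_norm ?mulr_ge0 ?subr_ge0// ler_wpM2l ?mulr_ge0 ?subr_ge0//.
  have := mulr_ge0 b0 u0; have := mulr_ge0 b0 h2; have := mulr_ge0 a0 W0 => *.
  by rewrite ler_norml; apply/andP; split; lra.
have h3 : (z * x) * ((z - x) * (v - W)) <= (z * x) * (K * x * v) by rewrite ler_wpM2l ?mulr_ge0.
have h4 : (z - x) * x * (z * u) <= z * x * (z * u).
  by rewrite ler_wpM2r ?mulr_ge0// ler_wpM2r// gerBl.
have h5 : (z - x) * x * (x * W) <= z * x * (x * v).
  rewrite ler_pM ?mulr_ge0 ?subr_ge0//; first by rewrite ler_wpM2r// gerBl.
  by rewrite ler_wpM2l// -subr_ge0.
rewrite (_ : (z - x) * x * _ = (z - x) * x * (z * u) + z * x * ((z - x) * (v - W))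
  + (z - x) * x * (x * W)); last by ring.
apply: le_trans (lerD (lerD h4 h3) h5) _; rewrite -subr_ge0.
rewrite (_ : _ - _ = (2 * K + 1) * (z * z * x * u) + (K + 1) * (x * x * z * v)); last by ring.
by rewrite addr_ge0 ?mulr_ge0 ?addr_ge0 ?mulr_ge0.
Qed.

Lemma kap_opp' (a b : nat) : (b <= a)%N -> kap (- a%:Z) b = (a%:R - b%:R) ^+ 2 * b%:R.
Proof. by move=> ba; rewrite kapC -kapN opprK kap_opp. Qed.

Lemma int_sym_ind (P : int -> int -> Prop) :
  (forall x y, P x y -> P (- x) (- y)) ->
  (forall a b : nat, P a b) -> (forall a b : nat, P (- a%:Z) b) ->
  forall j l, P j l.
Proof.
move=> PN Pp Pm j l.
have ab (u : int) : u = absz u \/ u = - (absz u)%:Z by lia.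
case: (ab j) (ab l) => -> [->|->] //.
  by rewrite -(opprK (absz j)%:Z); apply: PN.
exact: PN.
Qed.

Lemma kap_le j l : `|kap j l| <= j%:~R ^+ 2 * ak R l + l%:~R ^+ 2 * ak R j.
Proof.
move: j l; apply: int_sym_ind => [x y|a b|a b].
- by rewrite kapN /ak !rmorphN/= !normrN !sqrrN.
- rewrite kap_same /ak -!pmulrn !normr_nat ger0_norm ?mulr_ge0 ?addr_ge0//.
  by rewrite le_eqVlt; apply/orP; left; apply/eqP; ring.
rewrite /ak !rmorphN/= !normrN !sqrrN -!pmulrn !normr_nat.
have sq (x z : R) : 0 <= x -> x <= z -> (z - x) ^+ 2 * x <= x ^+ 2 * z + z ^+ 2 * x.
  move=> x0 xz; rewrite -subr_ge0 (_ : _ - _ = x ^+ 2 * (3 * z - x)); last by ring.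
  by rewrite mulr_ge0 ?sqr_ge0// subr_ge0 (le_trans xz)// ler_peMl ?(le_trans x0)// ler1n.
have [ab|/ltnW ab] := leqP a b.
  rewrite kap_opp// ger0_norm; last by rewrite mulr_ge0 ?sqr_ge0.
  by apply: sq; rewrite ?ler_nat.
rewrite kap_opp'// ger0_norm; last by rewrite mulr_ge0 ?sqr_ge0.
by rewrite [leRHS]addrC; apply: sq; rewrite ?ler_nat.
Qed.

(** Here j is the frequency of the coefficient and l that of the unknown, so only one of the two
    symmetric transport terms is subtracted. For equal signs nothing remains. *)
Lemma kap_sub j l : `|kap j l - (j + l)%:~R * ak R j * l%:~R|
  <= 2 * (j%:~R ^+ 2 * ak R l).
Proof.
move: j l; apply: int_sym_ind => [x y|a b|a b].
- by rewrite kapN -opprD /ak !rmorphN/= !normrN !sqrrN mulrN !mulNr opprK.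
- rewrite kap_same /ak intrD -!pmulrn !normr_nat subrr normr0.
  by rewrite !mulr_ge0 ?sqr_ge0.
rewrite /ak intrD !rmorphN/= !normrN !sqrrN -!pmulrn !normr_nat.
have [ab|/ltnW ab] := leqP a b.
  rewrite kap_opp//; have ab' : a%:R <= b%:R :> R by rewrite ler_nat.
  rewrite (_ : _ - _ = - ((b%:R - a%:R) * a%:R ^+ 2)); last by ring.
  rewrite normrN ger0_norm ?mulr_ge0 ?sqr_ge0 ?subr_ge0// mulrC mulrCA ler_wpM2l ?sqr_ge0//.
  have := ler0n R a; have := ler0n R b; lra.
rewrite kap_opp'//; have ab' : b%:R <= a%:R :> R by rewrite ler_nat.
rewrite (_ : _ - _ = (a%:R - b%:R) * b%:R * (2 * a%:R - b%:R)); last by ring.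
have a0 := ler0n R a; have b0 := ler0n R b.
have h : 0 <= 2 * a%:R - b%:R :> R by lra.
rewrite ger0_norm; last by rewrite !mulr_ge0// subr_ge0.
rewrite -subr_ge0 (_ : _ - _ = b%:R ^+ 2 * (3 * a%:R - b%:R)); last by ring.
by rewrite mulr_ge0 ?sqr_ge0//; lra.
Qed.

End Kernel.

Section Weights.
Variable R : realType.
Implicit Types (w : nat -> R).

(** With x = a / b in [0, 1] this is (1 + x)^p <= 1 + (2^p - 1) x: a convex function lies below its
    chord. *)
Lemma expD_le (a b : R) p : 0 <= a -> a <= b ->
  (b + a) ^+ p * b <= b ^+ p * (b + (2 ^+ p - 1) * a).
Proof.
move=> a0 ab; have b0 := le_trans a0 ab.
elim: p => [|p ih]; first by rewrite !expr0 subrr mul0r addr0.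
rewrite exprS -mulrA.
apply: (@le_trans _ _ ((b + a) * (b ^+ p * (b + (2 ^+ p - 1) * a)))).
  by rewrite ler_wpM2l ?addr_ge0.
rewrite mulrCA !exprSr -[leRHS]mulrA ler_wpM2l ?exprn_ge0//.
have h : 1 <= 2 ^+ p :> R by rewrite exprn_ege1// ler1n.
move: (2 ^+ p) h => c c1.
rewrite -subr_ge0 (_ : _ - _ = (c - 1) * a * (b - a)); last by ring.
by rewrite !mulr_ge0 ?subr_ge0.
Qed.

(** The last hypothesis says that w n / n^p is nonincreasing, so w (b + a) <= (1 + a / b)^p w b, and
    [expD_le] makes this linear in a / b. *)
Lemma slow_power w p : (forall n, 0 <= w n) ->
  (forall n n', (n <= n')%N -> w n <= w n') ->
  (forall a b, (0 < a)%N -> (a <= b)%N -> a%:R ^+ p * w b <= b%:R ^+ p * w a) ->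
  slow w (2 ^+ p).
Proof.
move=> w0 wle wp; split => // a b ab.
have [b0|b0] := posnP b.
  by move: ab; rewrite b0 leqn0 => /eqP ->; rewrite !(mul0r, mulr0).
have b0' : 0 < b%:R ^+ p :> R by rewrite exprn_gt0// ltr0n.
rewrite -(ler_pM2l b0').
have h1 := wp _ _ b0 (leq_addr a b).
have h2 := @expD_le a%:R b%:R p (ler0n _ _) _.
have {}h2 : (b%:R + a%:R) ^+ p * b%:R <= b%:R ^+ p * (b%:R + (2 ^+ p - 1) * a%:R) :> R.
  by apply: h2; rewrite ler_nat.
rewrite natrD in h1.
have h3 := ler_wpM2r (w0 b) h2; have h4 := ler_wpM2l (ler0n R b) h1.
have h5 : 0 <= b%:R ^+ p * a%:R * w b by rewrite !mulr_ge0// ltW.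
lra.
Qed.

(** For N0 > 0 and L >= 1: 1 up to N0, then n / N0, then L from L * N0 on. The growth is linear so
    that it costs a single power of n in [slow], whatever N0 and L are. *)
Definition ramp (N0 : nat) (L : R) (n : nat) : R := Num.min (Num.max 1 (n%:R / N0%:R)) L.

(* The factor [ramp] makes a bound on the weighted energy force smallness of the
   frequencies beyond [L * N0]; freezing the weight beyond frequency [N] keeps it
   bounded, so that the energy is known to be finite. *)
Definition weight (s : R) N0 L N (n : nat) : R :=
  (1 + (minn n N)%:R ^+ 2) `^ ((s - 1) / 2) * ramp N0 L (minn n N).

Lemma ramp_ge1 N0 L n : 1 <= L -> 1 <= ramp N0 L n.
Proof. by move=> L1; rewrite /ramp le_min L1 le_max lexx. Qed.

Lemma ramp_leL N0 L n : ramp N0 L n <= L.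
Proof. by rewrite /ramp ge_min lexx orbT. Qed.

Lemma ramp_le N0 L a b : (a <= b)%N -> ramp N0 L a <= ramp N0 L b.
Proof.
move=> ab; rewrite /ramp le_min !ge_min lexx orbT andbT.
apply/orP; left; rewrite ge_max !le_max lexx/=; apply/orP; right.
by rewrite ler_wpM2r ?invr_ge0// ler_nat.
Qed.

Lemma ramp_small N0 L n : 1 <= L -> (n <= N0)%N -> ramp N0 L n = 1.
Proof.
move=> L1 nN; rewrite /ramp max_l ?min_l//.
have [->|N0p] := posnP N0; first by rewrite invr0 mulr0.
by rewrite ler_pdivrMr ?ltr0n// mul1r ler_nat.
Qed.

Lemma ramp_large N0 L n : (0 < N0)%N -> L * N0%:R <= n%:R -> ramp N0 L n = L.
Proof.
move=> N0p h; rewrite /ramp min_r// le_max; apply/orP; right.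
by rewrite ler_pdivlMr ?ltr0n.
Qed.

Lemma ramp_power N0 L a b : 1 <= L -> (a <= b)%N ->
  a%:R * ramp N0 L b <= b%:R * ramp N0 L a.
Proof.
move=> L1 ab; have ab' : a%:R <= b%:R :> R by rewrite ler_nat.
rewrite /ramp [leRHS]mulrC minr_pMl// le_min; apply/andP; split; last first.
  apply: (@le_trans _ _ (a%:R * L)); first by rewrite ler_wpM2l// ge_min lexx orbT.
  by rewrite mulrC ler_wpM2l// (le_trans ler01).
rewrite maxr_pMl// mul1r le_max.
have [h|h] := leP (b%:R / N0%:R) (1 : R).
  by rewrite (min_l L1) mulr1 ab'.
apply/orP; right; apply: (@le_trans _ _ (a%:R * (b%:R / N0%:R))).
  by rewrite ler_wpM2l// ge_min lexx.
by rewrite mulrA mulrAC.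
Qed.

Lemma weight_ge0 s N0 L N n : 1 <= L -> 0 <= weight s N0 L N n.
Proof. by move=> L1; rewrite mulr_ge0 ?powR_ge0// (le_trans ler01)// ramp_ge1. Qed.

Lemma weight_le s N0 L N n n' : 1 <= s -> 1 <= L -> (n <= n')%N ->
  weight s N0 L N n <= weight s N0 L N n'.
Proof.
move=> s1 L1 nn'; have mm : (minn n N <= minn n' N)%N by lia.
rewrite ler_pM ?powR_ge0 ?(le_trans ler01 (ramp_ge1 _ _ _))// ?ramp_le//.
rewrite ge0_ler_powR ?nnegrE ?addr_ge0 ?sqr_ge0 ?divr_ge0 ?subr_ge0//.
by rewrite lerD2l lerXn2r ?nnegrE ?ler_nat.
Qed.

(** The ratio of 1 + b^2 to 1 + a^2 is at most (b / a)^2, and b / a >= 1, so its power e is at most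
    (b / a)^p. *)
Lemma bracket_power (e : R) p (a b : nat) : 0 <= e -> 2 * e <= p%:R -> (0 < a)%N ->
  (a <= b)%N ->
  a%:R ^+ p * (1 + b%:R ^+ 2) `^ e <= b%:R ^+ p * (1 + a%:R ^+ 2) `^ e :> R.
Proof.
move=> e0 ep a0 ab; have a0' : 0 < a%:R :> R by rewrite ltr0n.
have ab' : a%:R <= b%:R :> R by rewrite ler_nat.
have b0' := lt_le_trans a0' ab'.
have sa : 0 < 1 + a%:R ^+ 2 :> R by rewrite ltr_wpDr ?sqr_ge0.
have sb : 0 < 1 + b%:R ^+ 2 :> R by rewrite ltr_wpDr ?sqr_ge0.
have r1 : 1 <= b%:R / a%:R :> R by rewrite ler_pdivlMr// mul1r.
have h : (1 + b%:R ^+ 2) / (1 + a%:R ^+ 2) <= (b%:R / a%:R) ^+ 2 :> R.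
  rewrite expr_div_n ler_pdivrMr// mulrAC ler_pdivlMr ?exprn_gt0//.
  by rewrite !mulrDl !mulrDr !mul1r !mulr1 mulrC lerD2r lerXn2r ?nnegrE// ltW.
have {}h : ((1 + b%:R ^+ 2) / (1 + a%:R ^+ 2)) `^ e <= (b%:R / a%:R) ^+ p :> R.
  apply: (@le_trans _ _ (((b%:R / a%:R) ^+ 2) `^ e)).
    by rewrite ge0_ler_powR ?nnegrE ?divr_ge0 ?(ltW sa) ?(ltW sb) ?sqr_ge0.
  rewrite -!powR_mulrn ?divr_ge0// -powRrM; exact: ler_powR.
have -> : 1 + b%:R ^+ 2 = (1 + b%:R ^+ 2) / (1 + a%:R ^+ 2) * (1 + a%:R ^+ 2) :> R.
  by rewrite divfK// gt_eqF.
rewrite powRM ?divr_ge0 ?(ltW sa) ?(ltW sb)// mulrA ler_wpM2r ?powR_ge0//.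
apply: (@le_trans _ _ (a%:R ^+ p * (b%:R / a%:R) ^+ p)).
  by rewrite ler_wpM2l ?exprn_ge0.
by rewrite -exprMn mulrC divfK// gt_eqF.
Qed.

(** The order of the quantifiers matters: K depends on s alone, so L and N0 can be chosen after the
    Gronwall constant is known. *)
Lemma weight_slow s : 1 <= s -> exists2 K, 1 <= K &
  forall N0 L N, 1 <= L -> (0 < N)%N -> slow (weight s N0 L N) K.
Proof.
move=> s1.
have [q sq] : exists q : nat, s - 1 <= q%:R.
  exists (Num.truncn (s - 1)).+1; apply/ltW; exact: truncnS_gt.
(* The bracket takes q powers of n and the ramp one more. *)
exists (2 ^+ q.+1); first by rewrite exprn_ege1// ler1n.
move=> N0 L N L1 N_gt0; apply: slow_power => [n|n n'|a b a0 ab].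
- exact: weight_ge0.
- exact: weight_le.
pose a' := minn a N; pose b' := minn b N.
have a'0 : (0 < a')%N by lia. have ab' : (a' <= b')%N by lia.
have h1 := @bracket_power ((s - 1) / 2) q a' b' _ _ a'0 ab'.
have {}h1 : a'%:R ^+ q * (1 + b'%:R ^+ 2) `^ ((s - 1) / 2)
    <= b'%:R ^+ q * (1 + a'%:R ^+ 2) `^ ((s - 1) / 2) :> R.
  by apply: h1; rewrite ?divr_ge0 ?subr_ge0// mulrC divfK.
have h2 := @ramp_power N0 L a' b' L1 ab'.
(* Freezing beyond N only lowers ratios: b' / a' <= b / a. *)
have h3 : (a * b' <= b * a')%N.
  rewrite /a' /b' /minn; case: ifP => h; case: ifP => h'; nia.
have h4 : a'%:R ^+ q.+1 * weight s N0 L N b <= b'%:R ^+ q.+1 * weight s N0 L N a.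
  have r0 n : 0 <= ramp N0 L n by exact: le_trans ler01 (ramp_ge1 _ _ L1).
  rewrite /weight -/a' -/b' !(exprSr _ q) mulrACA [leRHS]mulrACA.
  by rewrite ler_pM// ?mulr_ge0 ?exprn_ge0 ?powR_ge0//.
have a'q : 0 < a'%:R ^+ q.+1 :> R by rewrite exprn_gt0// ltr0n.
rewrite -(ler_pM2l a'q) mulrCA.
apply: (@le_trans _ _ (a%:R ^+ q.+1 * (b'%:R ^+ q.+1 * weight s N0 L N a))).
  by rewrite ler_wpM2l ?exprn_ge0.
rewrite mulrA [leRHS]mulrA -exprMn -exprMn; apply: ler_wpM2r; first exact: weight_ge0.
by apply: lerXn2r; rewrite ?nnegrE ?mulr_ge0// -!natrM ler_nat (mulnC a').
Qed.

End Weights.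

Section FourierSystem.
Variable R : realType.
Local Notation C := R[i].
Local Notation Re := complex.Re.
Implicit Types (z p : R -> int -> C).

(* [z] and [p] are the Fourier coefficients of the solution and of its time
   derivative, [fs_z] and [fs_p] bound their H^3 and H^2 norms, and
   [fs_coercive] is mu - 2 H[phi]_x >= delta tested against squares of
   trigonometric polynomials. *)
Record fourier_system (T mu delta H : R) z p : Prop := {
  fs_herm : forall t, t \in `[0, T] -> forall k, z t (- k) = (z t k)^*%C ;
  fs_der : forall t, t \in `[0, T] -> forall k, ctder T (z ^~ k) (p t k) t ;
  fs_eq : exists2 N : R -> int -> C,
    forall t, t \in `[0, T] -> forall k,
      ctder T (p ^~ k) (N t k - (mu * k%:~R ^+ 2)%:C%C * z t k) t &
    forall t, t \in `[0, T] -> forall k e, 0 < e ->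
      exists L0, forall L, (L0 <= L)%N ->
      nc (N t k - \sum_(j <- box L) \sum_(l <- box L)
        (if j + l == k then (kap R j l)%:C%C * (z t j * z t l) else 0)) <= e ;
  fs_z : forall t, t \in `[0, T] ->
    bdsum (fun k => (1 + k%:~R ^+ 2) ^+ 3 * nc (z t k) ^+ 2) H ;
  fs_p : forall t, t \in `[0, T] ->
    bdsum (fun k => (1 + k%:~R ^+ 2) ^+ 2 * nc (p t k) ^+ 2) H ;
  fs_coercive : forall t, t \in `[0, T] -> forall P (h : int -> C),
    delta * \sum_(k <- box P) nc (h k) ^+ 2 <=
    mu * \sum_(k <- box P) nc (h k) ^+ 2
    - 2 * Re (\sum_(k <- box P) \sum_(l <- box P)
        (ak R (k - l))%:C%C * z t (k - l) * h l * (h k)^*%C) }.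

(** By telescoping: the frequencies x and - x contribute 2 / (1 + x^2) <= 4 / x - 4 / (x + 1), and
    for N = 0 the bound 5 - 4 / N.+1 equals the term 1 of frequency 0. *)
Lemma bdsum_inv_sqr : bdsum (fun k : int => (1 + k%:~R ^+ 2 : R)^-1) 5.
Proof.
apply: bdsum_box => [k|N]; first by rewrite invr_ge0 addr_ge0 ?sqr_ge0.
suff h : \sum_(k <- box N) (1 + k%:~R ^+ 2 : R)^-1 <= 5 - 4 / N.+1%:R.
  by apply: le_trans h _; rewrite gerBl divr_ge0.
have boxS n : perm_eq (box n.+1) (n.+1%:Z :: - n.+1%:Z :: box n).
  apply: uniq_perm; first exact: box_uniq.
    by rewrite !cons_uniq box_uniq !inE !mem_box; lia.
  by move=> k; rewrite !inE !mem_box; lia.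
elim: N => [|n ih].
  by rewrite /box; unlock; rewrite /= big_seq1 subrr expr0n/= addr0 invr1; lra.
rewrite (perm_big _ (boxS n)) !big_cons rmorphN/= sqrrN -!pmulrn.
have n0 : 0 < n.+1%:R :> R by [].
rewrite -[n.+2%:R]natr1; move: (n.+1%:R : R) n0 ih => x x0 ih.
have h1 : 0 < 1 + x ^+ 2 by rewrite ltr_wpDr ?sqr_ge0.
have x1 : 0 < x + 1 by lra.
have : (1 + x ^+ 2)^-1 + (1 + x ^+ 2)^-1 <= 4 / x - 4 / (x + 1).
  rewrite -subr_ge0 (_ : _ - _ = (2 * (x ^+ 2 + 1) + (x - 1) ^+ 2 * 0 + (2 - 2 * x)
     ) / (x * (x + 1) * (1 + x ^+ 2))).
    rewrite divr_ge0 ?mulr_ge0 ?(ltW x0) ?(ltW x1) ?(ltW h1)//; nra.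
  by field; rewrite !gt_eqF.
lra.
Qed.

Section Bounds.
Variables (T mu delta H : R) (z p : R -> int -> C).
Hypothesis fs : fourier_system T mu delta H z p.

(** By 2 k^2 |z| <= (1 + k^2)^3 |z|^2 + (1 + k^2)^-1, whose last terms sum to at most 5. This is the
    origin of the constant 2^-1 * (H + 5). *)
Lemma fs_z2 t : t \in `[0, T] ->
  bdsum (fun k => k%:~R ^+ 2 * nc (z t k)) (2^-1 * (H + 5)).
Proof.
move=> tT; apply: bdsum_le (bdsumZ _ (bdsumD (fs_z fs tT) bdsum_inv_sqr)) => [k|]; last by lra.
have x0 : 0 <= k%:~R ^+ 2 :> R by exact: sqr_ge0.
move: (k%:~R ^+ 2 : R) (nc (z t k)) x0 (nc_ge0 (z t k)) => x u x0 u0.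
have x1 : 0 < 1 + x by lra.
rewrite [2^-1 * _]mulrC ler_pdivlMr// -subr_ge0.
have -> : (1 + x) ^+ 3 * u ^+ 2 + (1 + x)^-1 - x * u * 2 =
  (((1 + x) ^+ 2 * u - 1) ^+ 2 + 2 * u * (1 + x)) / (1 + x).
  by field; rewrite gt_eqF.
by rewrite divr_ge0 ?addr_ge0 ?sqr_ge0 ?mulr_ge0// ltW.
Qed.

Lemma ak_sq k : ak R k ^+ 2 = k%:~R ^+ 2.
Proof. by rewrite real_normK ?num_real. Qed.

Lemma ak_le_sq k : ak R k <= k%:~R ^+ 2.
Proof.
rewrite -ak_sq /ak -intr_norm; have [->|k0] := eqVneq k 0; first by rewrite expr0n.
by rewrite expr2 ler_peMr// ?ler0z// ler1z; lia.
Qed.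

Lemma fs_z1 t : t \in `[0, T] -> bdsum (fun k => ak R k * nc (z t k)) (2^-1 * (H + 5)).
Proof.
by move/fs_z2; apply: bdsum_le => k; rewrite ler_wpM2r ?nc_ge0// ak_le_sq.
Qed.

Lemma fs_p1 t : t \in `[0, T] -> bdsum (fun k => ak R k * nc (p t k)) (2^-1 * (H + 5)).
Proof.
move=> tT; apply: bdsum_le (bdsumZ _ (bdsumD (fs_p fs tT) bdsum_inv_sqr)) => [k|]; last by lra.
rewrite -ak_sq; move: (ak R k) (nc (p t k)) (ak_ge0 R k) (nc_ge0 (p t k)) => x u x0 u0.
have x1 : 0 < 1 + x ^+ 2 by rewrite ltr_wpDr ?sqr_ge0.
rewrite [2^-1 * _]mulrC ler_pdivlMr// -subr_ge0.
have -> : (1 + x ^+ 2) ^+ 2 * u ^+ 2 + (1 + x ^+ 2)^-1 - x * u * 2 =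
  ((x * u * (1 + x ^+ 2) - 1) ^+ 2 + u ^+ 2 * (1 + x ^+ 2) ^+ 2) / (1 + x ^+ 2).
  by field; rewrite gt_eqF.
by rewrite divr_ge0 ?addr_ge0 ?sqr_ge0 ?mulr_ge0 ?sqr_ge0// ltW.
Qed.

Lemma fs_z6 t : t \in `[0, T] -> bdsum (fun k => k%:~R ^+ 6 * nc (z t k) ^+ 2) H.
Proof.
move/(fs_z fs); apply: bdsum_le => k; rewrite ler_wpM2r ?sqr_ge0//.
by rewrite (exprM _ 2 3) lerXn2r ?nnegrE ?addr_ge0 ?sqr_ge0// lerDr.
Qed.

End Bounds.

(** Two of the six powers of k are given up for the factor P.+1 ^ -2. *)
Lemma tail_of_bdsum (v : int -> C) H P r : bdsum (fun k => k%:~R ^+ 6 * nc (v k) ^+ 2) H ->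
  uniq r -> (forall k, k \in r -> (P < `|k|)%N) ->
  \sum_(k <- r) k%:~R ^+ 4 * nc (v k) ^+ 2 <= H / P.+1%:R ^+ 2.
Proof.
move=> hH ur rP; rewrite ler_pdivlMr ?exprn_gt0// mulrC.
apply: le_trans (hH r ur); rewrite mulr_sumr big_seq [leRHS]big_seq.
apply: ler_sum => k /rP kP; rewrite mulrA ler_wpM2r ?sqr_ge0//.
rewrite (exprD _ 2 4) ler_wpM2r//; first by rewrite (exprM _ 2 2) sqr_ge0.
rewrite -ak_sq lerXn2r ?nnegrE ?ak_ge0// /ak -intr_norm.
by rewrite -[P.+1%:R]/(P.+1%:Z%:~R) ler_int; lia.
Qed.

End FourierSystem.

(** * Energy estimates *)

Section EnergyLimit.
Variable R : realType.
Local Notation C := R[i].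
Local Notation Re := complex.Re.

Lemma ler_inv_sqr (x y D : R) : 0 <= D ->
  (exists P0, forall P, (P0 <= P)%N -> x <= y + D / P.+1%:R ^+ 2) -> x <= y.
Proof.
move=> D0 [P0 h]; apply/ler_addgt0Pr => e e0.
have [P1 hP1] : exists P1 : nat, D / e <= P1%:R.
  by exists (Num.truncn (D / e)).+1; apply/ltW; exact: truncnS_gt.
have := h (maxn P0 P1) (leq_maxl _ _) => /le_trans; apply; rewrite lerD2l.
have P1P : P1%:R <= (maxn P0 P1).+1%:R :> R by rewrite ler_nat leqW// leq_maxr.
move: ((maxn P0 P1).+1) (ltn0Sn (maxn P0 P1)) P1P => n n0 P1P.
have n0' : 0 < n%:R :> R by rewrite ltr0n.
rewrite ler_pdivrMr ?exprn_gt0//.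
have : D <= e * n%:R by rewrite mulrC -ler_pdivrMr//; exact: le_trans P1P.
move=> /le_trans; apply; rewrite ler_wpM2l ?(ltW e0)//.
by rewrite expr2 ler_peMl ?(ltW n0')// ler1n.
Qed.

Variables (T mu delta CA CA1 CB M H : R).
Variables (m : int -> R) (a b v p N : R -> int -> C) (Q : R -> int -> int -> C)
  (A : R -> int -> R).
Hypothesis T0 : 0 <= T.
Hypothesis delta0 : 0 < delta.
Hypothesis M0 : 0 <= M.
Hypothesis m0 : forall k, 0 <= m k.
Hypothesis mM : forall k, m k <= M.
Hypothesis va : forall t, t \in `[0, T] -> forall k, ctder T (a ^~ k) (b t k) t.
Hypothesis vp : forall t, t \in `[0, T] -> forall k, ctder T (v ^~ k) (p t k) t.
Hypothesis pq : forall t, t \in `[0, T] -> forall k,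
  ctder T (p ^~ k) (N t k - (mu * k%:~R ^+ 2)%:C%C * v t k) t.
Hypothesis herm : forall t, t \in `[0, T] -> forall k, a t (- k) = (a t k)^*%C.
Hypothesis convN : forall t, t \in `[0, T] -> forall k e, 0 < e ->
  exists L0, forall L, (L0 <= L)%N ->
  nc (N t k - \sum_(j <- box L) \sum_(l <- box L)
    (if j + l == k then Q t j l else 0)) <= e.
Hypothesis A0 : forall t j, 0 <= A t j.
Hypothesis bA : forall t, t \in `[0, T] -> bdsum (A t) CA.
Hypothesis ba : forall t, t \in `[0, T] -> bdsum (fun j => ak R j * nc (a t j)) CA1.
Hypothesis bb : forall t, t \in `[0, T] -> bdsum (fun j => ak R j * nc (b t j)) CB.
Hypothesis kerQ : forall t, t \in `[0, T] -> forall j l,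
  nc ((m (j + l))%:C%C * Q t j l
      - ((j + l)%:~R)%:C%C *
        ((ak R j)%:C%C * a t j * ((l%:~R * m l)%:C%C * v t l)
         + (ak R l)%:C%C * a t l * ((j%:~R * m j)%:C%C * v t j)))
  <= A t j * nc ((l%:~R * m l)%:C%C * v t l) + A t l * nc ((j%:~R * m j)%:C%C * v t j).
Hypothesis bv : forall t, t \in `[0, T] ->
  bdsum (fun k => k%:~R ^+ 6 * nc (v t k) ^+ 2) H.
Hypothesis coercive : forall t, t \in `[0, T] -> forall P (h : int -> C),
  delta * \sum_(k <- box P) nc (h k) ^+ 2 <=
  mu * \sum_(k <- box P) nc (h k) ^+ 2
  - 2 * Re (\sum_(k <- box P) \sum_(l <- box P)
      (ak R (k - l))%:C%C * a t (k - l) * h l * (h k)^*%C).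

(** The list r stays fixed while P grows in [energy_estimate_box], with tau = H / P.+1 ^ 2. The
    weight must be bounded by some M for this limit, but M leaves no trace in the result, so a
    weight may be frozen at any frequency. *)
Lemma energy_estimate Y : 0 <= Y ->
  bdsum (fun k => m k ^+ 2 * (nc (p 0 k) ^+ 2 + (mu + 2 * CA1) * (k%:~R ^+ 2 * nc (v 0 k) ^+ 2))) Y ->
  forall t, t \in `[0, T] ->
  bdsum (fun k => m k ^+ 2 * (nc (p t k) ^+ 2 + delta * (k%:~R ^+ 2 * nc (v t k) ^+ 2)))
    (expR (2 * (CA + CA1 + CB) * (1 + delta^-1) * T) * Y).
Proof.
move=> Y0 hY t tT r ur.
have zT : (0 : R) \in `[0, T] by rewrite in_itv/= lexx.
have CA0 := bdsum_ge0 (bA zT); have CA10 := bdsum_ge0 (ba zT); have CB0 := bdsum_ge0 (bb zT).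
have H0 := bdsum_ge0 (bv zT).
have /andP[t0 tT'] : 0 <= t <= T by move: tT; rewrite in_itv.
set c := 2 * (CA + CA1 + CB) * (1 + delta^-1).
have c0 : 0 <= c by rewrite !mulr_ge0 ?addr_ge0 ?invr_ge0 ?(ltW delta0).
apply: (@ler_inv_sqr _ _ (expR (c * T) * (2 * (CA + CA1) * (M ^+ 2 * H) * T))).
  by rewrite mulr_ge0 ?expR_ge0 ?mulr_ge0 ?addr_ge0 ?sqr_ge0.
have [P0 rP0] := seq_sub_box r; exists P0 => P P0P.
have rP : {subset r <= box P} by move=> k /rP0; rewrite !mem_box => /leq_trans; apply.
have tau0 : 0 <= H / P.+1%:R ^+ 2 by rewrite divr_ge0 ?sqr_ge0.
have := energy_estimate_box delta0 M0 m0 mM tau0 va vp pq herm convN A0 bA ba bb kerQ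
  (fun t tT r ur rP => tail_of_bdsum (bv tT) ur rP) (fun t tT => coercive tT P) T0 tT.
rewrite -/c => h.
have e0 k : nc ((k%:~R * m k)%:C%C * v t k) ^+ 2 = m k ^+ 2 * (k%:~R ^+ 2 * nc (v t k) ^+ 2).
  by rewrite ncM nc_real exprMn real_normK ?num_real//; ring.
have e1 k : nc ((k%:~R * m k)%:C%C * v 0 k) ^+ 2 = m k ^+ 2 * (k%:~R ^+ 2 * nc (v 0 k) ^+ 2).
  by rewrite ncM nc_real exprMn real_normK ?num_real//; ring.
apply: (@le_trans _ _ (\sum_(k <- box P) m k ^+ 2 * nc (p t k) ^+ 2 +
    delta * \sum_(k <- box P) nc ((k%:~R * m k)%:C%C * v t k) ^+ 2)).
  have E k : m k ^+ 2 * nc (p t k) ^+ 2 + delta * nc ((k%:~R * m k)%:C%C * v t k) ^+ 2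
     = m k ^+ 2 * (nc (p t k) ^+ 2 + delta * (k%:~R ^+ 2 * nc (v t k) ^+ 2)).
    by rewrite e0; ring.
  rewrite mulr_sumr -big_split/=; under [leRHS]eq_bigr => k _ do rewrite E.
  apply: sum_subseq => //; last exact: box_uniq.
  move=> k; apply: mulr_ge0 (sqr_ge0 _) (addr_ge0 (sqr_ge0 _) _).
  exact: mulr_ge0 (ltW delta0) (mulr_ge0 (sqr_ge0 _) (sqr_ge0 _)).
apply: le_trans h _.
set Z := _ + _ * _ + _ in |- *.
apply: (@le_trans _ _ (expR (c * T) * (Y + 2 * (CA + CA1) * (M ^+ 2 * (H / P.+1%:R ^+ 2)) * T))).
  have hZ : Z <= Y + 2 * (CA + CA1) * (M ^+ 2 * (H / P.+1%:R ^+ 2)) * T.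
    rewrite /Z lerD//; last by rewrite ler_wpM2l// !mulr_ge0 ?addr_ge0 ?sqr_ge0.
    apply: le_trans (hY _ (box_uniq P)).
    rewrite mulr_sumr -big_split/= le_eqVlt; apply/orP; left; apply/eqP.
    by apply: eq_bigr => k _; rewrite e1; ring.
  apply: (@le_trans _ _ (expR (c * t) * (Y + 2 * (CA + CA1) * (M ^+ 2 * (H / P.+1%:R ^+ 2)) * T))).
    by rewrite ler_wpM2l ?expR_ge0.
  rewrite ler_wpM2r ?ler_expR ?ler_wpM2l//.
  by rewrite addr_ge0// !mulr_ge0 ?addr_ge0 ?sqr_ge0.
rewrite mulrDr lerD2l le_eqVlt; apply/orP; left; apply/eqP.
by rewrite !mulrA; ring.
Qed.

End EnergyLimit.

Section Estimates.
Variables (R : realType) (T mu delta H : R).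
Local Notation C := R[i].
Hypothesis T0 : 0 <= T.
Hypothesis delta0 : 0 < delta.

(** With h = 2^-1 * (H + 5), the three summands are CA = (2 K + 2) h from [kap_commutator] and
    [fs_z2], CA1 = h from [fs_z1], and CB = h from [fs_p1]. *)
Definition growth (K : R) := expR (2 * ((2 * K + 2) * (2^-1 * (H + 5)) + 2^-1 * (H + 5)
  + 2^-1 * (H + 5)) * (1 + delta^-1) * T).

Lemma weighted_estimate (z p : R -> int -> C) w K M Y :
  fourier_system T mu delta H z p ->
  1 <= K -> slow w K -> (forall n, w n <= M) -> 0 <= Y ->
  bdsum (fun k => w (absz k) ^+ 2 * (nc (p 0 k) ^+ 2
     + (mu + 2 * (2^-1 * (H + 5))) * (k%:~R ^+ 2 * nc (z 0 k) ^+ 2))) Y ->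
  forall t, t \in `[0, T] ->
  bdsum (fun k => w (absz k) ^+ 2 * (nc (p t k) ^+ 2 + delta * (k%:~R ^+ 2 * nc (z t k) ^+ 2)))
    (growth K * Y).
Proof.
move=> fs K1 sw wM Y0 hY; have [w0 _ _] := sw; have K0 := le_trans ler01 K1.
have [N pN cN] := fs_eq fs.
apply: (@energy_estimate R T mu delta _ _ _ M H (fun k => w (absz k)) z p z p N
  (fun t j l => (kap R j l)%:C%C * (z t j * z t l))
  (fun t j => (2 * K + 2) * (j%:~R ^+ 2 * nc (z t j)))) => //.
- exact: le_trans (w0 0%N) (wM 0%N).
- exact: fs_der fs.
- exact: fs_der fs.
- exact: fs_herm fs.
- move=> t j; apply: mulr_ge0; first by rewrite addr_ge0 ?mulr_ge0.
  by rewrite mulr_ge0 ?nc_ge0 ?sqr_ge0.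
- by move=> t tT; apply: bdsumZ; [rewrite addr_ge0 ?mulr_ge0|exact: fs_z2 fs _ tT].
- exact: fs_z1 fs.
- exact: fs_p1 fs.
- move=> t _ j l.
  rewrite (_ : _ - _ = (w (absz (j + l)) * kap R j l - (j + l)%:~R *
     (ak R j * l%:~R * w (absz l) + ak R l * j%:~R * w (absz j)))%:C%C * (z t j * z t l)); last first.
    by case: (z t j) (z t l) => ? ? [? ?]; simpc; congr Complex; ring.
  rewrite !ncM !nc_real; apply: le_trans (ler_wpM2r _ (kap_commutator _ _ K1 sw)) _.
    by rewrite mulr_ge0 ?nc_ge0.
  rewrite !normrM !(ger0_norm (w0 _)) -/(ak R j) -/(ak R l).
  by rewrite le_eqVlt; apply/orP; left; apply/eqP; ring.
- exact: fs_z6 fs.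
- exact: fs_coercive fs.
Qed.

Lemma difference_estimate (z p z' p' : R -> int -> C) Y :
  fourier_system T mu delta H z p -> fourier_system T mu delta H z' p' -> 0 <= Y ->
  bdsum (fun k => nc (p' 0 k - p 0 k) ^+ 2
     + (mu + 2 * (2^-1 * (H + 5))) * (k%:~R ^+ 2 * nc (z' 0 k - z 0 k) ^+ 2)) Y ->
  forall t, t \in `[0, T] ->
  bdsum (fun k => nc (p' t k - p t k) ^+ 2 + delta * (k%:~R ^+ 2 * nc (z' t k - z t k) ^+ 2))
    (growth 1 * Y).
Proof.
move=> fs fs' Y0 hY t tT.
have [N pN cN] := fs_eq fs; have [N' pN' cN'] := fs_eq fs'.
pose v t k := z' t k - z t k; pose q t k := p' t k - p t k.
suff : bdsum (fun k => 1 ^+ 2 * (nc (q t k) ^+ 2 + delta * (k%:~R ^+ 2 * nc (v t k) ^+ 2)))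
    (growth 1 * Y).
  by apply: bdsum_le => k; rewrite expr1n mul1r.
(* The factor 4 in [growth 1] is divided between the two solutions: 3 for z' and 1 for z. *)
have C4 : (2 * 1 + 2) * (2^-1 * (H + 5)) = 3 * (2^-1 * (H + 5)) + 1 * (2^-1 * (H + 5)) by ring.
rewrite /growth C4; move: t tT.
(* The bound 4 * H for v comes from |z' - z|^2 <= 2 |z'|^2 + 2 |z|^2. *)
apply: (@energy_estimate R T mu delta _ _ _ 1 (4 * H) (fun k => 1) z' p' v q
  (fun t k => N' t k - N t k)
  (fun t j l => (kap R j l)%:C%C * (z' t j * z' t l) - (kap R j l)%:C%C * (z t j * z t l))
  (fun t j => 3 * (j%:~R ^+ 2 * nc (z' t j)) + 1 * (j%:~R ^+ 2 * nc (z t j)))) => //.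
- exact: fs_der fs'.
- by move=> t tT k; apply: ctderB; [exact: (fs_der fs')|exact: (fs_der fs)].
- move=> t tT k; rewrite /v /q.
  rewrite (_ : _ - _ = (N' t k - (mu * k%:~R ^+ 2)%:C%C * z' t k)
    - (N t k - (mu * k%:~R ^+ 2)%:C%C * z t k)); last by ring.
  by apply: ctderB; [exact: pN'|exact: pN].
- exact: fs_herm fs'.
- move=> t tT k e e0; have e2 : 0 < e / 2 by rewrite divr_gt0.
  have [L1 h1] := cN _ tT k _ e2; have [L2 h2] := cN' _ tT k _ e2.
  exists (maxn L1 L2) => L; rewrite geq_max => /andP[l1 l2].
  rewrite [e]splitr; apply: le_trans (lerD (h2 _ l2) (h1 _ l1)).
  apply: le_trans (ncB _ _); rewrite le_eqVlt; apply/orP; left; apply/eqP; congr nc.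
  have E x x' y y' D : D = y' - y :> C -> x' - x - D = x' - y' - (x - y) by move=> ->; ring.
  apply: E; rewrite -sumrB; apply: eq_bigr => j _; rewrite -sumrB; apply: eq_bigr => l _.
  by case: ifP => _; rewrite ?subr0.
- move=> t j; apply: addr_ge0; apply: mulr_ge0 => //;
    exact: mulr_ge0 (sqr_ge0 _) (nc_ge0 _).
- by move=> t tT; apply: bdsumD; apply: bdsumZ => //; [exact: (fs_z2 fs')|exact: (fs_z2 fs)].
- exact: fs_z1 fs'.
- exact: fs_p1 fs'.
- move=> t _ j l; rewrite !mulr1.
  (* Expansion z' z' - z z = z' v + v z' - v v. By [kap_sub] the first two terms cost 2 |z'|; in the
     last one [kap_le] and |v| <= |z'| + |z|, on the factor that bears two derivatives, cost one
     more |z'| and one |z|. *)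
  rewrite (_ : _ - _ = (kap R j l - (j + l)%:~R * ak R j * l%:~R)%:C%C * (z' t j * v t l)
    + (kap R l j - (l + j)%:~R * ak R l * j%:~R)%:C%C * (z' t l * v t j)
    - (kap R j l)%:C%C * (v t j * v t l)); last first.
    rewrite /v (kapC _ l j) (addrC l j).
    by case: (z t j) (z t l) (z' t j) (z' t l) => ? ? [? ?] [? ?] [? ?]; simpc; congr Complex; ring.
  apply: le_trans (ncB _ _) _; apply: le_trans (lerD (ncD _ _) (lexx _)) _.
  have v1 i : nc (v t i) <= nc (z' t i) + nc (z t i) by exact: ncB.
  rewrite !ncM !nc_real -/(ak R j) -/(ak R l).
  have h1 := ler_wpM2r (mulr_ge0 (nc_ge0 (z' t j)) (nc_ge0 (v t l))) (kap_sub R j l).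
  have h2 := ler_wpM2r (mulr_ge0 (nc_ge0 (z' t l)) (nc_ge0 (v t j))) (kap_sub R l j).
  have h3 := ler_wpM2r (mulr_ge0 (nc_ge0 (v t j)) (nc_ge0 (v t l))) (kap_le R j l).
  have h4 : 0 <= j%:~R ^+ 2 * ak R l * nc (v t l) by exact: mulr_ge0 (mulr_ge0 (sqr_ge0 _) (ak_ge0 _ _)) (nc_ge0 _).
  have h5 : 0 <= l%:~R ^+ 2 * ak R j * nc (v t j) by exact: mulr_ge0 (mulr_ge0 (sqr_ge0 _) (ak_ge0 _ _)) (nc_ge0 _).
  have h6 := ler_wpM2l h4 (v1 j); have h7 := ler_wpM2l h5 (v1 l).
  apply: le_trans (lerD (lerD h1 h2) h3) _; move: h6 h7; clear.
  move: (nc (v t l)) (nc (v t j)) (nc (z' t l)) (nc (z' t j)) (nc (z t l)) (nc (z t j)) (ak R j) (ak R l).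
  move: (j%:~R ^+ 2 : R) (l%:~R ^+ 2 : R) => x1 x2 vl vj z'l z'j zl zj aj al; lra.
- move=> t tT; have := bdsumD (bdsumZ (ler0n R 2) (fs_z6 fs' tT)) (bdsumZ (ler0n R 2) (fs_z6 fs tT)).
  rewrite -mulrDl -natrD; apply: bdsum_le => k.
  have := nc_sqB (z' t k) (z t k); have : 0 <= k%:~R ^+ 6 :> R by rewrite (exprM _ 3 2) sqr_ge0.
  by rewrite /v; move=> k0 /(ler_wpM2l k0); lra.
- exact: fs_coercive fs'.
by apply: bdsum_le hY => k; rewrite expr1n mul1r.
Qed.

End Estimates.

(** * Fourier series on the torus *)

Section TorusIntegral.
Variable R : realType.
Local Notation C := R[i].
Local Notation Re := complex.Re.
Local Notation Im := complex.Im.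
Local Notation mu := (@lebesgue_measure R).
Local Notation I := (`[0%R, (2 * pi)%R]%classic : set R).
Implicit Types f g : R -> R.

Definition torus_integrable f := mu.-integrable I (EFin \o f).

Let mI : measurable I. Proof. exact: measurable_itv. Qed.

Lemma twopi_gt0 : 0 < 2 * pi :> R. Proof. by rewrite mulr_gt0 ?pi_gt0. Qed.

Lemma continuous_torus_integrable f : continuous f -> torus_integrable f.
Proof.
move=> cf; apply: continuous_compact_integrable; first exact: segment_compact.
exact: continuous_subspaceT.
Qed.

Lemma torus_intD f g : torus_integrable f -> torus_integrable g ->
  torus_int (fun x => f x + g x) = torus_int f + torus_int g.
Proof. exact: RintegralD. Qed.

Lemma torus_intB f g : torus_integrable f -> torus_integrable g ->
  torus_int (fun x => f x - g x) = torus_int f - torus_int g.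
Proof. exact: RintegralB. Qed.

Lemma torus_intZ c f : torus_integrable f ->
  torus_int (fun x => c * f x) = c * torus_int f.
Proof. exact: RintegralZl. Qed.

Lemma torus_integrableD f g : torus_integrable f -> torus_integrable g ->
  torus_integrable (fun x => f x + g x).
Proof. by move=> hf hg; exact: (@integrableD _ _ R mu I (measurable_itv _) (EFin \o f) (EFin \o g)). Qed.

Lemma torus_integrableB f g : torus_integrable f -> torus_integrable g ->
  torus_integrable (fun x => f x - g x).
Proof. by move=> hf hg; exact: (@integrableB _ _ R mu I (measurable_itv _) (EFin \o f) (EFin \o g)). Qed.

Lemma torus_integrableZ c f : torus_integrable f -> torus_integrable (fun x => c * f x).
Proof. by move=> hf; exact: (@integrableZl _ _ R mu I (measurable_itv _) c (EFin \o f)). Qed.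

Lemma torus_integrableN f : torus_integrable f -> torus_integrable (fun x => - f x).
Proof. by move/(torus_integrableZ (-1)); under eq_fun do rewrite mulN1r. Qed.

Lemma torus_intN f : torus_integrable f -> torus_int (fun x => - f x) = - torus_int f.
Proof.
by move=> hf; rewrite -mulN1r -torus_intZ//; under eq_fun do rewrite -mulN1r.
Qed.

Lemma torus_integrableM f g : torus_integrable f -> continuous g ->
  (forall x, `|g x| <= 1) -> torus_integrable (fun x => f x * g x).
Proof.
move=> hf cg g1.
have := @integrableMl _ _ _ mu _ mI (EFin \o f) g hf _ _; apply.
  apply: measurable_funTS; exact: continuous_measurable_fun.
exists 1; split => // M M1 x _ /=; exact: le_trans (g1 x) (ltW M1).
Qed.

Lemma torus_int_cst c : torus_int (fun=> c : R) = 2 * pi * c.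
Proof.
rewrite /torus_int Rintegral_cst//= lebesgue_measure_itv/= lte_fin twopi_gt0/=.
by rewrite subr0 mulrC.
Qed.

Lemma torus_int_le f g : torus_integrable f -> torus_integrable g ->
  (forall x, f x <= g x) -> torus_int f <= torus_int g.
Proof. by move=> hf hg fg; apply: le_Rintegral. Qed.

Lemma cst_torus_integrable c : torus_integrable (fun=> c).
Proof. by apply: continuous_torus_integrable => x; exact: cvg_cst. Qed.

Lemma torus_int_norm_le f e : torus_integrable f -> (forall x, `|f x| <= e) ->
  `|torus_int f| <= 2 * pi * e.
Proof.
move=> hf fe; rewrite -torus_int_cst ler_norml -torus_intN; last exact: cst_torus_integrable.
apply/andP; split; apply: torus_int_le => //; rewrite -?torus_intN.
- exact: cst_torus_integrable.
- by move=> x; have := fe x; rewrite ler_norml => /andP[].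
- exact: cst_torus_integrable.
- by move=> x; have := fe x; rewrite ler_norml => /andP[].
Qed.

Lemma continuous_cosk (c : R) : continuous (fun x => cos (c * x)).
Proof.
move=> x; apply: continuous_comp; last exact: continuous_cos.
by apply: cvgM; [exact: cvg_cst|exact: cvg_id].
Qed.

Lemma continuous_sink (c : R) : continuous (fun x => sin (c * x)).
Proof.
move=> x; apply: continuous_comp; last exact: continuous_sin.
by apply: cvgM; [exact: cvg_cst|exact: cvg_id].
Qed.

Lemma is_derive_cosk (c x : R) : is_derive x 1 (fun x => cos (c * x)) (- (c * sin (c * x))).
Proof.
have h : is_derive x 1 ( *%R c) c by apply: is_derive_eq; rewrite scaler1.
by have := @is_derive1_comp _ (@cos R) ( *%R c) x _ _ (is_derive_cos _) h; rewrite mulNr mulrC.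
Qed.

Lemma is_derive_sink (c x : R) : is_derive x 1 (fun x => sin (c * x)) (c * cos (c * x)).
Proof.
have h : is_derive x 1 ( *%R c) c by apply: is_derive_eq; rewrite scaler1.
by have := @is_derive1_comp _ (@sin R) ( *%R c) x _ _ (is_derive_sin _) h; rewrite mulrC.
Qed.

Lemma is_derive_cmul (c x : R) f df : is_derive x 1 f df ->
  is_derive x 1 (fun x => c * f x) (c * df).
Proof. by move=> h; exact: (@is_deriveZ _ _ _ f c x 1 df h). Qed.

Lemma torus_int_FTC (F f : R -> R) : continuous f -> (forall x : R, is_derive x 1 F (f x)) ->
  torus_int f = F (2 * pi) - F 0.
Proof.
move=> cf dF; have cF : continuous F.
  move=> x; apply/differentiable_continuous/derivable1_diffP.
  by have := dF x => -[].
rewrite /torus_int /Rintegral (@continuous_FTC2 _ f F _ _ twopi_gt0)//.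
- exact: continuous_subspaceT.
- split => [x _||].
  + by have := dF x => -[].
  + exact/cvg_at_right_filter/cF.
  + exact/cvg_at_left_filter/cF.
- by move=> x _; rewrite derive1E; have := dF x => -[].
Qed.

Lemma cos_2pi (k : int) : cos (k%:~R * (2 * pi) : R) = 1.
Proof.
have P (n : nat) : cos (n%:~R * (2 * pi) : R) = 1.
  have := periodicn (@cosD2pi R) n 0; rewrite add0r cos0 => h; rewrite -[RHS]h.
  by congr cos; rewrite -[_ *+ n]mulr_natl -[pi *+ 2]mulr_natl -pmulrn.
by case: (intP k) => [|n|n]; rewrite ?P// rmorphN/= mulNr cosN P.
Qed.

Lemma sin_2pi (k : int) : sin (k%:~R * (2 * pi) : R) = 0.
Proof.
have P (n : nat) : sin (n%:~R * (2 * pi) : R) = 0.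
  have := periodicn (@sinD2pi R) n 0; rewrite add0r sin0 => h; rewrite -[RHS]h.
  by congr sin; rewrite -[_ *+ n]mulr_natl -[pi *+ 2]mulr_natl -pmulrn.
by case: (intP k) => [|n|n]; rewrite ?P// rmorphN/= mulNr sinN P oppr0.
Qed.

Lemma torus_int_cos (k : int) : k != 0 -> torus_int (fun x => cos (k%:~R * x) : R) = 0.
Proof.
move=> k0; have k0' : k%:~R != 0 :> R by rewrite intr_eq0.
have dF (x : R) : is_derive x 1 (fun x => k%:~R^-1 * sin (k%:~R * x)) (cos (k%:~R * x)).
  have h := is_derive_sink k%:~R x.
  by have := is_derive_cmul k%:~R^-1 h; rewrite mulrA mulVf// mul1r.
have -> := torus_int_FTC (@continuous_cosk _) dF.
by rewrite sin_2pi !mulr0 sin0 mulr0 subrr.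
Qed.

Lemma torus_int_sin (k : int) : torus_int (fun x => sin (k%:~R * x) : R) = 0.
Proof.
have [->|k0] := eqVneq k 0.
  by under eq_fun do rewrite mul0r sin0; rewrite torus_int_cst mulr0.
have k0' : k%:~R != 0 :> R by rewrite intr_eq0.
have dF (x : R) : is_derive x 1 (fun x => - k%:~R^-1 * cos (k%:~R * x)) (sin (k%:~R * x)).
  have h := is_derive_cosk k%:~R x.
  by have := is_derive_cmul (- k%:~R^-1) h; rewrite mulrN mulNr opprK mulrA mulVf// mul1r.
have -> := torus_int_FTC (@continuous_sink _) dF.
by rewrite cos_2pi mulr0 cos0 subrr.
Qed.

Implicit Types G : R -> C.

Definition cintegrable G := torus_integrable (fun x => Re (G x)) /\
  torus_integrable (fun x => Im (G x)).

(** By conversion [fourier f k] is the [cmean] of f times a character, so the coefficients inherit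
    the linearity of the mean. *)
Definition cmean G : C := ((2 * pi)^-1)%:C%C * torus_cint G.

Lemma cintegrableD G1 G2 : cintegrable G1 -> cintegrable G2 ->
  cintegrable (fun x => G1 x + G2 x).
Proof.
move=> [h1 h2] [h3 h4]; split.
  by under eq_fun do rewrite ReD; exact: torus_integrableD.
by under eq_fun do rewrite ImD; exact: torus_integrableD.
Qed.

Lemma cmeanD G1 G2 : cintegrable G1 -> cintegrable G2 ->
  cmean (fun x => G1 x + G2 x) = cmean G1 + cmean G2.
Proof.
move=> [h1 h2] [h3 h4]; rewrite /cmean -mulrDr; congr (_ * _); rewrite /torus_cint.
under eq_fun do rewrite ReD.
under [in X in Complex _ X]eq_fun do rewrite ImD.
by rewrite !torus_intD.
Qed.

Lemma cintegrableZ c G : cintegrable G -> cintegrable (fun x => c * G x).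
Proof.
move=> [h1 h2]; split.
  by under eq_fun do rewrite ReM; apply: torus_integrableB; exact: torus_integrableZ.
by under eq_fun do rewrite ImM; apply: torus_integrableD; exact: torus_integrableZ.
Qed.

Lemma cmeanZ c G : cintegrable G -> cmean (fun x => c * G x) = c * cmean G.
Proof.
move=> [h1 h2]; rewrite /cmean mulrCA; congr (_ * _); rewrite /torus_cint.
under eq_fun do rewrite ReM.
under [in X in Complex _ X]eq_fun do rewrite ImM.
rewrite torus_intB ?torus_intD ?torus_intZ//; try exact: torus_integrableZ.
by case: c.
Qed.

Lemma cmeanB G1 G2 : cintegrable G1 -> cintegrable G2 ->
  cmean (fun x => G1 x - G2 x) = cmean G1 - cmean G2.
Proof.
move=> h1 h2; have h3 := cintegrableZ (-1) h2.
rewrite -[cmean G1 - cmean G2](_ : cmean G1 + cmean (fun x => -1 * G2 x) = _).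
  by rewrite -cmeanD//; under [in RHS]eq_fun do rewrite mulN1r.
by rewrite cmeanZ// mulN1r.
Qed.

Lemma nc_cmean_le G e : cintegrable G -> (forall x, nc (G x) <= e) -> nc (cmean G) <= 2 * e.
Proof.
move=> [h1 h2] Ge; rewrite /cmean ncM nc_real ger0_norm ?invr_ge0 ?(ltW twopi_gt0)//.
rewrite mulrC ler_pdivrMr ?twopi_gt0//; apply: le_trans (nc_le _) _ => /=.
have := torus_int_norm_le h1 (fun x => le_trans (Re_le_nc _) (Ge x)).
have := torus_int_norm_le h2 (fun x => le_trans (Im_le_nc _) (Ge x)).
lra.
Qed.

(** Trigonometric polynomials as lists of pairs (coefficient, frequency). Frequencies may repeat, so
    a product needs no collecting of terms. *)
Definition trig (r : seq (C * int)) x : C := \sum_(u <- r) u.1 * expi (u.2%:~R * x).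

Lemma expiD (x y : R) : expi (x + y) = expi x * expi y.
Proof. by rewrite /expi cosD sinD; simpc; congr Complex; ring. Qed.

Lemma nc_expi (x : R) : nc (expi x) = 1.
Proof.
apply: (@pexpIrn _ 2) => //; rewrite ?nnegrE ?nc_ge0//.
by rewrite nc_sq/= cos2Dsin2 expr1n.
Qed.

Lemma expiJ (x : R) : (expi x)^*%C = expi (- x).
Proof. by rewrite /expi cosN sinN. Qed.

Lemma cintegrable_expi (k : int) : cintegrable (fun x => expi (k%:~R * x)).
Proof.
by split; apply: continuous_torus_integrable; [exact: continuous_cosk|exact: continuous_sink].
Qed.

Lemma cmean_expi (k : int) : cmean (fun x => expi (k%:~R * x)) = if k == 0 then 1 else 0.
Proof.
rewrite /cmean /torus_cint /= torus_int_sin; case: eqVneq => [->|k0].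
  under eq_fun do rewrite mul0r cos0.
  rewrite torus_int_cst mulr1; simpc.
  by rewrite mulVf ?gt_eqF ?twopi_gt0//.
by rewrite torus_int_cos// mulr0.
Qed.

Lemma trig_cons u r x : trig (u :: r) x = u.1 * expi (u.2%:~R * x) + trig r x.
Proof. by rewrite /trig big_cons. Qed.

Lemma cintegrable_trig r : cintegrable (trig r).
Proof.
elim: r => [|u r ih].
  by split; rewrite /trig; under eq_fun do rewrite big_nil; exact: cst_torus_integrable.
rewrite /cintegrable; under eq_fun do rewrite trig_cons.
under [in X in _ /\ X]eq_fun do rewrite trig_cons.
by apply: cintegrableD => //; apply: cintegrableZ; exact: cintegrable_expi.
Qed.

Lemma cmean_trig r : cmean (trig r) = \sum_(u <- r | u.2 == 0) u.1.
Proof.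
elim: r => [|u r ih].
  rewrite big_nil /cmean /torus_cint /trig.
  under eq_fun do rewrite big_nil; under [in X in Complex _ X]eq_fun do rewrite big_nil.
  by rewrite /= torus_int_cst mulr0 mulr0.
rewrite big_cons -ih; have -> : trig (u :: r) = (fun x => u.1 * expi (u.2%:~R * x) + trig r x).
  by apply/funext => x; rewrite trig_cons.
rewrite cmeanD; [|apply: cintegrableZ; exact: cintegrable_expi|exact: cintegrable_trig].
rewrite cmeanZ; last exact: cintegrable_expi.
by rewrite cmean_expi; case: ifP => _; rewrite ?mulr1// mulr0 add0r.
Qed.

Lemma trig_shift r (k : int) x : trig r x * expi (- (k%:~R * x)) =
  trig [seq (u.1, u.2 - k) | u <- r] x.
Proof.
rewrite /trig big_map mulr_suml; apply: eq_bigr => u _ /=.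
by rewrite rmorphB/= mulrBl expiD mulrA.
Qed.

Lemma cintegrable_fourier f k : torus_integrable f ->
  cintegrable (fun x => (f x)%:C%C * expi (- (k%:~R * x))).
Proof.
move=> hf; split.
  under eq_fun do rewrite ReM /= mul0r subr0 cosN.
  by apply: torus_integrableM => // [|x]; [exact: continuous_cosk|exact: cos_max].
under eq_fun do rewrite ImM /= mul0r addr0 sinN mulrN.
apply: torus_integrableN.
by apply: torus_integrableM => // [|x]; [exact: continuous_sink|exact: sin_max].
Qed.

Lemma fourierD f g k : torus_integrable f -> torus_integrable g ->
  fourier (fun x => f x + g x) k = fourier f k + fourier g k.
Proof.
move=> hf hg; rewrite -[RHS]cmeanD; try exact: cintegrable_fourier.
by congr cmean; apply/funext => x; rewrite rmorphD mulrDl.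
Qed.

Lemma fourierZ c f k : torus_integrable f ->
  fourier (fun x => c * f x) k = c%:C%C * fourier f k.
Proof.
move=> hf; rewrite -[RHS]cmeanZ; last exact: cintegrable_fourier.
by congr cmean; apply/funext => x; rewrite rmorphM mulrA.
Qed.

Lemma fourierB f g k : torus_integrable f -> torus_integrable g ->
  fourier (fun x => f x - g x) k = fourier f k - fourier g k.
Proof.
move=> hf hg; rewrite -[RHS]cmeanB; try exact: cintegrable_fourier.
by congr cmean; apply/funext => x; rewrite rmorphB mulrBl.
Qed.

Lemma fourierE f k : torus_integrable f -> fourier f k =
  ((2 * pi)^-1)%:C%C * Complex (torus_int (fun x => f x * cos (k%:~R * x)))
    (- torus_int (fun x => f x * sin (k%:~R * x))).
Proof.
move=> hf; rewrite /fourier /torus_cint; congr (_ * Complex _ _).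
  by congr torus_int; apply/funext => x; rewrite ReM/= mul0r subr0 cosN.
rewrite -torus_intN.
  by congr torus_int; apply/funext => x; rewrite ImM/= mul0r addr0 sinN mulrN.
by apply: torus_integrableM => // [|x]; [exact: continuous_sink|exact: sin_max].
Qed.

Lemma fourierN_conj f k : torus_integrable f -> fourier f (- k) = (fourier f k)^*%C.
Proof.
move=> hf; rewrite !fourierE//.
have -> : torus_int (fun x => f x * cos ((- k)%:~R * x)) = torus_int (fun x => f x * cos (k%:~R * x)).
  by congr torus_int; apply/funext => x; rewrite rmorphN/= mulNr cosN.
have -> : torus_int (fun x => f x * sin ((- k)%:~R * x)) = - torus_int (fun x => f x * sin (k%:~R * x)).
  rewrite -torus_intN.
    by congr torus_int; apply/funext => x; rewrite rmorphN/= mulNr sinN mulrN.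
  by apply: torus_integrableM => // [|x]; [exact: continuous_sink|exact: sin_max].
by simpc; congr Complex; ring.
Qed.

(** Coefficients are continuous for the uniform norm. This identifies the coefficients both of a
    uniformly convergent series and of a product. *)
Lemma fourier_approx f r k e : torus_integrable f ->
  (forall x, nc ((f x)%:C%C - trig r x) <= e) ->
  nc (fourier f k - \sum_(u <- r | u.2 == k) u.1) <= 2 * e.
Proof.
move=> hf h.
have -> : \sum_(u <- r | u.2 == k) u.1 = cmean (fun x => trig r x * expi (- (k%:~R * x))).
  transitivity (cmean (trig [seq (u.1, u.2 - k) | u <- r])).
    by rewrite cmean_trig big_map/=; apply: eq_bigl => u; rewrite subr_eq0.
  by congr cmean; apply/funext => x; rewrite trig_shift.
have h1 := cintegrable_fourier k hf.
have h2 : cintegrable (fun x => trig r x * expi (- (k%:~R * x))).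
  rewrite /cintegrable; under eq_fun do rewrite trig_shift.
  under [in X in _ /\ X]eq_fun do rewrite trig_shift.
  exact: cintegrable_trig.
rewrite -[fourier f k]/(cmean _) -cmeanB//; apply: nc_cmean_le => [|x].
  have := cintegrableD h1 (cintegrableZ (-1) h2).
  rewrite /cintegrable; under eq_fun do rewrite mulN1r.
  by under [in X in _ /\ X]eq_fun do rewrite mulN1r.
by rewrite -mulrBl ncM nc_expi mulr1.
Qed.

End TorusIntegral.

Section FourierSeries.
Variable R : realType.
Local Notation C := R[i].
Local Notation Re := complex.Re.
Local Notation Im := complex.Im.
Implicit Types (f g : R -> R) (c d : int -> C).

Definition partial_sum c N x : C := \sum_(k <- box N) c k * expi (k%:~R * x).

Definition hermitian c := forall k, c (- k) = (c k)^*%C.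

(** The Wiener algebra, with the coefficients as a parameter: Hilbert transform, derivative and
    product become operations on [c]. *)
Record fourier_series f c : Prop := {
  fser_abs : exists B, bdsum (fun k => nc (c k)) B ;
  fser_lim : forall e, 0 < e -> exists N0, forall N, (N0 <= N)%N -> forall x,
    nc ((f x)%:C%C - partial_sum c N x) <= e }.

Lemma partial_sum_trig c N x :
  partial_sum c N x = trig [seq (c k, k) | k <- box N] x.
Proof. by rewrite /trig big_map. Qed.

Lemma partial_sumB_le c N M x : (N <= M)%N ->
  nc (partial_sum c M x - partial_sum c N x) <=
  \sum_(k <- [seq k <- box M | k \notin box N]) nc (c k).
Proof.
move=> NM.
have -> : partial_sum c M x - partial_sum c N x =
  \sum_(k <- [seq k <- box M | k \notin box N]) c k * expi (k%:~R * x).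
  rewrite /partial_sum (bigID (fun k => k \in box N)) big_filter.
  rewrite -[X in X + _ - _]big_filter (perm_big (box N)); first by rewrite addrAC subrr add0r.
  apply: uniq_perm; rewrite ?filter_uniq ?box_uniq// => k.
  by rewrite mem_filter !mem_box; lia.
apply: le_trans (nc_sum _ _ _) _; apply: ler_sum => k _.
by rewrite ncM nc_expi mulr1.
Qed.

Lemma summable_tail c B e : bdsum (fun k => nc (c k)) B -> 0 < e ->
  exists N0, forall N M, (N0 <= N)%N -> (N <= M)%N ->
  \sum_(k <- [seq k <- box M | k \notin box N]) nc (c k) <= e.
Proof.
move=> hB e0; have [N0 h] := bdsum_tail (fun k => nc_ge0 (c k)) hB e0.
exists N0 => N M N0N NM; apply: h; first by rewrite filter_uniq ?box_uniq.
by move=> k; rewrite mem_filter !mem_box => /andP[]; lia.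
Qed.

Lemma partial_sum_real c N x : hermitian c -> Im (partial_sum c N x) = 0.
Proof.
move=> hc; suff h : partial_sum c N x = (partial_sum c N x)^*%C.
  have : Im (partial_sum c N x) = - Im (partial_sum c N x).
    by rewrite {1}h; case: (partial_sum c N x).
  by move=> /eqP; rewrite -addr_eq0 -mulr2n mulrn_eq0 => /eqP.
rewrite [in RHS]/partial_sum rmorph_sum /partial_sum.
have -> : \sum_(k <- box N) c k * expi (k%:~R * x) =
  \sum_(k <- [seq - k | k <- box N]) c k * expi (k%:~R * x).
  have uN : uniq [seq - k | k <- box N] by rewrite map_inj_uniq ?box_uniq// => a b; lia.
  apply: perm_big; apply: (uniq_perm (box_uniq N) uN).
  move=> k; rewrite mem_box; apply/idP/mapP => [kN|[j]].
    by exists (- k); rewrite ?opprK// mem_box abszN.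
  by rewrite mem_box => jN ->; rewrite abszN.
rewrite big_map; apply: eq_bigr => k _.
have -> : expi ((- k)%:~R * x) = (expi (k%:~R * x))^*%C.
  by rewrite expiJ rmorphN/= mulNr.
by rewrite hc -rmorphM.
Qed.

(** Hermitian symmetry makes the partial sums real, so nothing is lost by taking real parts; the
    tails of the sum of nc (c k) bound their increments uniformly in x. *)
Lemma fourier_series_sum c B : hermitian c -> bdsum (fun k => nc (c k)) B ->
  fourier_series (fun x => lim ((fun N => Re (partial_sum c N x)) @ \oo)) c.
Proof.
move=> hc hB; split; first by exists B.
have cauchy e : 0 < e -> exists N0, forall N M, (N0 <= N)%N -> (N0 <= M)%N -> forall x,
    `|Re (partial_sum c N x) - Re (partial_sum c M x)| <= e.
  move=> e0; have [N0 h] := summable_tail hB e0.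
  exists N0 => N M; wlog NM : N M / (N <= M)%N => [H NN0 MN0 x|].
    have [/H|/ltnW/H] := leqP N M; first exact.
    by rewrite distrC; exact.
  move=> NN0 MN0 x; rewrite distrC -ReN -ReD.
  by apply: le_trans (Re_le_nc _) (le_trans (partial_sumB_le _ _ NM) (h _ _ NN0 NM)).
have cv x : cvg ((fun N => Re (partial_sum c N x)) @ \oo).
  apply/cauchy_cvgP/cauchy_exP => e e0.
  have e2 : 0 < e / 2 by rewrite divr_gt0.
  have [N0 h] := cauchy _ e2.
  exists (Re (partial_sum c N0 x)); exists N0 => // n /= Nn; rewrite /ball/=.
  by apply: le_lt_trans (h _ _ (leqnn _) Nn x) _; lra.
move=> e e0; have [N0 h] := cauchy _ e0; exists N0 => N NN0 x.
have -> : (lim ((fun N => Re (partial_sum c N x)) @ \oo))%:C%C - partial_sum c N x =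
  (lim ((fun N => Re (partial_sum c N x)) @ \oo) - Re (partial_sum c N x))%:C%C.
  have := partial_sum_real N x hc; case: (partial_sum c N x) => u v /= ->.
  by simpc.
rewrite nc_real.
have : `|Re (partial_sum c n x) - Re (partial_sum c N x)| @[n --> \oo] -->
  `|lim ((fun N => Re (partial_sum c N x)) @ \oo) - Re (partial_sum c N x)|.
  by apply: cvg_norm; apply: cvgB; [exact: cv|exact: cvg_cst].
move=> /cvgr_to_le; apply; exists N0 => // n /= Nn; exact: h.
Qed.

Lemma continuous_partial_sum c N : continuous (fun x => Re (partial_sum c N x)).
Proof.
move=> x; rewrite /partial_sum; under eq_fun do rewrite Re_sum.
elim: (box N) => [|k r ih].
  by rewrite big_nil; under eq_fun do rewrite big_nil; exact: cvg_cst.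
have -> : (fun y => \sum_(i <- k :: r) Re (c i * expi (i%:~R * y))) =
  (fun y => (Re (c k) * cos (k%:~R * y) - Im (c k) * sin (k%:~R * y))
    + \sum_(i <- r) Re (c i * expi (i%:~R * y))).
  by apply/funext => y; rewrite big_cons ReM.
rewrite big_cons ReM; apply: cvgD => //.
apply: cvgB; apply: cvgM; [exact: cvg_cst|exact: continuous_cosk|exact: cvg_cst|].
exact: continuous_sink.
Qed.

Lemma fourier_series_re f c : fourier_series f c -> forall e, 0 < e ->
  exists N0, forall N, (N0 <= N)%N -> forall x, `|f x - Re (partial_sum c N x)| <= e.
Proof.
move=> [_ h] e /h [N0 hN0]; exists N0 => N /hN0 {}h x.
by apply: le_trans (h x); rewrite -[f x]/(Re (f x)%:C%C) -ReN -ReD; exact: Re_le_nc.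
Qed.

Lemma fourier_series_continuous f c : fourier_series f c -> continuous f.
Proof.
move=> /fourier_series_re h x; apply/cvgrPdist_le => e e0.
have e3 : 0 < e / 3 by rewrite divr_gt0.
have [N /(_ N (leqnn _)) hN] := h _ e3.
have := @continuous_partial_sum c N x; move/cvgrPdist_le => /(_ _ e3); apply: filterS => y hy.
have h1 := hN x; have h2 := hN y.
have -> : f x - f y = (f x - Re (partial_sum c N x)) + (Re (partial_sum c N x) - Re (partial_sum c N y))
   - (f y - Re (partial_sum c N y)) by ring.
apply: le_trans (ler_normB _ _) _; apply: le_trans (lerD (ler_normD _ _) (lexx _)) _.
lra.
Qed.

Lemma fourier_series_integrable f c : fourier_series f c -> torus_integrable f.
Proof. by move/fourier_series_continuous/continuous_torus_integrable. Qed.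

Lemma fourier_series_bound f c B : fourier_series f c -> bdsum (fun k => nc (c k)) B ->
  forall x, `|f x| <= B.
Proof.
move=> [_ h] hB x; apply/ler_addgt0Pr => e e0.
have [N /(_ N (leqnn _) x) hN] := h _ e0.
rewrite -nc_real -[(f x)%:C%C](subrK (partial_sum c N x)) addrC [leRHS]addrC.
rewrite [X in nc X]addrC; apply: le_trans (ncD _ _) _; apply: lerD => //.
apply: le_trans (nc_sum _ _ _) _; apply: le_trans (hB _ (box_uniq N)).
by apply: ler_sum => k _; rewrite ncM nc_expi mulr1.
Qed.

Lemma big_box_delta (V : nmodType) N (F : int -> V) k : k \in box N ->
  \sum_(j <- box N | j == k) F j = F k.
Proof. by move=> kN; rewrite big_mkcond (bigD1_seq k) ?box_uniq//= eqxx big1 ?addr0// => j /negPf ->. Qed.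

Lemma fourier_of_series f c : fourier_series f c -> forall k, fourier f k = c k.
Proof.
move=> fc k; have hf := fourier_series_integrable fc.
apply/eqP; rewrite -subr_eq0; apply/eqP/nc_eq0 => e e0.
have e2 : 0 < e / 2 by rewrite divr_gt0.
have [N0 h] := fser_lim fc e2.
pose N := maxn N0 `|k|%N.
have h1 x : nc ((f x)%:C%C - trig [seq (c k, k) | k <- box N] x) <= e / 2.
  by rewrite -partial_sum_trig; apply: h; exact: leq_maxl.
have := fourier_approx k hf h1; rewrite big_map /= big_box_delta ?mem_box ?leq_maxr//.
by move=> /le_trans; apply; lra.
Qed.

Lemma fourier_series_herm f c : fourier_series f c -> hermitian c.
Proof.
move=> fc k; rewrite -!(fourier_of_series fc); apply: fourierN_conj.
exact: fourier_series_integrable fc.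
Qed.

Lemma partial_sumM c d N x : partial_sum c N x * partial_sum d N x =
  trig [seq (c j * d l, j + l) | j <- box N, l <- box N] x.
Proof.
rewrite /partial_sum /trig big_allpairs_dep/= mulr_suml; apply: eq_bigr => j _.
rewrite mulr_sumr; apply: eq_bigr => l _.
by rewrite rmorphD/= mulrDl expiD mulrACA.
Qed.

(** The product of the two partial sums of rank L is uniformly close to f g, and its coefficients
    are exactly the convolution truncated to box L times box L. *)
Lemma fourier_mul f g c d : fourier_series f c -> fourier_series g d ->
  forall k e, 0 < e -> exists L0, forall L, (L0 <= L)%N ->
  nc (fourier (fun x => f x * g x) k - \sum_(j <- box L) \sum_(l <- box L)
    (if j + l == k then c j * d l else 0)) <= e.
Proof.
move=> fc gd k e e0.
have [B hB] := fser_abs fc; have [B' hB'] := fser_abs gd.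
have B0 := bdsum_ge0 hB; have B'0 := bdsum_ge0 hB'.
(* The uniform error is at most (B + B') e' <= e / 2, and [fourier_approx] doubles it. *)
pose e' := e / (2 * (B + B' + 1)).
have e'0 : 0 < e' by rewrite divr_gt0// mulr_gt0// ltr_wpDl// addr_ge0.
have [N1 h1] := fser_lim fc e'0; have [N2 h2] := fser_lim gd e'0.
exists (maxn N1 N2) => L; rewrite geq_max => /andP[L1 L2].
have hfg : torus_integrable (fun x => f x * g x).
  apply: continuous_torus_integrable => x; apply: cvgM.
    exact: fourier_series_continuous fc _.
  exact: fourier_series_continuous gd _.
have h x : nc ((f x * g x)%:C%C - trig [seq (c j * d l, j + l) | j <- box L, l <- box L] x)
    <= e / 2.
  rewrite -partial_sumM rmorphM/=.
  rewrite (_ : _ - _ = (f x)%:C%C * ((g x)%:C%C - partial_sum d L x)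
    + ((f x)%:C%C - partial_sum c L x) * partial_sum d L x); last by ring.
  apply: le_trans (ncD _ _) _; rewrite !ncM nc_real.
  have pd : nc (partial_sum d L x) <= B'.
    apply: le_trans (nc_sum _ _ _) _; apply: le_trans (hB' _ (box_uniq L)).
    by apply: ler_sum => i _; rewrite ncM nc_expi mulr1.
  apply: (@le_trans _ _ (B * e' + e' * B')).
    by apply: lerD; apply: ler_pM; rewrite ?nc_ge0// ?h1 ?h2// (fourier_series_bound fc).
  rewrite -subr_ge0 (_ : _ - _ = e'); first exact: ltW.
  by rewrite /e'; field; rewrite gt_eqF// ltr_wpDl// addr_ge0.
have := fourier_approx k hfg h; rewrite big_mkcond big_allpairs_dep/=.
by move=> /le_trans; apply; lra.
Qed.

Lemma nc_expiB_le (x y : R) : nc (expi x - expi y) <= 2 * `|x - y|.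
Proof.
wlog xy : x y / x <= y => [H|].
  by have [/H//|/ltW/H] := leP x y; rewrite ncBC distrC.
have cF (F : R -> R) : (forall x : R, derivable F x 1) -> {within `[x, y], continuous F}.
  move=> dF; apply: continuous_subspaceT => u.
  exact/differentiable_continuous/derivable1_diffP.
have [u _ hu] := MVT_segment xy (fun u _ => is_derive_cos u) (cF _ (@derivable_cos R)).
have [v _ hv] := MVT_segment xy (fun u _ => is_derive_sin u) (cF _ (@derivable_sin R)).
rewrite ncBC distrC; apply: le_trans (nc_le _) _; rewrite ReD ImD ReN ImN /= hu hv !normrM normrN.
have := ler_wpM2r (normr_ge0 (y - x)) (cos_max v); have := ler_wpM2r (normr_ge0 (y - x)) (sin_max u).
lra.
Qed.

Lemma is_derive_partial_sum c N (x : R) :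
  is_derive x 1 (fun x => Re (partial_sum c N x))
    (Re (partial_sum (fun k => 'i%C * (k%:~R)%:C%C * c k) N x)).
Proof.
rewrite /partial_sum; under eq_fun do rewrite Re_sum.
rewrite Re_sum; elim: (box N) => [|k r ih].
  by rewrite big_nil; under eq_fun do rewrite big_nil; exact: is_derive_cst.
rewrite big_cons; under eq_fun do rewrite big_cons; apply: is_deriveD => //.
under eq_fun do rewrite ReM /=.
have h1 := is_derive_cmul (Re (c k)) (is_derive_cosk k%:~R x).
have h2 := is_derive_cmul (Im (c k)) (is_derive_sink k%:~R x).
apply: is_derive_eq (is_deriveB h1 h2) _.
by case: (c k) => a b /=; ring.
Qed.

(** The remainder of the series is Lipschitz with constant 2 D, so its difference quotients are
    small uniformly in h; this justifies termwise differentiation. *)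
Lemma fourier_series_diff_le f c N D (x h : R) : fourier_series f c ->
  (forall M, (N <= M)%N ->
    \sum_(k <- [seq k <- box M | k \notin box N]) ak R k * nc (c k) <= D) ->
  `|f (x + h) - f x - (Re (partial_sum c N (x + h)) - Re (partial_sum c N x))|
  <= 2 * D * `|h|.
Proof.
move=> fc hD; apply/ler_addgt0Pr => e e0.
have e2 : 0 < e / 2 by rewrite divr_gt0.
have [N0 hN0] := fourier_series_re fc e2.
pose M := maxn N N0; have h0 := hN0 M (leq_maxr _ _).
have NM : (N <= M)%N := leq_maxl _ _.
have key : `|Re (partial_sum c M (x + h)) - Re (partial_sum c M x)
   - (Re (partial_sum c N (x + h)) - Re (partial_sum c N x))| <= 2 * D * `|h|.
  have -> : Re (partial_sum c M (x + h)) - Re (partial_sum c M x)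
    - (Re (partial_sum c N (x + h)) - Re (partial_sum c N x)) = Re (partial_sum c M (x + h)
      - partial_sum c M x - (partial_sum c N (x + h) - partial_sum c N x)).
    by rewrite !(ReD, ReN).
  apply: le_trans (Re_le_nc _) _.
  have -> : partial_sum c M (x + h) - partial_sum c M x - (partial_sum c N (x + h) - partial_sum c N x)
    = \sum_(k <- [seq k <- box M | k \notin box N]) c k * (expi (k%:~R * (x + h)) - expi (k%:~R * x)).
    rewrite -!sumrB; under [X in X - _]eq_bigr do rewrite -mulrBr.
    under [X in _ - X]eq_bigr do rewrite -mulrBr.
    rewrite (bigID (fun k => k \in box N)) big_filter.
    rewrite -[X in X + _ - _]big_filter (perm_big (box N)); first by rewrite addrAC subrr add0r.
    apply: uniq_perm; rewrite ?filter_uniq ?box_uniq// => k.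
    by rewrite mem_filter !mem_box; lia.
  apply: le_trans (nc_sum _ _ _) _.
  apply: (@le_trans _ _ (2 * (\sum_(k <- [seq k <- box M | k \notin box N]) ak R k * nc (c k)) * `|h|)).
    rewrite mulr_sumr mulr_suml; apply: ler_sum => k _; rewrite ncM.
    have := nc_expiB_le (k%:~R * (x + h)) (k%:~R * x).
    rewrite -mulrBr addrAC subrr add0r normrM -/(ak R k) => /(ler_wpM2l (nc_ge0 (c k))).
    by move=> /le_trans; apply; rewrite le_eqVlt; apply/orP; left; apply/eqP; ring.
  by rewrite ler_wpM2r// ler_wpM2l// hD.
have h1 := h0 (x + h); have h2 := h0 x.
rewrite (_ : _ - _ = (Re (partial_sum c M (x + h)) - Re (partial_sum c M x)
   - (Re (partial_sum c N (x + h)) - Re (partial_sum c N x)))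
   + (f (x + h) - Re (partial_sum c M (x + h))) - (f x - Re (partial_sum c M x))); last by ring.
apply: le_trans (ler_normB _ _) _; apply: le_trans (lerD (ler_normD _ _) (lexx _)) _.
lra.
Qed.

Lemma fourier_series_derive f c B : fourier_series f c ->
  bdsum (fun k => ak R k * nc (c k)) B ->
  (forall x : R, derivable f x 1) /\
  fourier_series (derive1 f) (fun k => 'i%C * (k%:~R)%:C%C * c k).
Proof.
move=> fc hB; have hc := fourier_series_herm fc.
pose c' k : C := 'i%C * (k%:~R)%:C%C * c k.
have hc' : hermitian c'.
  move=> k; rewrite /c' hc rmorphN/=; case: (c k) => a b; simpc.
  by congr Complex; ring.
have nc' k : nc (c' k) = ak R k * nc (c k).
  by rewrite /c' !ncM nc_real -/(ak R k) /nc/= expr0n/= expr1n add0r sqrtr1 mul1r.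
have hB' : bdsum (fun k => nc (c' k)) B by apply: bdsum_le hB => k; rewrite nc'.
have gc := fourier_series_sum hc' hB'; set g := (fun x => lim _) in gc.
have dfg (x : R) : is_derive x 1 f (g x).
  suff H : h^-1 *: ((f \o shift x) (h *: 1) - f x) @[h --> 0^'] --> g x.
    apply: DeriveDef; first by apply/cvg_ex; exists (g x).
    exact: cvg_lim H.
  (* One quarter for the tail of the derived series, one for the difference quotient of the partial
     sum, and two for the remainder of f, by [fourier_series_diff_le] with D = e / 4. *)
  apply/cvgrPdist_le => e e0; have e4 : 0 < e / 4 by rewrite divr_gt0.
  have [N1 h1] := summable_tail hB' e4; have [N2 h2] := fourier_series_re gc e4.
  pose N := maxn N1 N2.
  have h3 M : (N <= M)%N -> \sum_(k <- [seq k <- box M | k \notin box N]) ak R k * nc (c k) <= e / 4.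
    move=> NM; apply: le_trans (h1 N M (leq_maxl _ _) NM).
    by rewrite le_eqVlt; apply/orP; left; apply/eqP; apply: eq_bigr => k _; rewrite nc'.
  have h4 := h2 N (leq_maxr _ _) x.
  have [dps eps] := is_derive_partial_sum c N x.
  have : h^-1 *: (((fun x => Re (partial_sum c N x)) \o shift x) (h *: 1) - Re (partial_sum c N x))
     @[h --> 0^'] --> Re (partial_sum c' N x) by rewrite -eps; exact: dps.
  move/cvgrPdist_le => /(_ _ e4).
  have : \forall h \near (0 : R)^', h != 0 by exact: nbhs_dnbhs_neq.
  apply: filterS2 => h hn0 /=; rewrite ![_%:A]mulr1 => h5.
  have h6 := @fourier_series_diff_le f c N (e / 4) x h fc h3.
  rewrite (addrC h x) in h5 *.
  rewrite (_ : _ - _ = (g x - Re (partial_sum c' N x))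
    + (Re (partial_sum c' N x) - h^-1 * (Re (partial_sum c N (x + h)) - Re (partial_sum c N x)))
    - h^-1 * (f (x + h) - f x - (Re (partial_sum c N (x + h)) - Re (partial_sum c N x)))); last first.
    by rewrite -[_ *: _]/(h^-1 * _); ring.
  apply: le_trans (ler_normB _ _) _; apply: le_trans (lerD (ler_normD _ _) (lexx _)) _.
  have h7 : `|h^-1 * (f (x + h) - f x - (Re (partial_sum c N (x + h)) - Re (partial_sum c N x)))| <= 2 * (e / 4).
    rewrite normrM normfV mulrC ler_pdivrMr ?normr_gt0//.
  rewrite -[_ *: _]/(h^-1 * _) in h5; lra.
split; first by move=> x; have [] := dfg x.
suff -> : derive1 f = g by [].
by apply/funext => x; rewrite derive1E; have [] := dfg x.
Qed.



End FourierSeries.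

(** * Uniqueness of Fourier coefficients and Fourier inversion *)

Section Uniqueness.
Variable R : realType.
Local Notation C := R[i].
Local Notation Re := complex.Re.
Local Notation Im := complex.Im.
Local Notation mu := (@lebesgue_measure R).
Local Notation I := (`[0%R, (2 * pi)%R]%classic : set R).
Implicit Types (f h : R -> R).

Lemma fourier_mul_cos f (x0 : R) k : torus_integrable f ->
  fourier (fun x => f x * cos (x - x0)) k =
  (expi (- x0) / 2%:R) * fourier f (k - 1) + (expi x0 / 2%:R) * fourier f (k + 1).
Proof.
move=> hf; have h1 := cintegrable_fourier (k - 1) hf; have h2 := cintegrable_fourier (k + 1) hf.
rewrite -[fourier f (k - 1)]/(cmean _) -[fourier f (k + 1)]/(cmean _).
rewrite -cmeanZ// -[X in _ + X]cmeanZ// -cmeanD; try exact: cintegrableZ.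
congr cmean; apply/funext => x.
have e2 : (2%:R : C) != 0 by rewrite pnatr_eq0.
have hc : (cos (x - x0))%:C%C = (expi (x - x0) + expi (- (x - x0))) / 2%:R :> C.
  apply: (mulIf e2); rewrite divfK// /expi cosN sinN -(rmorph_nat (real_complex R)).
  by simpc; congr Complex; ring.
rewrite rmorphM/= hc expiD.
have e3 : expi (- ((k - 1)%:~R * x)) = expi (- (k%:~R * x)) * expi x.
  by rewrite -expiD; congr expi; rewrite rmorphB/=; ring.
have e4 : expi (- ((k + 1)%:~R * x)) = expi (- (k%:~R * x)) * expi (- x).
  by rewrite -expiD; congr expi; rewrite rmorphD/=; ring.
rewrite e3 e4 opprB (addrC x0) expiD; ring.
Qed.

(** The powers of 1 + cos (x - x0) are trigonometric polynomials peaked at x0. One more factor only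
    mixes neighbouring coefficients, so all of them stay 0. *)
Lemma cos_kernel_orth h (x0 : R) n : continuous h -> (forall k, fourier h k = 0) ->
  torus_int (fun x => h x * (1 + cos (x - x0)) ^+ n) = 0.
Proof.
move=> ch h0.
have cc : continuous (fun x => cos (x - x0)).
  move=> x; apply: (@continuous_comp _ _ _ (fun x => x - x0) (@cos R)); last exact: continuous_cos.
  by apply: cvgB; [exact: cvg_id|exact: cvg_cst].
have cn m : continuous (fun x => h x * (1 + cos (x - x0)) ^+ m).
  elim: m => [|m ih] x.
    by under eq_fun do rewrite expr0 mulr1; exact: ch.
  have -> : (fun x => h x * (1 + cos (x - x0)) ^+ m.+1) =
    (fun x => h x * (1 + cos (x - x0)) ^+ m * (1 + cos (x - x0))).
    by apply/funext => y; rewrite exprSr mulrA.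
  apply: cvgM; first exact: ih.
  by apply: cvgD; [exact: cvg_cst|exact: cc].
have F0 m k : fourier (fun x => h x * (1 + cos (x - x0)) ^+ m) k = 0.
  elim: m k => [|m ih] k.
    by under eq_fun do rewrite expr0 mulr1.
  have iF := continuous_torus_integrable (cn m).
  have iFc : torus_integrable (fun x => h x * (1 + cos (x - x0)) ^+ m * cos (x - x0)).
    by apply: torus_integrableM => // x; exact: cos_max.
  have -> : (fun x => h x * (1 + cos (x - x0)) ^+ m.+1) =
    (fun x => h x * (1 + cos (x - x0)) ^+ m + h x * (1 + cos (x - x0)) ^+ m * cos (x - x0)).
    by apply/funext => x; rewrite exprSr; ring.
  by rewrite fourierD// fourier_mul_cos// !ih !mulr0 !addr0.
have := F0 n 0; rewrite fourierE; last exact/continuous_torus_integrable/cn.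
move=> /eqP; rewrite mulf_eq0 => /orP[/eqP[] /eqP|/eqP[]].
  by rewrite invr_eq0 gt_eqF ?twopi_gt0.
by under eq_fun do rewrite mul0r cos0 mulr1.
Qed.

Lemma exprn_unbounded (q q' K : R) : 0 < q -> q < q' ->
  (forall n, q' ^+ n <= K * q ^+ n) -> False.
Proof.
move=> q0 qq' h; pose d := q' / q - 1.
have d0 : 0 < d by rewrite subr_gt0 ltr_pdivlMr// mul1r.
have B n : 1 + d *+ n <= K.
  have -> : 1 + d *+ n = 1 + n%:R * d by rewrite mulr_natl.
  apply: (@le_trans _ _ ((1 + d) ^+ n)).
    elim: n => [|n ih]; first by rewrite mul0r addr0 expr0.
    rewrite exprSr; apply: (@le_trans _ _ ((1 + n%:R * d) * (1 + d))).
      rewrite -natr1 -subr_ge0 (_ : _ - _ = n%:R * d ^+ 2); last by ring.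
      by rewrite mulr_ge0 ?sqr_ge0.
    by rewrite ler_wpM2r// addr_ge0// ltW.
  by rewrite /d addrCA subrr addr0 expr_div_n ler_pdivrMr ?exprn_gt0.
have [n hn] : exists n : nat, (K - 1) / d < n%:R.
  by exists (Num.truncn ((K - 1) / d)).+1; exact: truncnS_gt.
have := B n; rewrite leNgt => /negP; apply.
by move: hn; rewrite ltr_pdivrMr// mulr_natl ltrBlDl.
Qed.

Lemma cos_le_away (eta u : R) : 0 <= eta -> eta <= pi -> eta <= u -> u <= 2 * pi - eta ->
  cos u <= cos eta.
Proof.
move=> e0 ep eu u2.
have mono (x y : R) : 0 <= x -> x <= y -> y <= pi -> cos y <= cos x.
  move=> x0; rewrite le_eqVlt => /predU1P[->//|xy] yp.
  by apply/ltW; rewrite ltr_cos// in_itv/= ?x0 ?yp ?(le_trans x0 (ltW xy)) ?(le_trans (ltW xy) yp).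
have [up|/ltW up] := leP u pi; first exact: mono.
have -> : cos u = cos (2 * pi - u).
  have := @cosD2pi R (- u); rewrite cosN => <-; congr cos.
  by rewrite -[pi *+ 2]mulr_natl addrC.
by apply: mono => //; lra.
Qed.

(** If h x0 = c > 0, then h >= c / 2 within eta of x0. The n-th power of 1 + cos (x - x0) is at
    least q'^n within eta / 2 and at most q^n beyond eta, so orthogonality gives c / 2 * eta * q'^n
    <= 2 pi M q^n for all n, although q < q'. *)
Lemma fourier_zero_interior h (x0 : R) : continuous h -> (forall k, fourier h k = 0) ->
  0 < x0 -> x0 < 2 * pi -> h x0 <= 0.
Proof.
move=> ch h0 x00 x0p; rewrite leNgt; apply/negP => c0; set c := h x0 in c0.
have c2 : 0 < c / 2 by rewrite divr_gt0.
have [eta [eta0 etax etap etapi heta]] : exists eta, [/\ 0 < eta, eta <= x0, eta <= 2 * pi - x0,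
   eta <= pi / 2 & forall x, `|x - x0| <= eta -> c / 2 <= h x].
  have := ch x0 => /cvgrPdist_le => /(_ _ c2) /nbhs_ballP[e /= e0 he].
  (* The entries x0 and 2 * pi - x0 keep the peak inside [0, 2 * pi] and away from the periodic
     copies of x0; pi / 2 makes cos eta >= 0, hence q > 0. *)
  pose eta := Num.min (Num.min (e / 2) x0) (Num.min (2 * pi - x0) (pi / 2)).
  exists eta; split.
  - by rewrite !lt_min x00 subr_gt0 x0p !divr_gt0 ?pi_gt0.
  - by rewrite !ge_min lexx orbT.
  - by rewrite !ge_min lexx !orbT.
  - by rewrite !ge_min lexx !orbT.
  move=> x xx0; have := he x; rewrite /ball/= distrC => H.
  have : `|x - x0| < e.
    apply: le_lt_trans xx0 _; apply: (@le_lt_trans _ _ (e / 2)); first by rewrite !ge_min lexx.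
    lra.
  move=> /H; rewrite -/c ler_norml => /andP[_]; lra.
have pi0 := @pi_gt0 R.
pose q := 1 + cos eta; pose q' := 1 + cos (eta / 2).
have q0 : 0 < q.
  rewrite /q; have : 0 <= cos eta; last by lra.
  by apply: cos_ge0_pihalf; apply/andP; split; lra.
have qq' : q < q' by rewrite /q /q' ltrD2l ltr_cos ?in_itv/=; lra.
have [M M0 hM] : exists2 M, 0 <= M & forall x, x \in `[0, 2 * pi] -> - M <= h x.
  have cN : {within `[0, 2 * pi], continuous (fun x => - h x)}.
    by apply: continuous_subspaceT => x; apply: cvgN; exact: ch.
  have [m _ hm] := EVT_max (ltW (@twopi_gt0 R)) cN.
  exists `|h m| => // x /hm hx; have := ler_norm (- h m); rewrite normrN; lra.
pose A : set R := `[x0 - eta / 2, x0 + eta / 2]%classic.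
have AI : A `<=` I.
  by move=> x; rewrite /A /= !in_itv/= => /andP[h1 h2]; apply/andP; split; lra.
have iA : torus_int (\1_A : R -> R) = eta.
  rewrite /torus_int /Rintegral integral_indic//=; last exact: measurable_itv.
  rewrite (setIidl AI) /A lebesgue_measure_itv/= lte_fin.
  by rewrite ifT /=; lra.
have intA : torus_integrable (\1_A : R -> R).
  have hA := @integrable_indic_itv R (x0 - eta / 2) (x0 + eta / 2) true false.
  by apply: integrableS hA => //; exact: measurable_itv.
apply: (@exprn_unbounded q q' (2 * pi * M / (c / 2 * eta))) => // n.
rewrite mulrAC ler_pdivlMr ?mulr_gt0//.
have cc : continuous (fun x => cos (x - x0)).
  move=> x; apply: (@continuous_comp _ _ _ (fun x => x - x0) (@cos R)); last exact: continuous_cos.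
  by apply: cvgB; [exact: cvg_id|exact: cvg_cst].
have cW m : continuous (fun x => (1 + cos (x - x0)) ^+ m).
  move=> x; apply: (@continuous_comp _ _ _ (fun x => 1 + cos (x - x0)) (fun y => y ^+ m)).
    by apply: cvgD; [exact: cvg_cst|exact: cc].
  exact: exprn_continuous.
have iF : torus_integrable (fun x => h x * (1 + cos (x - x0)) ^+ n).
  by apply: continuous_torus_integrable => x; apply: cvgM; [exact: ch|exact: cW].
have iL : torus_integrable (fun x => c / 2 * q' ^+ n * \1_A x - M * q ^+ n).
  by apply: torus_integrableB; [exact: torus_integrableZ|exact: cst_torus_integrable].
(* Pointwise comparison in three cases: on A; off A with h >= 0; off A with h < 0, which forces |x -
   x0| > eta. *)
have : torus_int (fun x => c / 2 * q' ^+ n * \1_A x - M * q ^+ n) <= 0.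
  rewrite -(cos_kernel_orth x0 n ch h0); apply: le_Rintegral => // x xI.
  have W0 : 0 <= 1 + cos (x - x0) by have := cos_geN1 (x - x0); lra.
  have Mq0 : 0 <= M * q ^+ n by rewrite mulr_ge0// exprn_ge0// ltW.
  rewrite indicE; case: (boolP (x \in A)) => xA.
    rewrite mulr1; apply: (@le_trans _ _ (c / 2 * q' ^+ n)); first by rewrite gerBl.
    have xe : `|x - x0| <= eta / 2.
      by move: xA; rewrite inE /A /= in_itv/= => /andP[h1 h2]; rewrite ler_norml; apply/andP; split; lra.
    have h1 := heta x (le_trans xe (ltac:(lra) : eta / 2 <= eta)).
    apply: ler_pM => //; [exact: ltW|by rewrite exprn_ge0// ltW// (lt_trans q0)|].
    rewrite lerXn2r ?nnegrE//; first by rewrite ltW// (lt_trans q0).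
    rewrite /q' lerD2l -[cos (x - x0)]cos_norm.
    have : eta / 2 <= 2 * pi - `|x - x0| by lra.
    have [->//|ne] := eqVneq `|x - x0| (eta / 2).
    by move=> _; apply/ltW; rewrite ltr_cos ?in_itv/= ?normr_ge0 ?lt_neqAle ?ne ?xe//=; lra.
  rewrite mulr0 sub0r.
  have [hx|hx] := leP 0 (h x).
    by apply: (@le_trans _ _ 0); rewrite ?oppr_le0// mulr_ge0// exprn_ge0.
  have xe : eta < `|x - x0|.
    by rewrite ltNge; apply/negP => /heta; lra.
  have /andP[x1 x2] : 0 <= x <= 2 * pi by move: xI; rewrite /= in_itv.
  have xe' : `|x - x0| <= 2 * pi - eta by rewrite ler_norml; apply/andP; split; lra.
  have hc : cos (x - x0) <= cos eta.
    by rewrite -[cos (x - x0)]cos_norm; apply: cos_le_away => //; lra.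
  have h1 : (1 + cos (x - x0)) ^+ n <= q ^+ n.
    by rewrite lerXn2r ?nnegrE// ?(ltW q0)// lerD2l.
  have h2 : - M <= h x by apply: hM; rewrite in_itv/= x1.
  rewrite lerNl -mulNr; apply: ler_pM => //; rewrite ?oppr_ge0 ?(ltW hx) ?exprn_ge0//.
  by rewrite lerNl.
rewrite torus_intB ?torus_int_cst; [|exact: torus_integrableZ|exact: cst_torus_integrable].
by rewrite torus_intZ// iA; move: (q ^+ n) (q' ^+ n) => a b; lra.
Qed.

Lemma periodic_int h (n : int) x : periodic2pi h -> h (x + n%:~R * (2 * pi)) = h x.
Proof.
move=> ph; have P (m : nat) y : h (y + m%:~R * (2 * pi)) = h y.
  elim: m y => [|m ih] y; first by rewrite mul0r addr0.
  rewrite (_ : y + _ = (y + m%:~R * (2 * pi)) + 2 * pi); first by rewrite ph.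
  by rewrite -!pmulrn -natr1; ring.
case: (intP n) => [|m|m]; [exact: P|exact: P|].
by rewrite -[in RHS](subrK (m.+1%:~R * (2 * pi)) x) P rmorphN/= mulNr.
Qed.

Lemma fourier_unique h : continuous h -> periodic2pi h -> (forall k, fourier h k = 0) ->
  forall x, h x = 0.
Proof.
move=> ch ph h0.
have hI x : 0 < x -> x < 2 * pi -> h x = 0.
  move=> x0 xp; apply/eqP; rewrite eq_le fourier_zero_interior//=.
  rewrite -oppr_le0; apply: (@fourier_zero_interior (fun x => - h x)) => //.
    by move=> y; apply: cvgN; exact: ch.
  move=> k; have := @fourierZ R (-1) h k (continuous_torus_integrable ch).
  by rewrite h0 mulr0; under eq_fun do rewrite mulN1r.
(* At the endpoint 0 of [0, 2 * pi] the peak would not fit inside the interval; continuity settles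
   this point. *)
have h00 : h 0 = 0.
  apply/eqP/negPn/negP => hn; have e0 : 0 < `|h 0| by rewrite normr_gt0.
  have := ch 0 => /cvgrPdist_lt => /(_ _ e0) /nbhs_ballP[e /= e1 he].
  have pi0 := @twopi_gt0 R.
  pose x := Num.min (e / 2) pi.
  have x0 : 0 < x by rewrite lt_min divr_gt0// pi_gt0.
  have xe : x <= e / 2 by rewrite ge_min lexx.
  have xp : x <= pi by rewrite ge_min lexx orbT.
  have := he x; rewrite /ball/= sub0r normrN gtr0_norm// => H.
  have : `|h 0 - h x| < `|h 0| by apply: H; lra.
  by rewrite (hI x) ?subr0 ?ltxx//; lra.
move=> x; pose n := Num.floor (x / (2 * pi)).
rewrite -[x](subrK (n%:~R * (2 * pi))) periodic_int//.
have pi0 := @twopi_gt0 R.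
have h1 : n%:~R <= x / (2 * pi) by exact: real_floor_le (num_real _).
have h2 : x / (2 * pi) < (n + 1)%:~R by exact: real_floorD1_gt (num_real _).
move: h1 h2; rewrite ler_pdivlMr// ltr_pdivrMr//.
rewrite (_ : (n + 1)%:~R * (2 * pi) = n%:~R * (2 * pi) + 2 * pi); last by rewrite intrD; ring.
move=> h1 h2.
have [->//|hn] := eqVneq (x - n%:~R * (2 * pi)) 0.
by apply: hI; [rewrite lt_neqAle eq_sym hn subr_ge0|lra].
Qed.

(** The sum of the Fourier series of f is continuous, periodic and has the coefficients of f, so
    [fourier_unique] applies to the difference. *)
Lemma fourier_inversion f B : continuous f -> periodic2pi f ->
  bdsum (fun k => nc (fourier f k)) B -> fourier_series f (fourier f).
Proof.
move=> cf pf hB; have hf := continuous_torus_integrable cf.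
have gc := fourier_series_sum (fun k => fourierN_conj k hf) hB.
set g := (fun x => lim _) in gc.
have pg : periodic2pi g.
  move=> x; rewrite /g; congr (lim (_ @ \oo)); apply/funext => N; congr Re.
  apply: eq_bigr => k _; congr (_ * _).
  by rewrite mulrDr expiD /expi cos_2pi sin_2pi mulr1.
have cg := fourier_series_continuous gc.
suff fg : f = g by rewrite {1}fg.
apply/funext => x; apply/eqP; rewrite -subr_eq0; apply/eqP.
apply: (@fourier_unique (fun x => f x - g x)).
- by move=> y; apply: cvgB; [exact: cf|exact: cg].
- by move=> y; rewrite pf pg.
- move=> k; rewrite fourierB//; last exact: continuous_torus_integrable.
  by rewrite (fourier_of_series gc) subrr.
Qed.

End Uniqueness.

(** * Sobolev norms *)

Section SobolevNorm.
Variable R : realType.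
Local Notation C := R[i].
Local Notation mu := (@lebesgue_measure R).
Local Notation I := (`[0%R, (2 * pi)%R]%classic : set R).
Implicit Types (f g : R -> R) (s c : R).

Definition bracket s (k : int) : R := (1 + k%:~R ^+ 2) `^ s.

Lemma bracket_ge0 s k : 0 <= bracket s k. Proof. exact: powR_ge0. Qed.

Lemma bracket_base_ge1 (k : int) : 1 <= 1 + k%:~R ^+ 2 :> R.
Proof. by rewrite lerDl sqr_ge0. Qed.

Lemma bracket_ge1 s k : 0 <= s -> 1 <= bracket s k.
Proof.
move=> s0; rewrite /bracket -[leLHS](@powRr0 R (1 + k%:~R ^+ 2)).
by rewrite ler_powR// bracket_base_ge1.
Qed.

Lemma bracket_le s s' k : s <= s' -> bracket s k <= bracket s' k.
Proof. by move=> ss'; rewrite ler_powR// bracket_base_ge1. Qed.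

Lemma bracket_nat (n : nat) k : bracket n%:R k = (1 + k%:~R ^+ 2) ^+ n.
Proof. by rewrite /bracket powR_mulrn// (le_trans ler01)// bracket_base_ge1. Qed.

Definition sobolev_term s f k := bracket s k * nc (fourier f k) ^+ 2.

Lemma sobolev_term_ge0 s f k : 0 <= sobolev_term s f k.
Proof. by rewrite mulr_ge0 ?bracket_ge0 ?sqr_ge0. Qed.

Lemma sobolev_normE s f : sobolev_norm s f =
  ((\esum_(k in [set: int]) (sobolev_term s f k)%:E) `^ (2^-1))%E.
Proof.
rewrite /sobolev_norm; congr (_ `^ _)%E; apply: eq_esum => k _; congr EFin.
rewrite /sobolev_term /bracket; congr ((1 + _) `^ _ * _).
by rewrite intr_norm real_normK ?num_real.
Qed.

(** The bridge from the extended sums in [sobolev_norm] to bounds on finite lists. *)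
Lemma esum_leP (a : int -> R) c : (forall k, 0 <= a k) ->
  (\esum_(k in [set: int]) (a k)%:E <= c%:E)%E <-> bdsum a c.
Proof.
move=> a0; split => [h r ur|h].
  rewrite -lee_fin -sumEFin; apply: le_trans h.
  apply: esum_ge; exists [set` r]; first by split => //; exact: finite_seq.
  by rewrite -fsbig_seq.
apply: ge_ereal_sup => _ [X [finX _] <-].
by rewrite fsbig_finite//= sumEFin lee_fin; apply: h; exact: finmap.fset_uniq.
Qed.

Lemma sobolev_norm_sq s f :
  (sobolev_norm s f ^+ 2 = \esum_(k in [set: int]) (sobolev_term s f k)%:E)%E.
Proof.
rewrite sobolev_normE; set x := (\esum_(_ in _) _)%E.
have x0 : (0 <= x)%E by apply: esum_ge0 => k _; rewrite lee_fin sobolev_term_ge0.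
case: x x0 => [x||] //= x0.
  by rewrite -EFinM powR12_sqrt// -expr2 sqr_sqrtr.
by rewrite invr_eq0 pnatr_eq0/= mulyy.
Qed.

Lemma sobolev_norm_ge0 s f : (0 <= sobolev_norm s f)%E.
Proof. exact: poweR_ge0. Qed.

Lemma sobolev_norm_leP s f c : 0 <= c ->
  (sobolev_norm s f <= c%:E)%E <-> bdsum (sobolev_term s f) (c ^+ 2).
Proof.
move=> c0; rewrite -esum_leP; last by move=> k; exact: sobolev_term_ge0.
rewrite -sobolev_norm_sq EFin_expe.
have := sobolev_norm_ge0 s f; case: (sobolev_norm s f) => [x||] //= x0.
  by rewrite -!EFinM !lee_fin -!expr2 ler_pXn2r.
Qed.

Lemma sobolev_bdsum s f : (sobolev_norm s f < +oo)%E ->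
  exists c, bdsum (sobolev_term s f) c.
Proof.
have := sobolev_norm_ge0 s f; case: (sobolev_norm s f) (@sobolev_norm_leP s f) => [x||] //= h x0 _.
by exists (x ^+ 2); apply/h; rewrite ?lexx// -lee_fin.
Qed.

Lemma nc_fourier_le s f c k : 0 <= s -> 0 <= c -> (sobolev_norm s f <= c%:E)%E ->
  nc (fourier f k) <= c.
Proof.
move=> s0 c0 /(sobolev_norm_leP _ _ c0) /(bdsum_term k) h.
rewrite -(@ler_pXn2r _ 2)// ?nnegrE ?nc_ge0//; apply: le_trans h.
by rewrite /sobolev_term ler_peMl ?sqr_ge0 ?bracket_ge1.
Qed.

Lemma sobolev_integrable s f : sobolev s f -> torus_integrable f.
Proof.
case=> _ mf L2 _.
have h1 : mu.-integrable I (fun x => (1 + f x ^+ 2)%:E).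
  have h0 : mu.-integrable I (EFin \o cst (1 : R)) by exact: cst_torus_integrable.
  by exact: (@integrableD _ _ R mu I (measurable_itv _) (EFin \o cst 1) _ h0 L2).
apply: (@le_integrable _ _ R mu I (measurable_itv _) (EFin \o f) _ _ _ h1).
  by apply/measurable_EFinP; exact: measurable_funTS.
move=> x _ /=; rewrite lee_fin (ger0_norm (_ : 0 <= 1 + _)) ?addr_ge0 ?sqr_ge0//.
rewrite -[f x ^+ 2]real_normK ?num_real//; have := sqr_ge0 (`|f x| - 1); nra.
Qed.

Lemma fourier_ae f g k : measurable_fun setT f -> measurable_fun setT g ->
  {ae mu, forall x, f x = g x} -> fourier f k = fourier g k.
Proof.
move=> mf mg fg.
have H (u : R -> R) : measurable_fun setT u ->
    torus_int (fun x => f x * u x) = torus_int (fun x => g x * u x).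
  move=> mu_; rewrite /torus_int /Rintegral; congr fine; apply: ae_eq_integral => //.
  - by apply/measurable_EFinP/measurable_funTS; exact: measurable_funM.
  - by apply/measurable_EFinP/measurable_funTS; exact: measurable_funM.
  - by apply: (@filterS _ (almost_everywhere mu) _ _ _ _ fg) => x fgx _; rewrite fgx.
have mc : measurable_fun setT (fun x : R => cos (- (k%:~R * x))).
  apply: continuous_measurable_fun .
  rewrite (_ : (fun _ => _) = (fun x => cos ((- k%:~R) * x))); first exact: continuous_cosk.
  by apply/funext => x; rewrite mulNr.
have ms : measurable_fun setT (fun x : R => sin (- (k%:~R * x))).
  apply: continuous_measurable_fun .
  rewrite (_ : (fun _ => _) = (fun x => sin ((- k%:~R) * x))); first exact: continuous_sink.
  by apply/funext => x; rewrite mulNr.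
rewrite /fourier /torus_cint; congr (_ * Complex _ _).
  under eq_fun do rewrite ReM /= mul0r subr0.
  by rewrite H//; congr torus_int; apply/funext => x; rewrite ReM /= mul0r subr0.
under eq_fun do rewrite ImM /= mul0r addr0.
by rewrite H//; congr torus_int; apply/funext => x; rewrite ImM /= mul0r addr0.
Qed.

Lemma cvge0_near (T : Type) (F : set_system T) (FF : Filter F) (u : T -> \bar R) :
  (u @ F --> 0%E) -> forall e, 0 < e -> \forall x \near F, (u x <= e%:E)%E.
Proof.
move=> /fine_cvgP[fu cu] e e0.
move/cvgrPdist_le : cu => /(_ e e0) cu.
apply: filterS2 fu cu => x fx /=; rewrite sub0r normrN => h.
by rewrite -(fineK fx) lee_fin (le_trans _ h)// ler_norm.
Qed.

(** For s >= 0 every coefficient is bounded by the H^s norm, so difference quotients that converge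
    in H^s converge coefficientwise. Applied to phi_t in H^(s - 3), this is one place where s >= 3
    enters. *)
Lemma fourier_tder (T s : R) (u v : R -> R -> R) t k : 0 <= s -> t \in `[0, T] ->
  sobolev_time_derivative T s u v ->
  ctder T (fun t => fourier (u t) k) (fourier (v t) k) t.
Proof.
move=> s0 tT /[dup] hu /(_ t tT)[su sv cv].
have iu := sobolev_integrable su; have iv := sobolev_integrable sv.
have key e : 0 < e -> \forall t' \near within `[0, T] t^',
  nc ((t' - t)^-1%:C%C * (fourier (u t') k - fourier (u t) k) - fourier (v t) k) <= e.
  move=> e0; apply: (@filterS2 _ (within `[0, T] t^') _ _ _ _ _ (withinT _ _)
    (cvge0_near _ cv e0)) => t' t'T h.
  have [su' _ _] := hu t' t'T; have iu' := sobolev_integrable su'.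
  apply: le_trans (nc_fourier_le k s0 (ltW e0) h).
  have e1 : (fun x => (u t' x - u t x) / (t' - t) - v t x) =
    (fun x => (t' - t)^-1 * (u t' x - u t x) - v t x).
    by apply/funext => x; rewrite mulrC.
  rewrite e1 fourierB// ?fourierZ// ?fourierB//; first exact: torus_integrableB.
  by apply: torus_integrableZ; exact: torus_integrableB.
split; apply: tder_quotient; apply/cvgrPdist_le => e /key; apply: filterS => t' h.
  rewrite distrC; apply: le_trans h; apply: le_trans (Re_le_nc _).
  by rewrite !(ReD, ReN, ReZ) [X in _ <= `|X - _|]mulrC.
rewrite distrC; apply: le_trans h; apply: le_trans (Im_le_nc _).
by rewrite !(ImD, ImN, ImZ) [X in _ <= `|X - _|]mulrC.
Qed.

End SobolevNorm.

(** * Fourier coefficients of the flux *)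

Section Flux.
Variable R : realType.
Local Notation C := R[i].
Local Notation Re := complex.Re.
Local Notation Im := complex.Im.
Implicit Types (f g : R -> R) (k : int).

Definition hmul k : C := - 'i%C * (sgz k)%:~R.

Lemma hmulE k : hmul k = - 'i%C * (Num.sg (k%:~R : R))%:C%C.
Proof. by rewrite /hmul sgrEz sgz_int rmorph_int. Qed.

Lemma nc_hmul k : nc (hmul k) <= 1.
Proof.
rewrite hmulE ncM ncN nc_real [nc _](_ : _ = 1) ?mul1r.
  by rewrite normr_sg; case: (_ != 0).
by rewrite /nc/= expr0n/= expr1n add0r sqrtr1.
Qed.

Lemma hmulN k : hmul (- k) = (hmul k)^*%C.
Proof. by rewrite !hmulE rmorphN/= sgrN; simpc; congr Complex; ring. Qed.

Lemma hilbert_series f B : torus_integrable f -> bdsum (fun k => nc (fourier f k)) B ->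
  fourier_series (hilbert f) (fun k => hmul k * fourier f k).
Proof.
move=> hf hB.
have hh : hermitian (fun k => hmul k * fourier f k).
  by move=> k; rewrite hmulN (fourierN_conj _ hf) [RHS]rmorphM.
have := fourier_series_sum (B := B) hh.
have -> : (fun x => lim ((fun N => Re (partial_sum (fun k => hmul k * fourier f k) N x)) @ \oo))
  = hilbert f.
  apply/funext => x; rewrite /hilbert /fourier_multiplier; congr (lim (_ @ \oo)).
  (* [box] enumerates the frequencies in the order used by [fourier_multiplier], so the two sums
     agree term by term. *)
  apply/funext => N; congr Re; rewrite /partial_sum /box; unlock.
  by rewrite big_map big_mkord.
apply; apply: bdsum_le hB => k; rewrite ncM ler_piMl ?nc_ge0//; exact: nc_hmul.
Qed.

(** Absolute summability with this weight gives two classical derivatives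
    ([fourier_series_derive2]), and [wtD] makes it stable under products. *)
Definition wt k : R := 1 + k%:~R ^+ 2.

Lemma wt_ge1 k : 1 <= wt k. Proof. by rewrite lerDl sqr_ge0. Qed.
Lemma wt_ge0 k : 0 <= wt k. Proof. exact: le_trans ler01 (wt_ge1 k). Qed.

Lemma wtD k l : wt (k + l) <= 2 * (wt k * wt l).
Proof.
rewrite /wt rmorphD/=; move: (k%:~R : R) (l%:~R : R) => a b.
have := sqr_ge0 (a - b); have := mulr_ge0 (sqr_ge0 a) (sqr_ge0 b); nra.
Qed.

Lemma ak_le_wt k : ak R k <= wt k.
Proof. by apply: le_trans (ak_le_sq _ _) _; rewrite /wt lerDr. Qed.

Lemma bdsum_wt (a : int -> R) B : (forall k, 0 <= a k) ->
  bdsum (fun k => wt k * a k) B -> bdsum a B.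
Proof. by move=> a0; apply: bdsum_le => k; rewrite ler_peMl ?wt_ge1. Qed.

Lemma bdsum_ak (a : int -> R) B : (forall k, 0 <= a k) ->
  bdsum (fun k => wt k * a k) B -> bdsum (fun k => ak R k * a k) B.
Proof. by move=> a0; apply: bdsum_le => k; rewrite ler_wpM2r ?ak_le_wt. Qed.

Lemma bdsum_conv f g c d B B' : fourier_series f c -> fourier_series g d ->
  bdsum (fun k => wt k * nc (c k)) B -> bdsum (fun k => wt k * nc (d k)) B' ->
  bdsum (fun k => wt k * nc (fourier (fun x => f x * g x) k)) (2 * B * B').
Proof.
move=> fc gd hB hB' r ur; apply/ler_addgt0Pr => e e0.
(* [fourier_mul] gives the coefficients only in the limit; an error e / S at each k of r adds up to
   at most e after weighting. *)
pose S := \sum_(k <- r) wt k + 1.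
have S0 : 0 < S by rewrite ltr_wpDl// sumr_ge0// => k _; exact: wt_ge0.
have [L0 hL] := @uniform_rank _ r (fun k => fourier_mul fc gd k (divr_gt0 e0 S0)).
have {}hL := hL L0 (leqnn _).
pose F k j l := if j + l == k then wt k * (nc (c j) * nc (d l)) else 0.
apply: (@le_trans _ _ (\sum_(k <- r) (\sum_(j <- box L0) \sum_(l <- box L0) F k j l
   + wt k * (e / S)))).
  rewrite big_seq [leRHS]big_seq; apply: ler_sum => k kr.
  apply: (@le_trans _ _ (wt k * (\sum_(j <- box L0) \sum_(l <- box L0)
    (if j + l == k then nc (c j) * nc (d l) else 0) + e / S))).
    rewrite ler_wpM2l ?wt_ge0//.
    set q := \sum_(j <- box L0) \sum_(l <- box L0) (if j + l == k then c j * d l else 0) in hL.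
    rewrite -[fourier _ k](subrK (\sum_(j <- box L0) \sum_(l <- box L0) (if j + l == k then c j * d l else 0))).
    rewrite addrC [leRHS]addrC; rewrite [X in nc X]addrC; apply: le_trans (ncD _ _) _.
    apply: lerD; first exact: hL.
    apply: le_trans (nc_sum _ _ _) _; apply: ler_sum => j _.
    apply: le_trans (nc_sum _ _ _) _; apply: ler_sum => l _.
    by case: ifP => _; rewrite ?nc0// ncM.
  rewrite mulrDr lerD2r mulr_sumr; apply: ler_sum => j _; rewrite mulr_sumr.
  by apply: ler_sum => l _; rewrite /F; case: ifP => _; rewrite ?mulr0.
rewrite big_split/= -mulr_suml; apply: lerD; last first.
  by rewrite mulrCA ler_piMr ?(ltW e0)// ler_pdivrMr// mul1r /S lerDl.
rewrite exchange_big/=.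
apply: (@le_trans _ _ (\sum_(j <- box L0) \sum_(l <- box L0)
  2 * (wt j * nc (c j)) * (wt l * nc (d l)))).
  apply: ler_sum => j _; rewrite exchange_big/=; apply: ler_sum => l _.
  apply: (@le_trans _ _ (\sum_(k <- r) (if j + l == k then 2 * (wt j * nc (c j)) * (wt l * nc (d l)) else 0))).
    apply: ler_sum => k _; rewrite /F; case: eqP => [<-|//].
    have := ler_wpM2r (mulr_ge0 (nc_ge0 (c j)) (nc_ge0 (d l))) (wtD j l).
    by move=> /le_trans; apply; rewrite le_eqVlt; apply/orP; left; apply/eqP; ring.
  apply: (@sum_delta_le _ _ _ _ (j + l)) => //; last by move=> k /eqP.
  by rewrite !mulr_ge0 ?wt_ge0 ?nc_ge0.
under eq_bigr do rewrite -mulr_sumr.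
rewrite -mulr_suml -mulr_sumr.
have B0 := bdsum_ge0 hB.
have s0 (u : int -> C) : 0 <= \sum_(j <- box L0) wt j * nc (u j).
  by apply: sumr_ge0 => j _; rewrite mulr_ge0 ?wt_ge0 ?nc_ge0.
by apply: ler_pM; rewrite ?mulr_ge0 ?ler_wpM2l ?hB ?hB' ?box_uniq ?s0.
Qed.

Lemma fourier_series_derive2 f c B : fourier_series f c ->
  bdsum (fun k => wt k * nc (c k)) B ->
  fourier_series (derive1n 2 f) (fun k => - (k%:~R ^+ 2)%:C%C * c k).
Proof.
move=> fc hB.
have [_ h1] := fourier_series_derive fc (bdsum_ak (fun k => nc_ge0 _) hB).
have e1 k : nc ('i%C * (k%:~R)%:C%C * c k) = ak R k * nc (c k).
  by rewrite !ncM nc_real /nc/= expr0n/= expr1n add0r sqrtr1 mul1r.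
have hB2 : bdsum (fun k => ak R k * nc ('i%C * (k%:~R)%:C%C * c k)) B.
  apply: bdsum_le hB => k; rewrite e1 mulrA -expr2 ak_sq ler_wpM2r ?nc_ge0//.
  by rewrite /wt lerDr.
have [_ h2] := fourier_series_derive h1 hB2.
rewrite (_ : (fun k => - (k%:~R ^+ 2)%:C%C * c k) =
  (fun k => 'i%C * (k%:~R)%:C%C * ('i%C * (k%:~R)%:C%C * c k))) //.
by apply/funext => k; case: (c k) => a b; simpc; congr Complex; ring.
Qed.

(** The symbol computation with I * I = -1 as the only rule for I, within reach of [ring]. Here h is
    1/2; x and y are j + l and its square; a, b, c are the signs of j + l, j, l; d and e are l^2 and
    j^2. *)
Lemma flux_symbol_algebra (I u v h x y a b c d e : C) : I * I = -1 ->
  I * x * (h * (- y * ((- I * a) * ((- I * b * u) * (- I * c * v))))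
    + h * ((- I * b * u) * (- d * v) + (- e * u) * (- I * c * v))) =
  h * (x * y * a * b * c - x * b * d - x * c * e) * (u * v).
Proof.
move=> II.
transitivity (h * (x * y * a * b * c * ((I * I) * (I * I)) + x * b * d * (I * I)
   + x * c * e * (I * I)) * (u * v)); first by ring.
by rewrite II; ring.
Qed.

Lemma flux_symbol j l (u v : C) :
  'i%C * ((j + l)%:~R)%:C%C * ((2^-1)%:C%C * (- ((j + l)%:~R ^+ 2)%:C%C * (hmul (j + l) *
     (hmul j * u * (hmul l * v))))
    + (2^-1)%:C%C * ((hmul j * u) * (- (l%:~R ^+ 2)%:C%C * v)
     + (- (j%:~R ^+ 2)%:C%C * u) * (hmul l * v))) =
  (kap R j l)%:C%C * (u * v).
Proof.
rewrite !hmulE flux_symbol_algebra; last by simpc; congr Complex; ring.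
congr (_ * _); rewrite -!(rmorphM, rmorphB)/=; congr (_%:C)%C; rewrite /kap /ak.
have -> : `|(j + l)%:~R| = Num.sg (j + l)%:~R * (j + l)%:~R :> R by exact: normrEsg.
ring.
Qed.

Lemma flux_fourier f B : continuous f -> periodic2pi f ->
  bdsum (fun k => wt k * nc (fourier f k)) B ->
  [/\ torus_integrable (flux f), torus_integrable (derive1n 2 f),
    forall k, fourier (derive1n 2 f) k = - (k%:~R ^+ 2)%:C%C * fourier f k &
    forall k e, 0 < e -> exists L0, forall L, (L0 <= L)%N ->
      nc ('i%C * (k%:~R)%:C%C * fourier (flux f) k
        - \sum_(j <- box L) \sum_(l <- box L)
          (if j + l == k then (kap R j l)%:C%C * (fourier f j * fourier f l) else 0)) <= e].
Proof.
move=> cf pf hB; set z := fourier f.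
have hf := continuous_torus_integrable cf.
have z0 := fun k => nc_ge0 (z k); have hBz := bdsum_wt z0 hB.
have fz := fourier_inversion cf pf hBz.
have f2 := fourier_series_derive2 fz hB.
have wz := hilbert_series hf hBz; set w := hilbert f in wz.
have wwt k : wt k * nc (hmul k * z k) <= wt k * nc (z k).
  by rewrite ler_wpM2l ?wt_ge0// ncM ler_piMl ?nc_ge0//; exact: nc_hmul.
have hBw : bdsum (fun k => wt k * nc (hmul k * z k)) B by exact: bdsum_le hB.
have cw := fourier_series_continuous wz.
have cw2 : continuous (fun x => w x * w x) by move=> x; apply: cvgM; exact: cw.
have iw2 := continuous_torus_integrable cw2.
have hw2 := bdsum_conv wz wz hBw hBw.
have h2 := hilbert_series iw2 (bdsum_wt (fun k => nc_ge0 _) hw2).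
have hB2 : bdsum (fun k => wt k * nc (hmul k * fourier (fun x => w x * w x) k)) (2 * B * B).
  apply: bdsum_le hw2 => k.
  by rewrite ler_wpM2l ?wt_ge0// ncM ler_piMl ?nc_ge0//; exact: nc_hmul.
have h4 := fourier_series_derive2 h2 hB2.
have i4 := fourier_series_integrable h4.
have c2 := fourier_series_continuous f2.
have cwf : continuous (fun x => w x * derive1n 2 f x).
  by move=> x; apply: cvgM; [exact: cw|exact: c2].
have iwf := continuous_torus_integrable cwf.
have iZ := torus_integrableZ 2^-1 i4.
have eflux : flux f = (fun x => 2^-1 * derive1n 2 (hilbert (fun x => w x * w x)) x
   + w x * derive1n 2 f x).
  by apply/funext => x; rewrite /flux -/w (_ : (fun y => w y ^+ 2) = (fun y => w y * w y)).
split.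
- by rewrite eflux; exact: torus_integrableD iZ iwf.
- exact: fourier_series_integrable f2.
- by move=> k; rewrite (fourier_of_series f2).
move=> k e e0.
(* The product of w with the second derivative of f is written as the half sum of both orders, so
   that its convolution is symmetric in j and l, as [kap] is. *)
have ef : fourier (flux f) k = (2^-1)%:C%C * (- (k%:~R ^+ 2)%:C%C * (hmul k * fourier (fun x => w x * w x) k))
   + (2^-1)%:C%C * (fourier (fun x => w x * derive1n 2 f x) k
     + fourier (fun x => derive1n 2 f x * w x) k).
  rewrite eflux.
  have gen (a b : R -> R) c : torus_integrable a -> torus_integrable b -> fourier a k = c ->
      fourier (fun x => 2^-1 * a x + b x) k = (2^-1)%:C%C * c + fourier b k.
    by move=> ia ib <-; rewrite (fourierD _ (torus_integrableZ _ ia) ib) fourierZ.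
  rewrite (gen _ _ _ i4 iwf (fourier_of_series h4 k)); congr (_ + _).
  rewrite (_ : (fun x => derive1n 2 f x * w x) = (fun x => w x * derive1n 2 f x)).
    by move: (fourier _ k) => u; case: u => a b; simpc; congr Complex; field.
  by apply/funext => x; rewrite mulrC.
(* The derivatives amplify the errors of the three products by at most |k| (k^2 + 1); the 1 keeps K
   positive. *)
pose K := ak R k ^+ 3 + ak R k + 1.
have K0 : 0 < K by rewrite ltr_wpDl// addr_ge0 ?exprn_ge0 ?ak_ge0.
have e'0 : 0 < e / K by rewrite divr_gt0.
have [L1 hL1] := fourier_mul wz wz k e'0.
have [L2 hL2] := fourier_mul wz f2 k e'0.
have [L3 hL3] := fourier_mul f2 wz k e'0.
exists (maxn L1 (maxn L2 L3)) => L; rewrite !geq_max => /and3P[l1 l2 l3].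
have {}hL1 := hL1 L l1; have {}hL2 := hL2 L l2; have {}hL3 := hL3 L l3.
set S1 := \sum_(_ <- _) _ in hL1; set S2 := \sum_(_ <- _) _ in hL2; set S3 := \sum_(_ <- _) _ in hL3.
have -> : \sum_(j <- box L) \sum_(l <- box L)
   (if j + l == k then (kap R j l)%:C%C * (z j * z l) else 0) =
  'i%C * (k%:~R)%:C%C * ((2^-1)%:C%C * (- (k%:~R ^+ 2)%:C%C * (hmul k * S1)) + (2^-1)%:C%C * (S2 + S3)).
  rewrite /S1 /S2 /S3 -big_split/= !mulr_sumr -big_split/= mulr_sumr; apply: eq_bigr => j _.
  rewrite -big_split/= !mulr_sumr -big_split/= mulr_sumr; apply: eq_bigr => l _.
  case: eqP => [<-|_]; last by rewrite addr0 !mulr0 addr0 mulr0.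
  by rewrite flux_symbol.
rewrite ef -mulrBr.
set F1 := fourier _ k in hL1 *; set F2 := fourier _ k in hL2 *; set F3 := fourier _ k in hL3 *.
rewrite (_ : _ - _ = (2^-1)%:C%C * (- (k%:~R ^+ 2)%:C%C * hmul k * (F1 - S1))
  + (2^-1)%:C%C * ((F2 - S2) + (F3 - S3))); last by ring.
rewrite ncM [nc ('i%C * _)]ncM nc_real -/(ak R k) [nc 'i%C](_ : _ = 1); last first.
  by rewrite /nc/= expr0n/= expr1n add0r sqrtr1.
rewrite mul1r.
have h : nc ((2^-1)%:C%C * (- (k%:~R ^+ 2)%:C%C * hmul k * (F1 - S1))
  + (2^-1)%:C%C * ((F2 - S2) + (F3 - S3))) <= (ak R k ^+ 2 + 1) * (e / K).
  move: (hmul k) (nc_hmul k) => hk nh; apply: le_trans (ncD _ _) _; rewrite !ncM !ncN !nc_real ger0_norm ?invr_ge0//.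
  rewrite ger0_norm ?sqr_ge0// -ak_sq.
  have q1 : ak R k ^+ 2 * nc hk * nc (F1 - S1) <= ak R k ^+ 2 * (e / K).
    rewrite -mulrA ler_wpM2l ?sqr_ge0//; apply: le_trans hL1.
    by rewrite ler_piMl ?nc_ge0//; exact: nh.
  have q2 := le_trans (ncD (F2 - S2) (F3 - S3)) (lerD hL2 hL3).
  have q3 : 0 <= ak R k ^+ 2 * nc hk * nc (F1 - S1).
    exact: mulr_ge0 (mulr_ge0 (sqr_ge0 _) (nc_ge0 _)) (nc_ge0 _).
  by move: q1 q2 q3; clear; lra.
apply: le_trans (ler_wpM2l (ak_ge0 R k) h) _.
rewrite mulrA mulrCA ler_piMr ?(ltW e0)// ler_pdivrMr// mul1r /K.
by rewrite -subr_ge0 (_ : _ - _ = 1) //; ring.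
Qed.

Lemma derive1n_trig (k : int) (n : nat) (a b : R) : exists a' b' : R,
  derive1n n (fun x => a * cos (k%:~R * x) + b * sin (k%:~R * x)) =
  (fun x => a' * cos (k%:~R * x) + b' * sin (k%:~R * x)).
Proof.
elim: n => [|n [a' [b' ih]]]; first by exists a, b.
exists (b' * k%:~R), (- (a' * k%:~R)); rewrite /derive1n iterS -/(derive1n n _) ih.
apply/funext => x; rewrite derive1E.
have h := is_deriveD (is_derive_cmul a' (is_derive_cosk k%:~R x))
  (is_derive_cmul b' (is_derive_sink k%:~R x)).
by have [_ ->] := h; ring.
Qed.

Lemma smooth_periodic_trig (k : int) (a b : R) :
  smooth_periodic (fun x => a * cos (k%:~R * x) + b * sin (k%:~R * x)).
Proof.
split => [x|n x].
  rewrite mulrDr; have := cos_2pi R k; have := sin_2pi R k => s c.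
  by rewrite cosD sinD s c !mulr0 !mulr1 subr0 addr0.
have [a' [b' ->]] := derive1n_trig k n a b.
have h := is_deriveD (is_derive_cmul a' (is_derive_cosk k%:~R x))
  (is_derive_cmul b' (is_derive_sink k%:~R x)).
by have [] := h.
Qed.

(** Test functions are real, so the character is tested through its cosine and its sine. *)
Lemma weak_derivative_fourier f g k : torus_integrable f -> torus_integrable g ->
  weak_derivative f g -> 'i%C * (k%:~R)%:C%C * fourier f k = fourier g k.
Proof.
move=> hf hg w.
have iC h : torus_integrable h -> torus_integrable (fun x => h x * cos (k%:~R * x)).
  by move=> hh; apply: torus_integrableM => // [|x]; [exact: continuous_cosk|exact: cos_max].
have iS h : torus_integrable h -> torus_integrable (fun x => h x * sin (k%:~R * x)).
  by move=> hh; apply: torus_integrableM => // [|x]; [exact: continuous_sink|exact: sin_max].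
have d a b : derive1 (fun x => a * cos (k%:~R * x) + b * sin (k%:~R * x)) =
  (fun x => a * (- (k%:~R * sin (k%:~R * x))) + b * (k%:~R * cos (k%:~R * x))).
  apply/funext => x; rewrite derive1E.
  have h := is_deriveD (is_derive_cmul a (is_derive_cosk k%:~R x))
    (is_derive_cmul b (is_derive_sink k%:~R x)).
  by have [_ ->] := h.
have E1 : k%:~R * torus_int (fun x => f x * sin (k%:~R * x)) =
    torus_int (fun x => g x * cos (k%:~R * x)).
  have := w _ (smooth_periodic_trig k 1 0); rewrite d => h; apply: oppr_inj.
  rewrite -mulNr -torus_intZ; last exact: iS.
  transitivity (- torus_int (fun x => g x * (1 * cos (k%:~R * x) + 0 * sin (k%:~R * x)))).
    by rewrite -h; congr torus_int; apply/funext => x; ring.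
  by congr (- torus_int _); apply/funext => x; rewrite mul1r mul0r addr0.
have E2 : k%:~R * torus_int (fun x => f x * cos (k%:~R * x)) =
    - torus_int (fun x => g x * sin (k%:~R * x)).
  have := w _ (smooth_periodic_trig k 0 1); rewrite d => h.
  rewrite -torus_intZ; last exact: iC.
  transitivity (- torus_int (fun x => g x * (0 * cos (k%:~R * x) + 1 * sin (k%:~R * x)))).
    by rewrite -h; congr torus_int; apply/funext => x; ring.
  by congr (- torus_int _); apply/funext => x; rewrite mul1r mul0r add0r.
rewrite !fourierE// -E1 -E2; simpc; congr Complex; ring.
Qed.

Lemma cmean_sum (r : seq int) (F : int -> R -> C) : (forall k, cintegrable (F k)) ->
  cintegrable (fun x => \sum_(k <- r) F k x) /\
  cmean (fun x => \sum_(k <- r) F k x) = \sum_(k <- r) cmean (F k).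
Proof.
move=> hF; elim: r => [|k r [ih1 ih2]].
  have -> : (fun x => \sum_(k <- [::]) F k x) = trig [::].
    by apply/funext => x; rewrite /trig !big_nil.
  by split; [exact: cintegrable_trig|rewrite cmean_trig !big_nil].
have -> : (fun x => \sum_(k <- k :: r) F k x) = (fun x => F k x + \sum_(k <- r) F k x).
  by apply/funext => x; rewrite big_cons.
by split; [exact: cintegrableD|rewrite cmeanD// ih2 big_cons].
Qed.

(** A Toeplitz form: the sum is the mean of Y times the squared modulus of the trigonometric
    polynomial with coefficients h. *)
Lemma quadratic_form_ge0 Y P (h : int -> C) : torus_integrable Y ->
  (forall x, 0 <= Y x) ->
  0 <= Re (\sum_(k <- box P) \sum_(l <- box P) fourier Y (k - l) * h l * (h k)^*%C).
Proof.
move=> iY Y0.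
pose G x := \sum_(l <- box P) h l * expi (l%:~R * x).
pose F k l x := (h l * (h k)^*%C) * ((Y x)%:C%C * expi (- ((k - l)%:~R * x))).
have iF k l : cintegrable (F k l) by apply: cintegrableZ; exact: cintegrable_fourier.
have iF' k := (cmean_sum (box P) (iF k)).
have [i1 e1] := cmean_sum (box P) (fun k => (iF' k).1).
have -> : \sum_(k <- box P) \sum_(l <- box P) fourier Y (k - l) * h l * (h k)^*%C =
   cmean (fun x => \sum_(k <- box P) \sum_(l <- box P) F k l x).
  rewrite e1; apply: eq_bigr => k _; rewrite (iF' k).2; apply: eq_bigr => l _.
  rewrite /F cmeanZ; last exact: cintegrable_fourier.
  by rewrite -[cmean _]/(fourier Y (k - l)); ring.
rewrite /cmean ReZ mulr_ge0 ?invr_ge0 ?(ltW (@twopi_gt0 R))//=.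
apply: Rintegral_ge0 => x _.
have -> : \sum_(k <- box P) \sum_(l <- box P) F k l x = (Y x * nc (G x) ^+ 2)%:C%C.
  rewrite rmorphM/= -mulcJ /G rmorph_sum/= mulr_suml mulr_sumr exchange_big/=.
  apply: eq_bigr => l _; rewrite !mulr_sumr; apply: eq_bigr => k _.
  have -> : (h k * expi (k%:~R * x))^*%C = (h k)^*%C * expi (- (k%:~R * x)).
    by rewrite -expiJ; exact: rmorphM.
  rewrite /F.
  have -> : expi (- ((k - l)%:~R * x)) = expi (l%:~R * x) * expi (- (k%:~R * x)).
    by rewrite -expiD; congr expi; rewrite rmorphB/=; ring.
  ring.
by rewrite /= mulr_ge0 ?sqr_ge0.
Qed.

End Flux.

(** * Continuous dependence *)

Section Convergence.
Variable R : realType.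
Local Notation C := R[i].
Implicit Types (z p : R -> int -> C) (d : int -> R) (s L : R).

Lemma absz_sqr k : k%:~R ^+ 2 = (absz k)%:R ^+ 2 :> R.
Proof. by rewrite natr_absz intr_norm real_normK ?num_real. Qed.

Lemma weight_sqr s N0 L N n : weight s N0 L N n ^+ 2 =
  (1 + (minn n N)%:R ^+ 2) `^ (s - 1) * ramp N0 L (minn n N) ^+ 2.
Proof.
rewrite /weight exprMn; congr (_ * _).
by rewrite -[LHS]powR_mulrn ?powR_ge0// -powRrM divfK ?pnatr_eq0.
Qed.

Lemma bracket_min s N k : 0 <= s -> (1 + (minn (absz k) N)%:R ^+ 2) `^ s <= bracket s k.
Proof.
move=> s0; rewrite /bracket absz_sqr ge0_ler_powR ?nnegrE ?addr_ge0 ?sqr_ge0//.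
by rewrite lerD2l lerXn2r ?nnegrE// ler_nat geq_minl.
Qed.

Lemma weight_sqr_le s N0 L N k : 1 <= s -> 1 <= L ->
  weight s N0 L N (absz k) ^+ 2 <= L ^+ 2 * bracket (s - 1) k.
Proof.
move=> s1 L1; have L0 := le_trans ler01 L1.
rewrite weight_sqr mulrC ler_pM ?sqr_ge0 ?powR_ge0 ?bracket_min ?subr_ge0//.
by rewrite lerXn2r ?nnegrE// ?ramp_leL// (le_trans ler01)// ramp_ge1.
Qed.

Lemma weight_sqr_low s N0 L N k : 1 <= s -> 1 <= L -> (absz k <= N0)%N ->
  weight s N0 L N (absz k) ^+ 2 <= bracket (s - 1) k.
Proof.
move=> s1 L1 kN; rewrite weight_sqr ramp_small//; last exact: leq_trans (geq_minl _ _) kN.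
by rewrite expr1n mulr1 bracket_min ?subr_ge0.
Qed.

Lemma weight_sqr_high s N0 L N k : (0 < N0)%N -> (absz k <= N)%N ->
  L * N0%:R <= (absz k)%:R ->
  weight s N0 L N (absz k) ^+ 2 = L ^+ 2 * bracket (s - 1) k.
Proof.
move=> N00 kN hk; rewrite weight_sqr (minn_idPl kN) ramp_large//.
by rewrite mulrC /bracket absz_sqr.
Qed.

(** Up to N0 the ramp is 1; beyond, it costs at most L^2 against a tail eta. Hence N0 may be chosen
    after L so that the amplification hardly changes the bound. *)
Lemma weighted_data s N0 L N d Y eta : 1 <= s -> 1 <= L -> (forall k, 0 <= d k) ->
  bdsum (fun k => bracket (s - 1) k * d k) Y ->
  (forall r, uniq r -> (forall k, k \in r -> (N0 < absz k)%N) ->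
     \sum_(k <- r) bracket (s - 1) k * d k <= eta) ->
  bdsum (fun k => weight s N0 L N (absz k) ^+ 2 * d k) (Y + L ^+ 2 * eta).
Proof.
move=> s1 L1 d0 hY heta r ur; rewrite (bigID (fun k => absz k <= N0)%N)/=; apply: lerD.
  rewrite -big_filter; apply: le_trans (hY [seq k <- r | (absz k <= N0)%N] _); last first.
    by rewrite filter_uniq.
  rewrite big_seq [leRHS]big_seq; apply: ler_sum => k; rewrite mem_filter => /andP[kN _].
  by rewrite ler_wpM2r// weight_sqr_low.
rewrite -big_filter; have := heta [seq k <- r | ~~ (absz k <= N0)%N] (filter_uniq _ ur).
have h k : k \in [seq k <- r | ~~ (absz k <= N0)%N] -> (N0 < absz k)%N.
  by rewrite mem_filter -ltnNge => /andP[].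
move=> /(_ h) {}h; apply: le_trans (ler_wpM2l (sqr_ge0 L) h).
rewrite mulr_sumr; apply: ler_sum => k _; rewrite mulrA ler_wpM2r//.
exact: weight_sqr_le.
Qed.

Lemma weighted_data_small s N0 L N d Y : 1 <= s -> 1 <= L -> (forall k, 0 <= d k) ->
  bdsum (fun k => bracket (s - 1) k * d k) Y ->
  bdsum (fun k => weight s N0 L N (absz k) ^+ 2 * d k) (L ^+ 2 * Y).
Proof.
move=> s1 L1 d0 /(bdsumZ (sqr_ge0 L)); apply: bdsum_le => k.
by rewrite mulrA ler_wpM2r// weight_sqr_le.
Qed.

Section Tail.
Variables (T mu delta H s K : R).
Hypotheses (T0 : 0 <= T) (delta0 : 0 < delta) (s1 : 1 <= s) (K1 : 1 <= K).
Hypothesis slowK : forall N0 L N, 1 <= L -> (0 < N)%N -> slow (weight s N0 L N) K.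

(** From L * N0 on the squared weight is L^2 times the Sobolev weight, while [growth] does not
    involve L; dividing gives the gain L^-2. *)
Lemma high_frequency_estimate z p N0 L Y : fourier_system T mu delta H z p ->
  (0 < N0)%N -> 1 <= L -> 0 <= Y ->
  (forall N, bdsum (fun k => weight s N0 L N (absz k) ^+ 2 * (nc (p 0 k) ^+ 2
     + (mu + 2 * (2^-1 * (H + 5))) * (k%:~R ^+ 2 * nc (z 0 k) ^+ 2))) Y) ->
  forall t, t \in `[0, T] -> forall r, uniq r ->
  (forall k, k \in r -> L * N0%:R <= (absz k)%:R) ->
  \sum_(k <- r) bracket (s - 1) k * (nc (p t k) ^+ 2 + delta * (k%:~R ^+ 2 * nc (z t k) ^+ 2))
    <= growth T delta H K * Y / L ^+ 2.
Proof.
move=> fs N00 L1 Y0 hY t tT r ur hr; have L0 := lt_le_trans ltr01 L1.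
(* The weight is frozen only beyond the list r; its upper bound depends on r, the estimate does
   not. *)
have [N rN] := seq_sub_box r.
have wM n : weight s N0 L N.+1 n <= (1 + N.+1%:R ^+ 2) `^ ((s - 1) / 2) * L.
  rewrite /weight ler_pM ?powR_ge0 ?ramp_leL//.
    by rewrite (le_trans ler01)// ramp_ge1.
  rewrite ge0_ler_powR ?nnegrE ?addr_ge0 ?sqr_ge0 ?divr_ge0 ?subr_ge0//.
  by rewrite lerD2l lerXn2r ?nnegrE// ler_nat geq_minr.
have := weighted_estimate T0 delta0 fs K1 (slowK N0 L1 (ltn0Sn N)) wM Y0 (hY _) tT ur.
rewrite ler_pdivlMr ?exprn_gt0//; apply: le_trans; rewrite mulrC mulr_sumr.
rewrite big_seq [leRHS]big_seq; apply: ler_sum => k kr.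
rewrite weight_sqr_high ?hr//; last by have := rN k kr; rewrite mem_box => /leqW.
by rewrite mulrA.
Qed.

End Tail.


(** Order of the choices: L from e and the bound Y1 on the weighted data, N0 from L and the data of
    z, the cut Kc between low and high frequencies, and finally eta. Beyond Kc both solutions are
    small; up to Kc the Sobolev weight is at most B and the unweighted estimate of the difference
    suffices. *)
Lemma continuous_dependence (T mu delta H s : R) z p Y0 e : 0 <= T -> 0 < delta -> 0 <= mu ->
  1 <= s -> fourier_system T mu delta H z p ->
  let kappa := mu + 2 * (2^-1 * (H + 5)) in
  bdsum (fun k => bracket (s - 1) k *
    (nc (p 0 k) ^+ 2 + kappa * (k%:~R ^+ 2 * nc (z 0 k) ^+ 2))) Y0 ->
  0 < e -> exists2 eta, 0 < eta & forall z' p', fourier_system T mu delta H z' p' ->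
  bdsum (fun k => bracket (s - 1) k * (nc (p' 0 k - p 0 k) ^+ 2
    + kappa * (k%:~R ^+ 2 * nc (z' 0 k - z 0 k) ^+ 2))) eta ->
  forall t, t \in `[0, T] -> bdsum (fun k => bracket (s - 1) k *
    (nc (p' t k - p t k) ^+ 2 + delta * (k%:~R ^+ 2 * nc (z' t k - z t k) ^+ 2))) e.
Proof.
move=> T0 delta0 mu0 s1 fs kappa hY0 e0.
have zT : (0 : R) \in `[0, T] by rewrite in_itv/= lexx.
have H0 := bdsum_ge0 (fs_z fs zT).
have kappa0 : 0 <= kappa by rewrite addr_ge0// !mulr_ge0 ?addr_ge0 ?invr_ge0.
have [K K1 slowK] := weight_slow s1.
(* Twice Y0 + 1, for the weighted data of z, plus twice 1, for the weighted difference of the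
   data. *)
pose Y1 := 2 * Y0 + 4; have Y00 := bdsum_ge0 hY0.
have Y10 : 0 <= Y1 by rewrite addr_ge0 ?mulr_ge0.
pose G := growth T delta H K; have G0 : 0 <= G by exact: expR_ge0.
(* Each tail is at most G * Y1 / L^2 and the squared difference at most twice their sum, so 4 * G *
   Y1 / L^2 <= e / 2 is wanted; it follows from 8 * G * Y1 / e <= L <= L^2. *)
pose L := 1 + 8 * G * Y1 / e.
have L1 : 1 <= L by rewrite lerDl divr_ge0 ?mulr_ge0 ?(ltW e0).
have L0 := lt_le_trans ltr01 L1.
have Li0 : 0 < (L ^+ 2)^-1 by rewrite invr_gt0 exprn_gt0.
have nn (a b c kap : R) : 0 <= kap -> 0 <= a ^+ 2 + kap * (b ^+ 2 * c ^+ 2).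
  by move=> kap0; exact: addr_ge0 (sqr_ge0 _) (mulr_ge0 kap0 (mulr_ge0 (sqr_ge0 _) (sqr_ge0 _))).
have tailG : 4 * (G * Y1 / L ^+ 2) <= e / 2.
  have h : 8 * G * Y1 / L ^+ 2 <= e.
    rewrite ler_pdivrMr ?exprn_gt0// -ler_pdivrMl// [leLHS]mulrC.
    apply: (@le_trans _ _ L); first by rewrite lerDr.
    by rewrite expr2 ler_peMr// ltW.
  by rewrite (_ : _ * _ = 8 * G * Y1 / L ^+ 2 / 2) ?ler_pM2r//; field; rewrite gt_eqF.
(* A tail of L^-2 offsets the amplification L^2, so that [weighted_data] adds only 1 to Y0. *)
have [N hN] := bdsum_tail (fun k => mulr_ge0 (bracket_ge0 _ k) (nn _ _ _ _ kappa0)) hY0 Li0.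
pose N0 := N.+1; pose Kc := (Num.truncn (L * N0%:R)).+1.
pose B := bracket (s - 1) Kc.
have B0 : 0 < B by rewrite (lt_le_trans ltr01)// bracket_ge1 ?subr_ge0.
have G10 : 0 < growth T delta H 1 by exact: expR_gt0.
have BG0 : 0 < B * growth T delta H 1 by rewrite mulr_gt0.
(* The first entry keeps the amplified difference of the data below 1; the second brings the low
   frequencies below e / 2. *)
pose eta := Num.min (L ^+ 2)^-1 (e / 2 / (B * growth T delta H 1)).
have eta0 : 0 < eta by rewrite lt_min Li0/= !divr_gt0.
exists eta => // z' p' fs' hd t tT r ur.
have data : forall M, bdsum (fun k => weight s N0 L M (absz k) ^+ 2 * (nc (p 0 k) ^+ 2
     + kappa * (k%:~R ^+ 2 * nc (z 0 k) ^+ 2))) (Y0 + 1).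
  move=> M; have -> : Y0 + 1 = Y0 + L ^+ 2 * (L ^+ 2)^-1.
    by rewrite divff// gt_eqF// exprn_gt0.
  apply: weighted_data => //; first by move=> k; exact: nn.
  by move=> r' ur' hr'; apply: hN => // k /hr' /ltnW.
have data' : forall M, bdsum (fun k => weight s N0 L M (absz k) ^+ 2 * (nc (p' 0 k) ^+ 2
     + kappa * (k%:~R ^+ 2 * nc (z' 0 k) ^+ 2))) Y1.
  move=> M; have hs := weighted_data_small N0 M s1 L1 (fun k => nn _ _ _ _ kappa0) hd.
  have h := bdsumD (bdsumZ (ler0n R 2) (data M)) (bdsumZ (ler0n R 2) hs).
  have hle : 2 * (Y0 + 1) + 2 * (L ^+ 2 * eta) <= Y1.
    have : L ^+ 2 * eta <= 1.
      by rewrite mulrC -ler_pdivlMr ?exprn_gt0// div1r /eta ge_min lexx.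
    by rewrite /Y1; lra.
  move=> r' ur'; apply: le_trans hle; apply: le_trans (h r' ur'); apply: ler_sum => k _.
  rewrite !(mulrCA 2) -mulrDr ler_wpM2l ?sqr_ge0//.
  have hp := nc_sqD (p' 0 k - p 0 k) (p 0 k); have hz := nc_sqD (z' 0 k - z 0 k) (z 0 k).
  rewrite !subrK in hp hz.
  have := ler_wpM2l (mulr_ge0 kappa0 (sqr_ge0 k%:~R)) hz; move: hp; clear; lra.
have dataY1 : forall M, bdsum (fun k => weight s N0 L M (absz k) ^+ 2 * (nc (p 0 k) ^+ 2
     + kappa * (k%:~R ^+ 2 * nc (z 0 k) ^+ 2))) Y1.
  by move=> M r' /(data M) /le_trans; apply; rewrite /Y1; lra.
rewrite [e]splitr (bigID (fun k => absz k <= Kc)%N)/=; apply: lerD; rewrite -big_filter.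
  set rl := [seq _ <- _ | _]; have url : uniq rl by rewrite filter_uniq.
  have hd1 : bdsum (fun k => nc (p' 0 k - p 0 k) ^+ 2
      + kappa * (k%:~R ^+ 2 * nc (z' 0 k - z 0 k) ^+ 2)) eta.
    by apply: bdsum_le hd => k; rewrite ler_peMl ?nn ?bracket_ge1 ?subr_ge0.
  have := difference_estimate T0 delta0 fs fs' (ltW eta0) hd1 tT url.
  move=> /(ler_wpM2l (ltW B0)); rewrite mulrA => h.
  have {}h := le_trans h (_ : _ <= e / 2).
  apply: (le_trans _ (h _)); last first.
    by rewrite mulrC -ler_pdivlMr// /eta ge_min lexx orbT.
  rewrite mulr_sumr big_seq [leRHS]big_seq; apply: ler_sum => k.
  rewrite mem_filter => /andP[kK _]; rewrite ler_wpM2r ?nn ?(ltW delta0)//.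
  rewrite /B /bracket !absz_sqr ge0_ler_powR ?nnegrE ?subr_ge0 ?addr_ge0 ?sqr_ge0//.
  by rewrite lerD2l lerXn2r ?nnegrE// ler_nat.
set rh := [seq _ <- _ | _]; have urh : uniq rh by rewrite filter_uniq.
have hrh k : k \in rh -> L * N0%:R <= (absz k)%:R.
  rewrite mem_filter -ltnNge => /andP[kK _]; apply: (@le_trans _ _ Kc%:R).
    by rewrite ltW// truncnS_gt.
  by rewrite ler_nat ltnW.
have h1 := high_frequency_estimate T0 delta0 s1 K1 slowK fs (ltn0Sn N) L1 Y10 dataY1 tT urh hrh.
have h2 := high_frequency_estimate T0 delta0 s1 K1 slowK fs' (ltn0Sn N) L1 Y10 data' tT urh hrh.
apply: le_trans tailG; rewrite -/G in h1 h2.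
apply: (@le_trans _ _ (2 * (G * Y1 / L ^+ 2) + 2 * (G * Y1 / L ^+ 2))); last by lra.
apply: le_trans (lerD (ler_wpM2l (ler0n R 2) h2) (ler_wpM2l (ler0n R 2) h1)).
rewrite !mulr_sumr -big_split/=; apply: ler_sum => k _.
rewrite !(mulrCA 2) -mulrDr ler_wpM2l ?bracket_ge0//.
have hp := nc_sqB (p' t k) (p t k); have hz := nc_sqB (z' t k) (z t k).
have := ler_wpM2l (mulr_ge0 (ltW delta0) (sqr_ge0 k%:~R)) hz; move: hp; clear; lra.
Qed.

End Convergence.

(** * From a solution of the equation to its Fourier system *)

Section Solution.
Variable R : realType.
Local Notation C := R[i].
Local Notation Re := complex.Re.
Variables (mu delta s T H : R) (phi0 phi1 : R -> R) (phi phi_t : R -> R -> R).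
Hypothesis s3 : 3 <= s.
Hypothesis sol : is_solution mu s T phi0 phi1 phi phi_t.

Lemma solution_sobolev t : t \in `[0, T] -> sobolev s (phi t).
Proof. by move=> /(solution_C0 sol) []. Qed.

Lemma solution_sobolev_t t : t \in `[0, T] -> sobolev (s - 1) (phi_t t).
Proof. by move=> /(solution_C1 sol) []. Qed.

Let z t k := fourier (phi t) k.
Let p t k := fourier (phi_t t) k.

(** The same inequality as for [fs_z2], keeping the full factor 1 + k^2 that [flux_fourier] asks
    for. *)
Lemma solution_wt t : bdsum (sobolev_term s (phi t)) H ->
  bdsum (fun k => wt R k * nc (z t k)) (2^-1 * (H + 5)).
Proof.
move=> hH; apply: bdsum_le (bdsumZ _ (bdsumD hH (bdsum_inv_sqr R))) => [k|]; last by lra.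
have h : (1 + k%:~R ^+ 2) ^+ 3 * nc (z t k) ^+ 2 <= sobolev_term s (phi t) k.
  by rewrite -bracket_nat ler_wpM2r ?sqr_ge0 ?bracket_le.
rewrite /wt; have x0 := bracket_base_ge1 R k.
move: (1 + k%:~R ^+ 2 : R) (nc (z t k)) x0 (nc_ge0 (z t k)) h => x u x1 u0 h.
apply: (@le_trans _ _ (2^-1 * (x ^+ 3 * u ^+ 2 + x^-1))).
  have x0 : 0 < x by exact: lt_le_trans ltr01 x1.
  rewrite [2^-1 * _]mulrC ler_pdivlMr// -subr_ge0.
  rewrite (_ : _ - _ = (x ^+ 2 * u - 1) ^+ 2 / x); last by field; rewrite gt_eqF.
  by rewrite divr_ge0 ?sqr_ge0// ltW.
by rewrite ler_wpM2l ?invr_ge0// lerD2r.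
Qed.

Lemma solution_eq_fourier t k : t \in `[0, T] -> bdsum (sobolev_term s (phi t)) H ->
  ctder T (p ^~ k) ('i%C * (k%:~R)%:C%C * fourier (flux (phi t)) k
     - (mu * k%:~R ^+ 2)%:C%C * z t k) t.
Proof.
move=> tT hH; have [phi_tt htt heq] := solution_eq sol.
have s30 : 0 <= s - 3 by rewrite subr_ge0.
have [st stt _] := htt t tT; have itt := sobolev_integrable stt.
have [iF i2 e2 _] := flux_fourier (solution_repr sol tT)
  (sobolev_periodic (solution_sobolev tT)) (solution_wt hH).
have := fourier_tder k s30 tT htt.
have iZ := torus_integrableZ mu i2.
have := weak_derivative_fourier k iF (torus_integrableB itt iZ) (heq t tT).
rewrite (fourierB _ itt iZ) (fourierZ _ _ i2) e2 => ->.
rewrite (_ : fourier (phi_tt t) k - _ - _ = fourier (phi_tt t) k)//.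
rewrite -/(z t k); case: (z t k) => a b; case: (fourier _ _) => c d.
by simpc; congr Complex; ring.
Qed.

(** H[phi]_x has the coefficients |k| z_k, so this is [quadratic_form_ge0] for the nonnegative
    function mu - delta - 2 H[phi]_x. *)
Lemma solution_coercive t P (h : int -> C) : t \in `[0, T] ->
  bdsum (sobolev_term s (phi t)) H ->
  (forall x, delta <= mu - 2 * derive1 (hilbert (phi t)) x) ->
  delta * \sum_(k <- box P) nc (h k) ^+ 2 <=
  mu * \sum_(k <- box P) nc (h k) ^+ 2
  - 2 * Re (\sum_(k <- box P) \sum_(l <- box P)
      (ak R (k - l))%:C%C * z t (k - l) * h l * (h k)^*%C).
Proof.
move=> tT hH hyp; have hw := solution_wt hH.
have z0 k : 0 <= nc (z t k) by exact: nc_ge0.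
have sphi := solution_sobolev tT; have iphi := sobolev_integrable sphi.
have hs := hilbert_series iphi (bdsum_wt z0 hw).
have hk : bdsum (fun k => ak R k * nc (hmul R k * z t k)) (2^-1 * (H + 5)).
  apply: bdsum_le (bdsum_ak z0 hw) => k; rewrite ler_wpM2l ?ak_ge0//.
  by rewrite ncM ler_piMl// nc_hmul.
have [_ hd] := fourier_series_derive hs hk.
set g := derive1 (hilbert (phi t)) in hd hyp.
have ig := fourier_series_integrable hd; have ig2 := torus_integrableZ 2 ig.
have ic := cst_torus_integrable (mu - delta).
have fc k : fourier (fun=> mu - delta) k = (if k == 0 then mu - delta else 0)%:C%C.
  rewrite -[fourier _ k]/(cmean (fun x => (mu - delta)%:C%C * expi (- (k%:~R * x)))).
  rewrite (_ : (fun x => _) = (fun x => (mu - delta)%:C%C * expi ((- k)%:~R * x))); last first.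
    by apply/funext => x; rewrite rmorphN mulNr.
  rewrite cmeanZ ?cmean_expi; last exact: cintegrable_expi.
  by rewrite oppr_eq0; case: ifP => _; rewrite ?mulr1 ?mulr0.
have := @quadratic_form_ge0 R (fun x => (mu - delta) - 2 * g x) P h
  (torus_integrableB ic ig2) (fun x => _).
have -> : Re (\sum_(k <- box P) \sum_(l <- box P)
    fourier (fun x => mu - delta - 2 * g x) (k - l) * h l * (h k)^*%C) =
  (mu - delta) * \sum_(k <- box P) nc (h k) ^+ 2
  - 2 * Re (\sum_(k <- box P) \sum_(l <- box P)
      (ak R (k - l))%:C%C * z t (k - l) * h l * (h k)^*%C).
  rewrite !Re_sum !mulr_sumr -sumrB big_seq [RHS]big_seq; apply: eq_bigr => k kP.
  transitivity (Re (\sum_(l <- box P | l == k) (mu - delta)%:C%C * (h l * (h k)^*%C)) -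
    2 * Re (\sum_(l <- box P) (ak R (k - l))%:C%C * z t (k - l) * h l * (h k)^*%C)).
    rewrite !Re_sum mulr_sumr [X in _ = X - _]big_mkcond/= -sumrB; apply: eq_bigr => l _.
    rewrite (fourierB _ ic ig2) (fourierZ _ _ ig) (fourier_of_series hd) fc subr_eq0 eq_sym.
    have -> : 'i%C * ((k - l)%:~R)%:C%C * (hmul R (k - l) * fourier (phi t) (k - l)) =
       (ak R (k - l))%:C%C * z t (k - l).
      rewrite hmulE /ak normrEsg -/(z t (k - l)).
      by case: (z t _) => a b; simpc; congr Complex; ring.
    have E (a b u v : C) : (a - 2%:C%C * b) * u * v = a * (u * v) - 2%:C%C * (b * u * v) by ring.
    by rewrite E ReD ReN !ReZ; congr (_ - _); case: (l == k); rewrite ?mul0r.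
  by rewrite big_box_delta// mulcJ ReZ.
move=> /(_ _) q; have {}q := q (fun x => _).
have : 0 <= (mu - delta) * \sum_(k <- box P) nc (h k) ^+ 2
  - 2 * Re (\sum_(k <- box P) \sum_(l <- box P)
      (ak R (k - l))%:C%C * z t (k - l) * h l * (h k)^*%C).
  by apply: q => x; have := hyp x; lra.
lra.
Qed.

Lemma solution_fourier_system :
  (forall t, t \in `[0, T] -> bdsum (sobolev_term s (phi t)) H) ->
  (forall t, t \in `[0, T] -> bdsum (sobolev_term (s - 1) (phi_t t)) H) ->
  hyperbolic mu delta T phi -> fourier_system T mu delta H z p.
Proof.
move=> hz hp hyp; split.
- by move=> t tT k; apply: fourierN_conj; exact: sobolev_integrable (solution_sobolev tT).
- move=> t tT k; apply: (@fourier_tder R T (s - 1)) => //; last exact: (solution_dt sol).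
  by rewrite subr_ge0 (le_trans _ s3)// ler1n.
- exists (fun t k => 'i%C * (k%:~R)%:C%C * fourier (flux (phi t)) k).
    by move=> t tT k; apply: solution_eq_fourier => //; exact: hz.
  move=> t tT; have [_ _ _ h] := flux_fourier (solution_repr sol tT)
    (sobolev_periodic (solution_sobolev tT)) (solution_wt (hz t tT)).
  exact: h.
- move=> t tT; apply: bdsum_le (hz t tT) => k.
  by rewrite -bracket_nat ler_wpM2r ?sqr_ge0 ?bracket_le.
- move=> t tT; apply: bdsum_le (hp t tT) => k.
  by rewrite -bracket_nat ler_wpM2r ?sqr_ge0// bracket_le// lerBrDr -(natrD _ 2 1).
- by move=> t tT P h; apply: solution_coercive => //; [exact: hz|move=> x; exact: hyp].
Qed.

Lemma tder_const (f : R -> R) : (forall t, t \in `[0, T] -> tder T f 0 t) ->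
  forall t, t \in `[0, T] -> f t = f 0.
Proof.
move=> hf t tT; apply/eqP; rewrite eq_le; apply/andP; split.
  have := @gronwall R T f (fun=> 0) 0 0 hf (lexx _) (lexx _) _ t tT.
  by rewrite !mul0r expR0 mul1r addr0; apply=> u _; rewrite mul0r addr0.
have hN u : u \in `[0, T] -> tder T (fun t => - f t) 0 u.
  by move=> /hf /tderN; rewrite oppr0.
have := @gronwall R T (fun t => - f t) (fun=> 0) 0 0 hN (lexx _) (lexx _) _ t tT.
rewrite !mul0r expR0 mul1r addr0 lerN2; apply=> u _; by rewrite mul0r addr0.
Qed.

Lemma ctder_const (f : R -> C) : (forall t, t \in `[0, T] -> ctder T f 0 t) ->
  forall t, t \in `[0, T] -> f t = f 0.
Proof.
move=> hf t tT.
have hR := tder_const (f := fun t => Re (f t)) (fun t tT => (hf t tT).1) tT.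
have hI := tder_const (f := fun t => complex.Im (f t)) (fun t tT => (hf t tT).2) tT.
by move: hR hI; case: (f t) (f 0) => ? ? [? ?] /= -> ->.
Qed.

Hypotheses (m0 : zero_mean phi0) (m1 : zero_mean phi1).
Hypotheses (sob0 : sobolev s phi0) (sob1 : sobolev (s - 1) phi1).

Lemma zero_mean_fourier f : torus_integrable f -> zero_mean f -> fourier f 0 = 0 :> C.
Proof.
move=> hf f0; rewrite fourierE//.
have -> : torus_int (fun x => f x * cos (0%:~R * x)) = 0.
  by rewrite -[RHS]f0; congr torus_int; apply/funext => x; rewrite mul0r cos0 mulr1.
have -> : torus_int (fun x => f x * sin (0%:~R * x)) = 0.
  rewrite (_ : (fun _ => _) = fun=> 0) ?torus_int_cst ?mulr0//.
  by apply/funext => x; rewrite mul0r sin0 mulr0.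
by rewrite oppr0 mulr0.
Qed.

Hypothesis T0 : 0 <= T.

Lemma solution_initial k : z 0 k = fourier phi0 k.
Proof.
have zT : (0 : R) \in `[0, T] by rewrite in_itv/= lexx.
apply: fourier_ae; last exact: solution_init0 sol.
  exact: sobolev_measurable (solution_sobolev zT).
exact: sobolev_measurable sob0.
Qed.

Lemma solution_initial_t k : p 0 k = fourier phi1 k.
Proof.
have zT : (0 : R) \in `[0, T] by rewrite in_itv/= lexx.
apply: fourier_ae; last exact: solution_init1 sol.
  exact: sobolev_measurable (solution_sobolev_t zT).
exact: sobolev_measurable sob1.
Qed.

(** The energy controls k^2 |z_k|^2 and says nothing at k = 0. There both terms of the equation
    carry a factor k, so the mean of phi_t is conserved, hence 0, and then so is that of phi. *)
Lemma solution_zero_mode t :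
  (forall t, t \in `[0, T] -> bdsum (sobolev_term s (phi t)) H) ->
  t \in `[0, T] -> z t 0 = 0.
Proof.
move=> hz tT.
have pt u : u \in `[0, T] -> p u 0 = 0.
  move=> uT; transitivity (p 0 0).
    apply: (ctder_const (f := fun t => p t 0)) uT => v vT.
    have := solution_eq_fourier 0 vT (hz v vT).
    by rewrite expr0n mulr0 rmorph0 !(mulr0, mul0r) subr0.
  by rewrite solution_initial_t zero_mean_fourier//; exact: sobolev_integrable sob1.
transitivity (z 0 0).
  apply: (ctder_const (f := fun t => z t 0)) tT => v vT; rewrite -(pt v vT).
  apply: (@fourier_tder R T (s - 1)) => //; last exact: (solution_dt sol).
  by rewrite subr_ge0 (le_trans _ s3)// ler1n.
by rewrite solution_initial zero_mean_fourier//; exact: sobolev_integrable sob0.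
Qed.

End Solution.

(** * Translation into the norms of the theorem *)

Section Assembly.
Variable R : realType.
Local Notation C := R[i].
Implicit Types (f g : R -> R) (s c : R) (k : int).

Lemma cvge0_of_near (u : nat -> \bar R) : (forall n, (0 <= u n)%E) ->
  (forall e : R, 0 < e -> \forall n \near \oo, (u n <= e%:E)%E) -> u @ \oo --> 0%E.
Proof.
move=> u0 hu; apply/fine_cvgP; split.
  by apply: filterS (hu 1 ltr01) => n un; rewrite ge0_fin_numE// (le_lt_trans un)// ltry.
apply/cvgrPdist_le => e /hu; apply: filterS => n un /=.
by rewrite sub0r normrN ger0_norm ?fine_ge0// -lee_fin fineK// ge0_fin_numE// (le_lt_trans un)// ltry.
Qed.

Lemma sobolev_termB s f g k : torus_integrable f -> torus_integrable g ->
  sobolev_term s (f \- g) k = bracket s k * nc (fourier f k - fourier g k) ^+ 2.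
Proof. by move=> hf hg; rewrite -fourierB. Qed.

Lemma bracketS s k : bracket s k = bracket (s - 1) k * (1 + k%:~R ^+ 2).
Proof.
rewrite -[X in _ * X]powRr1 ?(le_trans ler01 (bracket_base_ge1 R k))//.
by rewrite /bracket -powRD ?subrK// (gt_eqF (lt_le_trans ltr01 (bracket_base_ge1 R k))) implybT.
Qed.

Lemma bracket_sqr_le s k : bracket (s - 1) k * k%:~R ^+ 2 <= bracket s k.
Proof. by rewrite [leRHS]bracketS ler_wpM2l ?bracket_ge0// lerDr. Qed.

Lemma bracket_le_sqr s k : k != 0 -> bracket s k <= 2 * (bracket (s - 1) k * k%:~R ^+ 2).
Proof.
move=> k0; rewrite bracketS mulrCA ler_wpM2l ?bracket_ge0// mulr_natl mulr2n lerD2r.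
rewrite absz_sqr exprn_ege1// ler1n; lia.
Qed.

Lemma energy_bound_bdsum s (T C2 c0 c1 : R) phi0 phi1 (phi phi_t : R -> R -> R) t : 0 < C2 ->
  energy_bound s T C2 phi0 phi1 phi phi_t ->
  bdsum (sobolev_term s phi0) c0 -> bdsum (sobolev_term (s - 1) phi1) c1 ->
  t \in `[0, T] ->
  bdsum (sobolev_term s (phi t)) (C2 * (c0 + c1)) /\
  bdsum (sobolev_term (s - 1) (phi_t t)) (C2 * (c0 + c1)).
Proof.
move=> C20 hb /esum_leP h0 /esum_leP h1 tT.
have {}h0 := h0 (sobolev_term_ge0 _ _); have {}h1 := h1 (sobolev_term_ge0 _ _).
have subst (x y x' y' a b a' b' : \bar R) : x = a -> y = b -> x' = a' -> y' = b' ->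
  (x + y <= C2%:E * (x' + y') -> a + b <= C2%:E * (a' + b'))%E by move=> -> -> -> ->.
have h := subst _ _ _ _ _ _ _ _ (sobolev_norm_sq s (phi t))
  (sobolev_norm_sq (s - 1) (phi_t t)) (sobolev_norm_sq s phi0) (sobolev_norm_sq (s - 1) phi1)
  (hb t tT).
have {}h := le_trans h (lee_wpmul2l _ (leeD h0 h1)); rewrite -EFinD -EFinM in h.
have {}h := h (ltW C20).
have p0 s' f : (0 <= \esum_(k in [set: int]) (sobolev_term s' f k)%:E)%E.
  by apply: esum_ge0 => k _; rewrite lee_fin sobolev_term_ge0.
split; apply/esum_leP; try exact: sobolev_term_ge0; apply: le_trans h.
  by rewrite leeDl.
by rewrite leeDr.
Qed.

(** The constant is that of |u|^2 <= 2 |u - v|^2 + 2 |v|^2, once the distance to f is at most 1. *)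
Lemma sobolev_bdsum_near s f (fn : nat -> R -> R) c : 0 <= s ->
  sobolev s f -> (forall n, sobolev s (fn n)) ->
  sobolev_norm s (fn n \- f) @[n --> \oo] --> 0%E ->
  bdsum (sobolev_term s f) c ->
  \forall n \near \oo, bdsum (sobolev_term s (fn n)) (2 + 2 * c).
Proof.
move=> s0 sf sfn cf hc; apply: filterS (cvge0_near _ cf ltr01) => n.
move/(sobolev_norm_leP _ _ ler01); rewrite expr1n => h.
have := bdsumD (bdsumZ (ler0n R 2) h) (bdsumZ (ler0n R 2) hc); rewrite mulr1.
apply: bdsum_le => k.
rewrite sobolev_termB; [|exact: sobolev_integrable (sfn n)|exact: sobolev_integrable sf].
rewrite /sobolev_term; set b := bracket s k.
rewrite (_ : 2 * _ + _ = b * (2 * nc (fourier (fn n) k - fourier f k) ^+ 2 +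
  2 * nc (fourier f k) ^+ 2)); last by ring.
rewrite ler_wpM2l ?bracket_ge0//.
by have := nc_sqD (fourier (fn n) k - fourier f k) (fourier f k); rewrite subrK.
Qed.

Lemma norm_C0_le (T s c : R) (u : R -> R -> R) :
  (forall t, t \in `[0, T] -> (sobolev_norm s (u t) <= c%:E)%E) ->
  (norm_C0 T s u <= c%:E)%E.
Proof. by move=> h; apply: ge_ereal_sup => _ [t tT <-]; exact: h. Qed.

Lemma norm_C0_ge0 (T s : R) (u : R -> R -> R) : 0 <= T -> (0 <= norm_C0 T s u)%E.
Proof.
move=> T0; apply: le_trans (sobolev_norm_ge0 s (u 0)) _.
by apply: ereal_sup_ubound; exists 0 => //=; rewrite in_itv/= lexx.
Qed.

Lemma norm_C1_distance_le (T s c : R) (u v u' v' : R -> R -> R) : 0 <= c ->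
  (forall t, t \in `[0, T] -> [/\ torus_integrable (u t), torus_integrable (v t),
     torus_integrable (u' t) & torus_integrable (v' t)]) ->
  (forall t, t \in `[0, T] ->
     bdsum (fun k => bracket s k * nc (fourier (u' t) k - fourier (u t) k) ^+ 2) (c ^+ 2)) ->
  (forall t, t \in `[0, T] ->
     bdsum (fun k => bracket (s - 1) k * nc (fourier (v' t) k - fourier (v t) k) ^+ 2) (c ^+ 2)) ->
  (norm_C0 T s (fun t => (u' t \- u t)%R) +
   norm_C1 T (s - 1) (fun t => (u' t \- u t)%R) (fun t => (v' t \- v t)%R)
     <= (3 * c)%:E)%E.
Proof.
move=> c0 hi hu hv.
have h1 : (norm_C0 T s (fun t => (u' t \- u t)%R) <= c%:E)%E.
  apply: norm_C0_le => t tT; have [i1 _ i3 _] := hi t tT.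
  apply/(sobolev_norm_leP _ _ c0); apply: bdsum_le (hu t tT) => k.
  by rewrite sobolev_termB.
have h2 : (norm_C0 T (s - 1) (fun t => (u' t \- u t)%R) <= c%:E)%E.
  apply: norm_C0_le => t tT; have [i1 _ i3 _] := hi t tT.
  apply/(sobolev_norm_leP _ _ c0); apply: bdsum_le (hu t tT) => k.
  by rewrite sobolev_termB// ler_wpM2r ?sqr_ge0// bracket_le// gerBl.
have h3 : (norm_C0 T (s - 1) (fun t => (v' t \- v t)%R) <= c%:E)%E.
  apply: norm_C0_le => t tT; have [_ i2 _ i4] := hi t tT.
  apply/(sobolev_norm_leP _ _ c0); apply: bdsum_le (hv t tT) => k.
  by rewrite sobolev_termB.
apply: le_trans (leeD h1 (leeD h2 h3)) _.
by rewrite -!EFinD lee_fin; lra.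
Qed.

End Assembly.

Theorem theorem2 (R : realType) (s mu delta : R)
    (phi0 phi1 : R -> R) (phi0n phi1n : nat -> R -> R)
    (T C2 : R) (phi phi_t : R -> R -> R) (phin phin_t : nat -> R -> R -> R)
    (hs : 3 <= s) (hdelta : 0 < delta) (hmu : delta < mu)
    (hphi0 : sobolev s phi0) (hphi1 : sobolev (s - 1) phi1)
    (hphi0n : forall n, sobolev s (phi0n n))
    (hphi1n : forall n, sobolev (s - 1) (phi1n n))
    (mphi0 : zero_mean phi0) (mphi1 : zero_mean phi1)
    (mphi0n : forall n, zero_mean (phi0n n))
    (mphi1n : forall n, zero_mean (phi1n n))
    (cphi0n : sobolev_norm s (phi0n n \- phi0) @[n --> \oo] --> 0%E)
    (cphi1n : sobolev_norm (s - 1) (phi1n n \- phi1) @[n --> \oo] --> 0%E)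
    (hT : 0 < T)
    (hsol : is_unique_solution mu s T phi0 phi1 phi phi_t)
    (hsoln : forall n,
      is_unique_solution mu s T (phi0n n) (phi1n n) (phin n) (phin_t n))
    (hC2 : 0 < C2)
    (hhyp : hyperbolic mu delta T phi)
    (hbound : energy_bound s T C2 phi0 phi1 phi phi_t)
    (hhypn : forall n, hyperbolic mu delta T (phin n))
    (hboundn : forall n,
      energy_bound s T C2 (phi0n n) (phi1n n) (phin n) (phin_t n)) :
  (norm_C0 T s (fun t => (phin n t \- phi t)%R) +
   norm_C1 T (s - 1) (fun t => (phin n t \- phi t)%R)
                     (fun t => (phin_t n t \- phi_t t)%R))%E
    @[n --> \oo] --> 0%E.
Proof.
have T0 := ltW hT; have s0 : 0 <= s by exact: le_trans (ler0n _ 3) hs.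
have s1 : 1 <= s by rewrite (le_trans _ hs)// ler1n.
have s10 : 0 <= s - 1 by rewrite subr_ge0.
have mu0 : 0 <= mu by rewrite (le_trans (ltW hdelta))// ltW.
have sol := hsol.1; have soln n := (hsoln n).1.
have [c0 hc0] := sobolev_bdsum (sobolev_finite hphi0).
have [c1 hc1] := sobolev_bdsum (sobolev_finite hphi1).
have c00 := bdsum_ge0 hc0; have c10 := bdsum_ge0 hc1.
(* One constant for the limit and for all large n: eventually the data of [phin n] obey the bounds 2
   + 2 * c0 and 2 + 2 * c1, which the limit data obey too. *)
pose H := C2 * (2 + 2 * c0 + (2 + 2 * c1)).
have bd c c' (a : int -> R) : c <= c' -> bdsum a c -> bdsum a c'.
  by move=> cc' ha r ur; exact: le_trans (ha r ur) cc'.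
have hz t : t \in `[0, T] -> bdsum (sobolev_term s (phi t)) H /\
    bdsum (sobolev_term (s - 1) (phi_t t)) H.
  have w0 : bdsum (sobolev_term s phi0) (2 + 2 * c0) by apply: bd hc0; lra.
  have w1 : bdsum (sobolev_term (s - 1) phi1) (2 + 2 * c1) by apply: bd hc1; lra.
  by move=> tT; exact: energy_bound_bdsum hC2 hbound w0 w1 tT.
have fs := solution_fourier_system hs sol (fun t tT => (hz t tT).1)
  (fun t tT => (hz t tT).2) hhyp.
have zT : (0 : R) \in `[0, T] by rewrite in_itv/= lexx.
have H0 := bdsum_ge0 (fs_z fs zT).
pose kappa := mu + 2 * (2^-1 * (H + 5)).
have kappa0 : 0 <= kappa by rewrite addr_ge0// !mulr_ge0 ?addr_ge0 ?invr_ge0.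
have data (a b : int -> R) ca cb : (forall k, 0 <= a k) -> (forall k, 0 <= b k) ->
    bdsum (fun k => bracket s k * a k) ca -> bdsum (fun k => bracket (s - 1) k * b k) cb ->
    bdsum (fun k => bracket (s - 1) k * (b k + kappa * (k%:~R ^+ 2 * a k))) (cb + kappa * ca).
  move=> a0 b0 ha hb; apply: bdsum_le (bdsumD hb (bdsumZ kappa0 ha)) => k.
  rewrite mulrDr lerD2l mulrCA ler_wpM2l// mulrA ler_wpM2r//; exact: bracket_sqr_le.
have hY0 : bdsum (fun k => bracket (s - 1) k * (nc (fourier (phi_t 0) k) ^+ 2
    + kappa * (k%:~R ^+ 2 * nc (fourier (phi 0) k) ^+ 2))) (c1 + kappa * c0).
  apply: data => [k|k||]; try exact: sqr_ge0.
    by apply: bdsum_le hc0 => k; rewrite (solution_initial sol hphi0 T0).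
  by apply: bdsum_le hc1 => k; rewrite (solution_initial_t sol hphi1 T0).
apply: cvge0_of_near => [n|e e0].
  by rewrite !adde_ge0 ?norm_C0_ge0.
(* Three suprema add up: phin n - phi in H^s and in H^(s-1), and the time derivatives in H^(s-1). *)
pose c := e / 3; have cp : 0 < c by rewrite divr_gt0.
(* The energy controls delta * k^2 times the bracket of order s - 1; for k <> 0 the bracket of order
   s is at most 2 k^2 times that one, which costs the factor 2 / delta. *)
pose e' := Num.min (c ^+ 2) (c ^+ 2 * delta / 2).
have e'0 : 0 < e' by rewrite lt_min exprn_gt0//= divr_gt0// mulr_gt0// exprn_gt0.
have [eta eta0 heta] := continuous_dependence T0 hdelta mu0 s1 fs hY0 e'0.
(* As d <= 1, one has d^2 <= d and thus (1 + kappa) d^2 <= eta. *)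
pose d := Num.min 1 (eta / (1 + kappa)).
have d0 : 0 < d by rewrite lt_min ltr01 divr_gt0// ltr_wpDr.
have deta : d ^+ 2 + kappa * d ^+ 2 <= eta.
  rewrite -[X in X + _]mul1r -mulrDl mulrC -ler_pdivlMr ?ltr_wpDr//.
  apply: (@le_trans _ _ d); last by rewrite ge_min lexx orbT.
  by rewrite expr2 ler_piMl ?(ltW d0)// ge_min lexx.
have evb0 := sobolev_bdsum_near s0 hphi0 hphi0n cphi0n hc0.
have evb1 := sobolev_bdsum_near s10 hphi1 hphi1n cphi1n hc1.
have evd0 := cvge0_near eventually_filter cphi0n d0; have evd1 := cvge0_near eventually_filter cphi1n d0.
apply: filterS (filterI (filterI evb0 evb1) (filterI evd0 evd1)) => n [[hb0 hb1] [hd0 hd1]].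
have hzn t (tT : t \in `[0, T]) := energy_bound_bdsum hC2 (hboundn n) hb0 hb1 tT.
have fsn := solution_fourier_system hs (soln n) (fun t tT => (hzn t tT).1)
  (fun t tT => (hzn t tT).2) (hhypn n).
have i0 := sobolev_integrable hphi0; have i1 := sobolev_integrable hphi1.
have i0n := sobolev_integrable (hphi0n n); have i1n := sobolev_integrable (hphi1n n).
have hdata : bdsum (fun k => bracket (s - 1) k *
    (nc (fourier (phin_t n 0) k - fourier (phi_t 0) k) ^+ 2
    + kappa * (k%:~R ^+ 2 * nc (fourier (phin n 0) k - fourier (phi 0) k) ^+ 2))) eta.
  apply: bd deta _; apply: data => [k|k||]; try exact: sqr_ge0.
    move/(sobolev_norm_leP _ _ (ltW d0)) : hd0; apply: bdsum_le => k.
    rewrite (solution_initial sol hphi0 T0) (solution_initial (soln n) (hphi0n n) T0).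
    by rewrite sobolev_termB.
  move/(sobolev_norm_leP _ _ (ltW d0)) : hd1; apply: bdsum_le => k.
  rewrite (solution_initial_t sol hphi1 T0) (solution_initial_t (soln n) (hphi1n n) T0).
  by rewrite sobolev_termB.
have key := heta _ _ fsn hdata.
rewrite [e](_ : _ = 3 * c); last by rewrite /c mulrC divfK.
apply: norm_C1_distance_le; first exact: ltW.
- move=> t tT; split.
  + exact: sobolev_integrable (solution_sobolev sol tT).
  + exact: sobolev_integrable (solution_sobolev_t sol tT).
  + exact: sobolev_integrable (solution_sobolev (soln n) tT).
  + exact: sobolev_integrable (solution_sobolev_t (soln n) tT).
- move=> t tT.
  have ce : 2 / delta * e' <= c ^+ 2.
    rewrite mulrAC ler_pdivrMr// mulrC -ler_pdivlMr//.
    by rewrite /e' ge_min lexx orbT.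
  apply: bd ce _.
  apply: bdsum_le (bdsumZ _ (key t tT)) => [k|]; last by rewrite divr_ge0 ?(ltW hdelta).
  (* The comparison of brackets fails at k = 0, where both coefficients vanish by
     [solution_zero_mode]. *)
  have [->|k0] := eqVneq k 0.
    rewrite (solution_zero_mode hs sol mphi0 mphi1 hphi0 hphi1 T0 (fun t tT => (hz t tT).1) tT).
    rewrite (solution_zero_mode hs (soln n) (mphi0n n) (mphi1n n) (hphi0n n) (hphi1n n) T0
      (fun t tT => (hzn t tT).1) tT).
    rewrite subrr nc0 expr0n/= mulr0.
    have h := addr_ge0 (sqr_ge0 (nc (fourier (phin_t n t) 0 - fourier (phi_t t) 0)))
      (mulr_ge0 (ltW hdelta) (mulr_ge0 (sqr_ge0 (0%:~R : R)) (sqr_ge0 (nc (0 : R[i]))))).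
    move: h; rewrite nc0 expr0n/= => h.
    by rewrite mulr_ge0 ?divr_ge0 ?(ltW hdelta)// mulr_ge0 ?bracket_ge0.
  apply: (@le_trans _ _ (2 * (bracket (s - 1) k * k%:~R ^+ 2) *
      nc (fourier (phin n t) k - fourier (phi t) k) ^+ 2)).
    by rewrite ler_wpM2r ?sqr_ge0// bracket_le_sqr.
  set u := nc (fourier (phin n t) k - fourier (phi t) k).
  rewrite (_ : 2 * _ * _ = 2 / delta * (bracket (s - 1) k * (delta * (k%:~R ^+ 2 * u ^+ 2)))).
    rewrite ler_wpM2l ?divr_ge0 ?(ltW hdelta)// ler_wpM2l ?bracket_ge0// lerDr.
    exact: sqr_ge0.
  by field; rewrite gt_eqF.
- move=> t tT; have ce : e' <= c ^+ 2 by rewrite ge_min lexx.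
  apply: bd ce _; apply: bdsum_le (key t tT) => k.
  rewrite ler_wpM2l ?bracket_ge0// lerDl.
  exact: mulr_ge0 (ltW hdelta) (mulr_ge0 (sqr_ge0 _) (sqr_ge0 _)).
Qed.
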